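(* Let $f\in\mathcal{A}$, let $$\mathcal{G}(z):=1-\frac{zf'(z)}{f(z)}+\frac{zf''(z)}{f'(z)},\qquad z\in\mathbb{D},$$ let $\varphi_{\mathrm{cr}}(z):=z+\sqrt{1+z^2}$ for $z\in\mathbb{D}$, and let $\beta\in\mathbb{R}$. Then each of the following conditions implies that $f$ is a member of $\mathcal{S}^*_{Ne}$: (a) $1+\beta\,\mathcal{G}(z)\left(\dfrac{zf'(z)}{f(z)}\right)\prec\varphi_{\mathrm{cr}}(z)$, for $\beta\geq\dfrac{3\left(\sqrt{2}-\log(1+\sqrt{2})+\log2\right)}{2}$; (b) $1+\beta\,\mathcal{G}(z)\prec\varphi_{\mathrm{cr}}(z)$, for $\beta\geq\dfrac{\sqrt{2}+\log2-\log(1+\sqrt{2})}{\log(5/3)}$; (c) $1+\beta\,\mathcal{G}(z)\left(\dfrac{zf'(z)}{f(z)}\right)^{-1}\prec\varphi_{\mathrm{cr}}(z)$, for $\beta\geq\dfrac{5\left(\sqrt{2}-\log(1+\sqrt{2})+\log2\right)}{2}$. Each estimate on $\beta$ is sharp.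
   Context: $\mathbb{D}=\{z\in\mathbb{C}:|z|<1\}$, $\mathcal{H}$ is the set of all analytic functions on $\mathbb{D}$, and $\mathcal{A}$ is the set of $f\in\mathcal{H}$ with $f(0)=0$ and $f'(0)=1$. For $f,g\in\mathcal{H}$, $f\prec g$ ($f$ is subordinate to $g$) means that there is $w\in\mathcal{H}$ with $w(0)=0$ and $|w(z)|<1$ for $z\in\mathbb{D}$ such that $f(z)=g(w(z))$ on $\mathbb{D}$; in particular, writing a subordination presupposes that both sides are analytic in $\mathbb{D}$ (the removable singularity of $zf'(z)/f(z)$ at $0$ being filled with value $1$). With $\varphi_{Ne}(z):=1+z-z^3/3$, $\mathcal{S}^*_{Ne}:=\{f\in\mathcal{A}:zf'(z)/f(z)\prec\varphi_{Ne}(z)\}$. The square root is the principal branch (so $\varphi_{\mathrm{cr}}(0)=1$) and $\log$ of a positive number is the natural logarithm. That an estimate $\beta\ge\beta_0$ is sharp means that $\beta_0$ cannot be replaced by any smaller real number so that the implication remains valid for all $f\in\mathcal{A}$ and all $\beta$ at least that number. *)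

(* Defs.v *)
From Stdlib Require Import Reals.
From Coquelicot Require Import Coquelicot.

Local Open Scope C_scope.

Definition unit_disc (z : C) : Prop := (Cmod z < 1)%R.

(* A function on the disc is represented by a total [f : C -> C], whose values
   outside the disc are irrelevant: the radius [r] may depend on [z0], so it
   can always be taken small enough for the ball to stay inside the disc. *)
Definition analytic_on_disc (f : C -> C) : Prop :=
  forall z0 : C, unit_disc z0 ->
  exists (r : R) (a : nat -> C), (0 < r)%R /\
    forall z : C, (Cmod (z - z0) < r)%R ->
      @is_pseries C_AbsRing C_NormedModule a (z - z0) (f z).

Definition class_A (f : C -> C) : Prop :=
  analytic_on_disc f /\ f 0 = 0 /\ C_derive f 0 = 1.

Definition subordinate (f g : C -> C) : Prop :=
  analytic_on_disc f /\ analytic_on_disc g /\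
  exists w : C -> C,
    analytic_on_disc w /\ w 0 = 0 /\
    (forall z : C, unit_disc z -> (Cmod (w z) < 1)%R) /\
    (forall z : C, unit_disc z -> f z = g (w z)).

(* Principal branch (argument in (-PI, PI]): the value has nonnegative real
   part, and lies on the positive imaginary axis when z < 0. *)
Definition Csqrt (z : C) : C :=
  (sqrt ((Cmod z + Re z) / 2),
   if Rlt_dec (Im z) 0 then (- sqrt ((Cmod z - Re z) / 2))%R
   else sqrt ((Cmod z - Re z) / 2))%R.

Definition phi_cr (z : C) : C := z + Csqrt (1 + z ^ 2).

Definition phi_Ne (z : C) : C := 1 + z - z ^ 3 / 3.

(* z f'(z) / f(z), with its removable singularity at 0 filled for f in A *)
Definition zdlog (f : C -> C) (z : C) : C :=
  if Ceq_dec z 0 then 1 else z * C_derive f z / f z.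

Definition calG (f : C -> C) (z : C) : C :=
  1 - zdlog f z + z * C_derive (C_derive f) z / C_derive f z.

(* Division is total in Coquelicot ([/ 0] is a junk value), so the two
   predicates below say explicitly when [zdlog f], respectively [calG f], is a
   genuine function on the disc. *)
Definition zdlog_defined (f : C -> C) : Prop :=
  forall z : C, unit_disc z -> z <> 0 -> f z <> 0.

Definition calG_defined (f : C -> C) : Prop :=
  zdlog_defined f /\ forall z : C, unit_disc z -> C_derive f z <> 0.

Definition starlike_Ne (f : C -> C) : Prop :=
  class_A f /\ zdlog_defined f /\ subordinate (zdlog f) phi_Ne.

(* [lhs beta f] is an expression in [zdlog f] and [calG f]. *)
Definition sufficient_from (lhs : R -> (C -> C) -> C -> C) (beta0 : R) : Prop :=
  forall (f : C -> C) (beta : R),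
    class_A f -> (beta0 <= beta)%R ->
    calG_defined f -> subordinate (lhs beta f) phi_cr ->
    starlike_Ne f.

Definition sharp_sufficient_from
    (lhs : R -> (C -> C) -> C -> C) (beta0 : R) : Prop :=
  sufficient_from lhs beta0 /\
  forall beta1 : R, (beta1 < beta0)%R -> ~ sufficient_from lhs beta1.

(* Main.v *)
Require Import Defs.
From Stdlib Require Import Reals Lra Lia Psatz.
From Coquelicot Require Import Coquelicot.

(* Write p = z f' / f, so that G p = z p'. The hypothesis reads
   beta z h' = phi_cr(w) - 1 with h = p - 1, h = log p, h = 1 - 1/p in the cases
   (a), (b), (c). By the Schwarz lemma |w(z)| <= |z|, and
   |phi_cr(zeta) - 1| <= phi_cr(|zeta|) - 1, so integrating along radii
   |h| < K / beta with K = int_0^1 (phi_cr(t) - 1) / t dt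
                         = sqrt 2 - log (1 + sqrt 2) + log 2.
   In each case the bound on beta turns this into |p - 1| < 2/3. On the unit
   circle |zeta - zeta^3/3| >= 2/3, so that disc lies in phi_Ne(D), where phi_Ne is
   univalent, and p is subordinate to phi_Ne. For smaller beta, w(z) = z gives a
   p with real values beyond 5/3 on (0, 1), whereas the real values of phi_Ne on
   the disc are below 5/3.

   Passing between complex differentiability and power series rests on Cauchy's
   formula on circles, obtained by contracting the circle to a point. *)

Local Open Scope C_scope.

(** * Complex differentiability *)

(** The constant [K] is common to all three thresholds because only the passage from [h] to [p]
    differs: [|h| < c] forces [|p - 1| < 2/3] with [c = 2/3] for [p = 1 + h], [c = log (5/3)] for
    [p = exp h], [c = 2/5] for [p = 1 / (1 - h)]. Each [c] is the positive [h] at which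
    [p = 5/3 = phi_Ne 1]. All modulus estimates are equalities on the positive real axis, so one
    extremal function serves every case.

    The obstacle is that subordination asks for an analytic [w], and analytic means local power
    series. The inverse of [phi_Ne] is shown to be continuously differentiable, and Cauchy's formula
    upgrades this to power series. The same upgrade yields the closure properties, an expansion at 0
    valid on the whole disc (hence division by [z] and primitives) and, applied to powers, a maximum
    principle from which the Schwarz lemma follows.

    Validity from [beta1] on covers every larger [beta], so it is refuted at some [beta] between
    9/10 of the threshold and the threshold; there [p] has no zeros, however small [beta1] is. *)

Lemma Cmod_triangle' (x y : C) : (Cmod (x - y) <= Cmod x + Cmod y)%R.
Proof.
  unfold Cminus. rewrite <- (Cmod_opp y). apply Cmod_triangle.
Qed.

Lemma Cmod_triangle_inv (x y : C) : (Cmod x - Cmod y <= Cmod (x - y))%R.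
Proof.
  replace x with ((x - y) + y) at 1 by ring.
  generalize (Cmod_triangle (x - y) y). lra.
Qed.

Lemma im_le_Cmod (c : C) : (Rabs (Im c) <= Cmod c)%R.
Proof.
  eapply Rle_trans; [ | apply Rmax_Cmod ]. apply Rmax_r.
Qed.

Lemma Cmod_sqr (c : C) : (Cmod c * Cmod c = Re c * Re c + Im c * Im c)%R.
Proof. generalize (Cmod2_alt c). simpl. lra. Qed.

Definition Ccont (f : C -> C) (z : C) : Prop :=
  forall eps : R, (0 < eps)%R -> exists d : R, (0 < d)%R /\
    forall y : C, (Cmod (y - z) < d)%R -> (Cmod (f y - f z) < eps)%R.

Lemma Ccont_const (c z : C) : Ccont (fun _ => c) z.
Proof.
  intros eps He. exists 1%R. split; [lra|]. intros y _.
  replace (c - c) with (RtoC 0) by ring. rewrite Cmod_0. exact He.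
Qed.

Lemma Ccont_id (z : C) : Ccont (fun x => x) z.
Proof. intros eps He. exists eps. auto. Qed.

Lemma Ccont_ext_loc (f g : C -> C) (z : C) (r : R) :
  (0 < r)%R -> (forall y, (Cmod (y - z) < r)%R -> f y = g y) ->
  Ccont f z -> Ccont g z.
Proof.
  intros Hr E H eps He. destruct (H eps He) as (d & Hd & K).
  exists (Rmin d r). split; [apply Rmin_pos; assumption|].
  intros y Hy. rewrite <- E, <- E.
  - apply K. eapply Rlt_le_trans; [exact Hy|apply Rmin_l].
  - replace (z - z) with (RtoC 0) by ring. rewrite Cmod_0. exact Hr.
  - eapply Rlt_le_trans; [exact Hy|apply Rmin_r].
Qed.

Lemma Ccont_plus (f g : C -> C) (z : C) :
  Ccont f z -> Ccont g z -> Ccont (fun x => f x + g x) z.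
Proof.
  intros Hf Hg eps He.
  destruct (Hf (eps / 2)%R) as (d1 & D1 & K1); [lra|].
  destruct (Hg (eps / 2)%R) as (d2 & D2 & K2); [lra|].
  exists (Rmin d1 d2). split; [apply Rmin_pos; assumption|].
  intros y Hy.
  replace (f y + g y - (f z + g z)) with ((f y - f z) + (g y - g z)) by ring.
  eapply Rle_lt_trans; [apply Cmod_triangle|].
  assert (A := K1 y (Rlt_le_trans _ _ _ Hy (Rmin_l _ _))).
  assert (B := K2 y (Rlt_le_trans _ _ _ Hy (Rmin_r _ _))). lra.
Qed.

Lemma Ccont_mult (f g : C -> C) (z : C) :
  Ccont f z -> Ccont g z -> Ccont (fun x => f x * g x) z.
Proof.
  intros Hf Hg eps He.
  set (A := (Cmod (f z) + 1)%R). set (B := (Cmod (g z) + 1)%R).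
  assert (HA : (0 < A)%R) by (unfold A; generalize (Cmod_ge_0 (f z)); lra).
  assert (HB : (0 < B)%R) by (unfold B; generalize (Cmod_ge_0 (g z)); lra).
  destruct (Hf (Rmin 1 (eps / 2 / B))) as (d1 & D1 & K1).
  { apply Rmin_pos; [lra|]. repeat apply Rdiv_lt_0_compat; lra. }
  destruct (Hg (eps / 2 / A)%R) as (d2 & D2 & K2).
  { repeat apply Rdiv_lt_0_compat; lra. }
  exists (Rmin d1 d2). split; [apply Rmin_pos; assumption|].
  intros y Hy.
  assert (L := K1 y (Rlt_le_trans _ _ _ Hy (Rmin_l _ _))).
  assert (M := K2 y (Rlt_le_trans _ _ _ Hy (Rmin_r _ _))).
  replace (f y * g y - f z * g z)
    with (f y * (g y - g z) + (f y - f z) * g z) by ring.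
  eapply Rle_lt_trans; [apply Cmod_triangle|]. rewrite !Cmod_mult.
  assert (L1 := Rlt_le_trans _ _ _ L (Rmin_l _ _)).
  assert (L2 := Rlt_le_trans _ _ _ L (Rmin_r _ _)).
  assert (Fy : (Cmod (f y) < A)%R).
  { generalize (Cmod_triangle_inv (f y) (f z)). unfold A. lra. }
  assert (X1 : (Cmod (f y) * Cmod (g y - g z) <= A * (eps / 2 / A))%R).
  { apply Rmult_le_compat; try apply Cmod_ge_0; lra. }
  assert (X2 : (Cmod (f y - f z) * B < eps / 2 / B * B)%R).
  { apply Rmult_lt_compat_r; assumption. }
  assert (X3 : (Cmod (f y - f z) * Cmod (g z) <= Cmod (f y - f z) * B)%R).
  { apply Rmult_le_compat_l; [apply Cmod_ge_0|]. unfold B; lra. }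
  replace (A * (eps / 2 / A))%R with (eps / 2)%R in X1 by (field; lra).
  replace (eps / 2 / B * B)%R with (eps / 2)%R in X2 by (field; lra).
  lra.
Qed.

Lemma Ccont_opp (f : C -> C) (z : C) : Ccont f z -> Ccont (fun x => - f x) z.
Proof.
  intros H eps He. destruct (H eps He) as (d & Hd & K). exists d. split; [exact Hd|].
  intros y Hy. replace (- f y - - f z) with (- (f y - f z)) by ring.
  rewrite Cmod_opp. auto.
Qed.

Lemma Ccont_comp (f g : C -> C) (z : C) :
  Ccont g z -> Ccont f (g z) -> Ccont (fun x => f (g x)) z.
Proof.
  intros Hg Hf eps He. destruct (Hf eps He) as (d & Hd & K).
  destruct (Hg d Hd) as (d' & Hd' & K'). exists d'. auto.
Qed.

Lemma Ccont_neq (f : C -> C) (z : C) :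
  Ccont f z -> f z <> 0 ->
  exists d, (0 < d)%R /\
    forall y, (Cmod (y - z) < d)%R -> (Cmod (f z) / 2 < Cmod (f y))%R.
Proof.
  intros H N. assert (P := proj1 (Cmod_gt_0 _) N).
  destruct (H (Cmod (f z) / 2)%R) as (d & Hd & K); [lra|].
  exists d. split; [exact Hd|]. intros y Hy. specialize (K y Hy).
  replace (f y - f z) with (- (f z - f y)) in K by ring. rewrite Cmod_opp in K.
  generalize (Cmod_triangle_inv (f z) (f y)). lra.
Qed.

Lemma Ccont_inv (f : C -> C) (z : C) :
  Ccont f z -> f z <> 0 -> Ccont (fun x => / f x) z.
Proof.
  intros H N eps He. assert (P := proj1 (Cmod_gt_0 _) N).
  destruct (Ccont_neq f z H N) as (d1 & D1 & K1).
  destruct (H (eps * (Cmod (f z) * Cmod (f z) / 2))%R) as (d2 & D2 & K2).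
  { apply Rmult_lt_0_compat; [exact He|]. nra. }
  exists (Rmin d1 d2). split; [apply Rmin_pos; assumption|].
  intros y Hy.
  assert (L := K1 y (Rlt_le_trans _ _ _ Hy (Rmin_l _ _))).
  assert (M := K2 y (Rlt_le_trans _ _ _ Hy (Rmin_r _ _))).
  assert (Ny : f y <> 0) by (apply Cmod_gt_0; lra).
  replace (/ f y - / f z) with (- ((f y - f z) * / (f y * f z)))
    by (field; auto).
  rewrite Cmod_opp, Cmod_mult, Cmod_inv, Cmod_mult by (apply Cmult_neq_0; auto).
  apply Rmult_lt_reg_r with (Cmod (f y) * Cmod (f z))%R; [nra|].
  rewrite Rmult_assoc, Rinv_l, Rmult_1_r by nra.
  eapply Rlt_trans; [exact M|].
  apply Rmult_lt_compat_l; [exact He|]. nra.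
Qed.

(* Caratheodory's form of differentiability. *)
Definition Cderiv (f : C -> C) (z l : C) : Prop :=
  exists q : C -> C,
    (forall h : C, f (z + h) = f z + q h * h) /\ q 0 = l /\ Ccont q 0.

(** [Cderiv] asks for a slope function valid for all increments; the difference quotient fills in
    outside the ball where [q] is given. *)
Lemma Cderiv_loc (f q : C -> C) (z : C) (r : R) :
  (0 < r)%R -> (forall h, (Cmod h < r)%R -> f (z + h) = f z + q h * h) ->
  Ccont q 0 -> Cderiv f z (q 0).
Proof.
  intros Hr E Hq.
  exists (fun h => if Ceq_dec h 0 then q 0 else (f (z + h) - f z) / h).
  split; [|split].
  - intro h. destruct (Ceq_dec h 0) as [->|N].
    + replace (z + 0) with z by ring. ring.
    + field. exact N.
  - destruct (Ceq_dec 0 0) as [_|N]; [reflexivity|congruence].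
  - apply Ccont_ext_loc with (f := q) (r := r); [exact Hr| |exact Hq].
    intros h Hh. replace (h - 0) with h in Hh by ring.
    destruct (Ceq_dec h 0) as [->|N]; [reflexivity|].
    rewrite (E h Hh). field. exact N.
Qed.

Lemma Cderiv_ext_loc (f g : C -> C) (z l : C) (r : R) :
  (0 < r)%R -> (forall y, (Cmod (y - z) < r)%R -> f y = g y) ->
  Cderiv f z l -> Cderiv g z l.
Proof.
  intros Hr E (q & Hq & <- & Cq).
  apply Cderiv_loc with r; [exact Hr| |exact Cq].
  intros h Hh. rewrite <- (E (z + h)), <- (E z).
  - apply Hq.
  - replace (z - z) with (RtoC 0) by ring. rewrite Cmod_0. exact Hr.
  - replace (z + h - z) with h by ring. exact Hh.
Qed.

Lemma Cderiv_cont (f : C -> C) (z l : C) : Cderiv f z l -> Ccont f z.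
Proof.
  intros (q & Hq & _ & Cq).
  assert (K : Ccont (fun h => f z + q h * h) 0).
  { apply Ccont_plus; [apply Ccont_const|]. apply Ccont_mult; [exact Cq|apply Ccont_id]. }
  intros eps He. destruct (K eps He) as (d & Hd & L). exists d. split; [exact Hd|].
  intros y Hy. specialize (L (y - z)). simpl in L.
  replace (y - z - 0) with (y - z) in L by ring. specialize (L Hy).
  rewrite <- !Hq in L. replace (z + (y - z)) with y in L by ring.
  replace (z + 0) with z in L by ring. exact L.
Qed.

Lemma Cderiv_const (c z : C) : Cderiv (fun _ => c) z 0.
Proof.
  exists (fun _ => 0). split; [intro; ring|split; [reflexivity|apply Ccont_const]].
Qed.

Lemma Cderiv_id (z : C) : Cderiv (fun x => x) z 1.
Proof.
  exists (fun _ => 1). split; [intro; ring|split; [reflexivity|apply Ccont_const]].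
Qed.

Lemma Cderiv_plus (f g : C -> C) (z l m : C) :
  Cderiv f z l -> Cderiv g z m -> Cderiv (fun x => f x + g x) z (l + m).
Proof.
  intros (q & Hq & <- & Cq) (p & Hp & <- & Cp).
  exists (fun h => q h + p h).
  split; [intro h; rewrite Hq, Hp; ring|split; [reflexivity|apply Ccont_plus; auto]].
Qed.

Lemma Cderiv_opp (f : C -> C) (z l : C) :
  Cderiv f z l -> Cderiv (fun x => - f x) z (- l).
Proof.
  intros (q & Hq & <- & Cq). exists (fun h => - q h).
  split; [intro h; rewrite Hq; ring|split; [reflexivity|apply Ccont_opp; auto]].
Qed.

Lemma Cderiv_mult (f g : C -> C) (z l m : C) :
  Cderiv f z l -> Cderiv g z m ->
  Cderiv (fun x => f x * g x) z (l * g z + f z * m).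
Proof.
  intros (q & Hq & <- & Cq) (p & Hp & <- & Cp).
  exists (fun h => q h * (g z + p h * h) + f z * p h).
  split; [intro h; rewrite Hq, Hp; ring|split; [ring|]].
  apply Ccont_plus; apply Ccont_mult; auto using Ccont_const.
  apply Ccont_plus; [apply Ccont_const|].
  apply Ccont_mult; [auto|apply Ccont_id].
Qed.

Lemma Cderiv_comp (f g : C -> C) (z l m : C) :
  Cderiv f (g z) l -> Cderiv g z m -> Cderiv (fun x => f (g x)) z (l * m).
Proof.
  intros (q & Hq & <- & Cq) (p & Hp & <- & Cp).
  exists (fun h => q (p h * h) * p h).
  split; [intro h; rewrite Hp, Hq; ring|split].
  - replace (p 0 * 0) with (RtoC 0) by ring. reflexivity.
  - apply Ccont_mult; [|exact Cp].
    apply (Ccont_comp q (fun h => p h * h)).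
    + apply Ccont_mult; [auto|apply Ccont_id].
    + replace (p 0 * 0) with (RtoC 0) by ring. exact Cq.
Qed.

Lemma Cderiv_inv (f : C -> C) (z l : C) :
  Cderiv f z l -> f z <> 0 -> Cderiv (fun x => / f x) z (- l / (f z * f z)).
Proof.
  intros D N. assert (Cf := Cderiv_cont _ _ _ D).
  destruct (Ccont_neq f z Cf N) as (d & Hd & K).
  destruct D as (q & Hq & <- & Cq).
  assert (Cs : Ccont (fun h => f z + q h * h) 0).
  { apply Ccont_plus; [apply Ccont_const|]. apply Ccont_mult; [auto|apply Ccont_id]. }
  set (p := fun h => - q h * / (f z * (f z + q h * h))).
  replace (- q 0 / (f z * f z)) with (p 0).
  2:{ unfold p. replace (f z + q 0 * 0) with (f z) by ring. reflexivity. }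
  apply (Cderiv_loc _ p z d Hd); unfold p.
  - intros h Hh. rewrite <- Hq.
    assert (N2 : f (z + h) <> 0).
    { apply Cmod_gt_0. specialize (K (z + h)).
      replace (z + h - z) with h in K by ring. specialize (K Hh).
      generalize (Cmod_ge_0 (f z)). lra. }
    assert (E : q h * h = f (z + h) - f z) by (rewrite Hq; ring).
    replace (- q h * / (f z * f (z + h)) * h)
      with (- (q h * h) * / (f z * f (z + h))) by ring.
    rewrite E. field. auto.
  - apply Ccont_mult; [apply Ccont_opp, Cq|].
    apply (Ccont_inv (fun h => f z * (f z + q h * h))).
    + apply Ccont_mult; [apply Ccont_const|exact Cs].
    + replace (f z + q 0 * 0) with (f z) by ring. apply Cmult_neq_0; auto.
Qed.

Lemma Cderiv_minus (f g : C -> C) (z l m : C) :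
  Cderiv f z l -> Cderiv g z m -> Cderiv (fun x => f x - g x) z (l - m).
Proof. intros. apply Cderiv_plus; [|apply Cderiv_opp]; assumption. Qed.

Lemma Cderiv_scal (c : C) (f : C -> C) (z l : C) :
  Cderiv f z l -> Cderiv (fun x => c * f x) z (c * l).
Proof.
  intro H. replace (c * l) with (0 * f z + c * l) by ring.
  apply (Cderiv_mult (fun _ => c)); [apply Cderiv_const|exact H].
Qed.

Lemma Cderiv_div (f g : C -> C) (z l m : C) :
  Cderiv f z l -> Cderiv g z m -> g z <> 0 ->
  Cderiv (fun x => f x / g x) z ((l * g z - f z * m) / (g z * g z)).
Proof.
  intros F G N.
  replace ((l * g z - f z * m) / (g z * g z))
    with (l * / g z + f z * (- m / (g z * g z))) by (field; exact N).
  apply (Cderiv_mult f (fun x => / g x)); [exact F|]. apply Cderiv_inv; assumption.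
Qed.

Lemma Cderiv_eps (f : C -> C) (z l : C) :
  Cderiv f z l -> forall eps : R, (0 < eps)%R -> exists d : R, (0 < d)%R /\
    forall h : C, (Cmod h < d)%R -> (Cmod (f (z + h)%C - f z - l * h) <= eps * Cmod h)%R.
Proof.
  intros (q & Hq & <- & Cq) eps He. destruct (Cq eps He) as (d & Hd & K).
  exists d. split; [exact Hd|]. intros h Hh.
  rewrite Hq. replace (f z + q h * h - f z - q 0 * h) with ((q h - q 0) * h) by ring.
  rewrite Cmod_mult. apply Rmult_le_compat_r; [apply Cmod_ge_0|].
  apply Rlt_le, K. replace (h - 0) with h by ring. exact Hh.
Qed.

Lemma Cderiv_of_eps (f : C -> C) (z l : C) :
  (forall eps : R, (0 < eps)%R -> exists d : R, (0 < d)%R /\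
    forall h : C, (Cmod h < d)%R -> (Cmod (f (z + h)%C - f z - l * h) <= eps * Cmod h)%R) ->
  Cderiv f z l.
Proof.
  intro H.
  exists (fun h => if Ceq_dec h 0 then l else (f (z + h) - f z) / h).
  split; [|split].
  - intro h. destruct (Ceq_dec h 0) as [->|N].
    + replace (z + 0) with z by ring. ring.
    + field. exact N.
  - destruct (Ceq_dec 0 0) as [_|N]; [reflexivity|congruence].
  - intros eps He. destruct (H (eps / 2)%R) as (d & Hd & K); [lra|].
    exists d. split; [exact Hd|]. intros h Hh.
    replace (h - 0) with h in Hh by ring.
    destruct (Ceq_dec 0 0) as [_|N]; [|congruence].
    destruct (Ceq_dec h 0) as [->|N].
    + replace (l - l) with (RtoC 0) by ring. rewrite Cmod_0. exact He.
    + specialize (K h Hh). assert (P := proj1 (Cmod_gt_0 _) N).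
      replace ((f (z + h) - f z) / h - l) with ((f (z + h) - f z - l * h) * / h)
        by (field; exact N).
      rewrite Cmod_mult, Cmod_inv by exact N.
      apply Rmult_lt_reg_r with (Cmod h); [exact P|].
      rewrite Rmult_assoc, Rinv_l, Rmult_1_r by lra. nra.
Qed.

(** Bridge to [C_derive], the derivative in which the theorem is stated. *)
Lemma Cderiv_unique_derive (f : C -> C) (z l : C) :
  Cderiv f z l -> C_derive f z = l.
Proof.
  intro D. apply is_C_derive_unique. split; [apply is_linear_scal_l|].
  intros x Hx.
  assert (E0 : z = x) by exact (@is_filter_lim_locally_unique C_AbsRing (AbsRing_NormedModule C_AbsRing) z x Hx).
  subst x. clear Hx.
  intros [eps He]. simpl.
  destruct (Cderiv_eps f z l D eps He) as (d & Hd & K).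
  exists (mkposreal d Hd). refine (fun (y : C) Hy => _). specialize (K (y - z)).
  replace (z + (y - z)) with y in K by ring.
  assert (E : scal (minus y z) l = l * (y - z)) by (apply Cmult_comm).
  change (Cmod (f y - f z - scal (minus y z) l) <= eps * Cmod (y - z))%R.
  rewrite E. apply K. exact Hy.
Qed.

(** * Power series *)

Definition Cseries (s : nat -> C) (l : C) : Prop :=
  @is_series C_AbsRing C_NormedModule s l.

Lemma Cseries_eps (s : nat -> C) (l : C) :
  Cseries s l <-> forall eps : R, (0 < eps)%R -> exists N : nat, forall n : nat,
    (N <= n)%nat -> (Cmod (sum_n (G := C_AbelianMonoid) s n - l)%C < eps)%R.
Proof.
  unfold Cseries, is_series. split.
  - intros H eps He.
    destruct (proj1 (filterlim_locally_ball_norm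
      (K := C_AbsRing) (U := C_NormedModule) (sum_n s) l) H (mkposreal eps He))
      as [N HN].
    exists N. intros n Hn. exact (HN n Hn).
  - intro H. apply (filterlim_locally_ball_norm (K := C_AbsRing) (U := C_NormedModule)).
    intros [eps He]. destruct (H eps He) as [N HN]. exists N. exact HN.
Qed.

Lemma pow_n_Cpow (z : C) (n : nat) : @pow_n C_Ring z n = z ^ n.
Proof. induction n as [|n IH]; [reflexivity|]. simpl. rewrite IH. reflexivity. Qed.

Lemma Cpseries_series (a : nat -> C) (z l : C) :
  @is_pseries C_AbsRing C_NormedModule a z l <-> Cseries (fun n => a n * z ^ n) l.
Proof.
  assert (E : forall n, @scal C_AbsRing C_NormedModule (@pow_n C_AbsRing z n) (a n)
                        = a n * z ^ n).
  { intro n. change (@pow_n C_Ring z n * a n = a n * z ^ n).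
    rewrite pow_n_Cpow. ring. }
  split; apply is_series_ext; intro n; rewrite E; reflexivity.
Qed.

Lemma Cseries_unique (s : nat -> C) (l m : C) : Cseries s l -> Cseries s m -> l = m.
Proof.
  intros H K. exact (filterlim_locally_unique (K := C_AbsRing) (V := C_NormedModule)
    (F := eventually) (sum_n s) l m H K).
Qed.

Lemma Cseries_ext (s t : nat -> C) (l : C) :
  (forall n, s n = t n) -> Cseries s l -> Cseries t l.
Proof. apply is_series_ext. Qed.

Lemma Cseries_plus (s t : nat -> C) (l m : C) :
  Cseries s l -> Cseries t m -> Cseries (fun n => s n + t n) (l + m).
Proof. apply (is_series_plus (K := C_AbsRing) (V := C_NormedModule)). Qed.

Lemma Cseries_scal (c : C) (s : nat -> C) (l : C) :
  Cseries s l -> Cseries (fun n => c * s n) (c * l).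
Proof. apply (is_series_scal (K := C_AbsRing) (V := C_NormedModule)). Qed.

Lemma Cseries_decr (s : nat -> C) (l : C) :
  Cseries (fun n => s (S n)) (l - s O) -> Cseries s l.
Proof. apply (is_series_decr_1 (K := C_AbsRing) (V := C_NormedModule)). Qed.

Lemma Cseries_zero : Cseries (fun _ => 0) 0.
Proof.
  apply Cseries_eps. intros eps He. exists O. intros n _.
  replace (sum_n _ n) with (RtoC 0).
  - replace (0 - 0) with (RtoC 0) by ring. rewrite Cmod_0. exact He.
  - induction n as [|n IHn]; [rewrite sum_O; reflexivity|].
    rewrite sum_Sn, <- IHn. change (RtoC 0 = 0 + 0). ring.
Qed.

Lemma Cseries_incr (s : nat -> C) (l : C) :
  Cseries s l -> Cseries (fun n => s (S n)) (l - s O).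
Proof.
  intro H. apply (is_series_incr_1 (K := C_AbsRing) (V := C_NormedModule)).
  assert (E : l = l - s O + s O) by ring. rewrite E in H. exact H.
Qed.

Lemma Cseries_terms_bounded (s : nat -> C) (l : C) :
  Cseries s l -> exists M : R, forall n, (Cmod (s n) <= M)%R.
Proof.
  intro H.
  destruct (filterlim_bounded (K := C_AbsRing) (V := C_NormedModule) (sum_n s)) as [M HM].
  { exists l. exact H. }
  exists (M + M)%R. intro n. destruct n as [|n].
  - specialize (HM O). rewrite sum_O in HM.
    change (Cmod (s O) <= M)%R in HM. generalize (Cmod_ge_0 (s O)). lra.
  - assert (A := HM n). assert (B := HM (S n)). rewrite sum_Sn in B.
    set (x := sum_n s n) in *. clearbody x. change C in x.
    change (Cmod x <= M)%R in A. change (Cmod (x + s (S n))%C <= M)%R in B.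
    replace (s (S n)) with ((x + s (S n)) - x) by ring.
    eapply Rle_trans; [apply Cmod_triangle'|]. lra.
Qed.

Lemma Cseries_exists (s : nat -> C) (b : nat -> R) :
  (forall n, (Cmod (s n) <= b n)%R) -> ex_series b -> exists l, Cseries s l.
Proof.
  intros H K.
  exact (ex_series_le (K := C_AbsRing) (V := C_CompleteNormedModule) s b H K).
Qed.

Lemma sum_n_Cmod (s : nat -> C) (b : nat -> R) (n : nat) :
  (forall k, (Cmod (s k) <= b k)%R) ->
  (Cmod (sum_n (G := C_AbelianMonoid) s n) <= sum_n b n)%R.
Proof.
  intro H. induction n as [|n IH].
  - rewrite !sum_O. apply H.
  - rewrite !sum_Sn. eapply Rle_trans; [apply Cmod_triangle|].
    apply Rplus_le_compat; [exact IH|apply H].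
Qed.

Lemma sum_n_le_Series (b : nat -> R) (n : nat) :
  (forall k, (0 <= b k)%R) -> ex_series b -> (sum_n b n <= Series b)%R.
Proof.
  intros Hb [l Hl]. rewrite (is_series_unique _ _ Hl).
  apply (is_lim_seq_incr_compare (sum_n b) l); [exact Hl|].
  intro k. rewrite sum_Sn. change (sum_n b k <= sum_n b k + b (S k))%R.
  generalize (Hb (S k)). lra.
Qed.

Lemma Cseries_bound (s : nat -> C) (l : C) (b : nat -> R) :
  (forall k, (Cmod (s k) <= b k)%R) -> ex_series b -> Cseries s l ->
  (Cmod l <= Series b)%R.
Proof.
  intros H Hb Hs. apply le_epsilon. intros eps He.
  destruct (proj1 (Cseries_eps s l) Hs eps He) as [N HN].
  specialize (HN N (le_n N)).
  set (x := sum_n (G := C_AbelianMonoid) s N) in *.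
  assert (A : (Cmod x <= sum_n b N)%R) by (apply sum_n_Cmod; exact H).
  assert (B : (sum_n b N <= Series b)%R).
  { apply sum_n_le_Series; [|exact Hb]. intro k.
    eapply Rle_trans; [apply Cmod_ge_0|apply H]. }
  replace l with (x - (x - l)) by ring.
  eapply Rle_trans; [apply Cmod_triangle'|]. lra.
Qed.

(** The terms at a point [y] strictly between [x] and [r] are bounded, so the real series of moduli
    has radius at least [y]. Absolute convergence of complex series is taken from the real theory in
    this way. *)
Lemma pseries_radius (a : nat -> C) (r : R) (F : C -> C) :
  (forall h, (Cmod h < r)%R -> Cseries (fun n => a n * h ^ n) (F h)) ->
  forall x : R, (0 <= x < r)%R -> Rbar_lt (Rabs x) (CV_radius (fun n => Cmod (a n))).
Proof.
  intros H x Hx. set (y := ((x + r) / 2)%R).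
  apply Rbar_lt_le_trans with (Finite y).
  { simpl. rewrite Rabs_pos_eq; unfold y; lra. }
  apply (CV_radius_bounded (fun n => Cmod (a n))).
  assert (Hy : (Cmod (RtoC y) < r)%R).
  { rewrite Cmod_R, Rabs_pos_eq; unfold y; lra. }
  destruct (Cseries_terms_bounded _ _ (H _ Hy)) as [M HM].
  exists M. intro n. specialize (HM n). rewrite Cmod_mult, Cmod_pow, Cmod_R in HM.
  rewrite Rabs_mult, (Rabs_pos_eq (Cmod (a n))), <- RPow_abs by apply Cmod_ge_0.
  exact HM.
Qed.

Definition Cpseries_derive (a : nat -> C) (n : nat) : C := RtoC (INR (S n)) * a (S n).

(** With [R_N] the remainder for exponent [N], one has [R_(N+1) = (z + k) R_N + N z^(N-1) k^2]. The
    factor in the bound is the one produced by differentiating [rho^(n+2)] twice, so that summation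
    over [n] gives a second-derivative series. *)
Lemma Cmod_pow_remainder (z k : C) (rho : R) (n : nat) :
  (Cmod z <= rho)%R -> (Cmod (z + k) <= rho)%R ->
  (Cmod ((z + k) ^ (S (S n)) - z ^ (S (S n)) - RtoC (INR (S (S n))) * z ^ (S n) * k)
   <= INR (S (S n)) * INR (S n) * rho ^ n * (Cmod k * Cmod k))%R.
Proof.
  intros Hz Hzk.
  assert (Hr : (0 <= rho)%R) by (generalize (Cmod_ge_0 z); lra).
  induction n as [|n IH].
  - replace ((z + k) ^ 2 - z ^ 2 - RtoC (INR 2) * z ^ 1 * k) with (k * k)
      by (simpl; rewrite RtoC_plus; ring).
    rewrite Cmod_mult. simpl. generalize (Cmod_ge_0 k). nra.
  - set (N := INR (S (S n))) in *.
    replace (INR (S (S (S n)))) with (N + 1)%R by (symmetry; apply (S_INR (S (S n)))).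
    assert (HN : (INR (S n) = N - 1)%R) by (unfold N; rewrite (S_INR (S n)); ring).
    rewrite HN in IH.
    assert (N2 : (2 <= N)%R).
    { unfold N. rewrite !S_INR. generalize (pos_INR n). lra. }
    replace ((z + k) ^ S (S (S n)) - z ^ S (S (S n)) - RtoC (N + 1) * z ^ S (S n) * k)
      with ((z + k) * ((z + k) ^ S (S n) - z ^ S (S n) - RtoC N * z ^ S n * k)
            + RtoC N * z ^ S n * (k * k)).
    2:{ rewrite RtoC_plus, !(Cpow_S _ (S (S n))), !(Cpow_S z (S n)). ring. }
    eapply Rle_trans; [apply Cmod_triangle|].
    rewrite !Cmod_mult, Cmod_pow, Cmod_R, (Rabs_pos_eq N) by lra.
    set (T := Cmod _) in IH. fold T. set (K := (Cmod k * Cmod k)%R) in *.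
    assert (HK : (0 <= K)%R) by (unfold K; generalize (Cmod_ge_0 k); nra).
    assert (HP : (0 <= rho ^ S n)%R) by (apply pow_le; exact Hr).
    assert (A : (Cmod (z + k) * T <= rho * (N * (N - 1) * rho ^ n * K))%R).
    { apply Rmult_le_compat; try apply Cmod_ge_0; assumption. }
    assert (B : (Cmod z ^ S n <= rho ^ S n)%R).
    { apply pow_incr. split; [apply Cmod_ge_0|exact Hz]. }
    assert (B2 : (N * Cmod z ^ S n * K <= N * rho ^ S n * K)%R).
    { apply Rmult_le_compat_r; [exact HK|]. apply Rmult_le_compat_l; [lra|exact B]. }
    replace (rho * (N * (N - 1) * rho ^ n * K))%R
      with (N * (N - 1) * (rho ^ S n * K))%R in A by (simpl; ring).
    assert (HPK : (0 <= rho ^ S n * K)%R) by (apply Rmult_le_pos; assumption).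
    replace ((N + 1) * N * rho ^ S n * K)%R with ((N + 1) * N * (rho ^ S n * K))%R by ring.
    replace (N * rho ^ S n * K)%R with (N * (rho ^ S n * K))%R in B2 by ring.
    nra.
Qed.

Lemma pseries_derivable (a : nat -> C) (r : R) (F : C -> C) :
  (forall h, (Cmod h < r)%R -> Cseries (fun n => a n * h ^ n) (F h)) ->
  forall z, (Cmod z < r)%R -> exists l,
    Cderiv F z l /\ Cseries (fun n => Cpseries_derive a n * z ^ n) l.
Proof.
  intros H z Hz.
  set (rho := ((Cmod z + r) / 2)%R).
  assert (H0 := Cmod_ge_0 z).
  assert (Hrho : (0 <= rho < r)%R) by (unfold rho; lra).
  set (b := fun n => Cmod (a n)).
  assert (RB : forall x, (0 <= x < r)%R -> Rbar_lt (Rabs x) (CV_radius b)).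
  { apply pseries_radius with F. exact H. }
  destruct (Cseries_exists (fun n => Cpseries_derive a n * z ^ n)
     (fun n => Rabs (PS_derive b n * Cmod z ^ n))) as [l Hl].
  { intro n. unfold Cpseries_derive, PS_derive.
    rewrite !Cmod_mult, Cmod_pow, Cmod_R.
    rewrite (Rabs_pos_eq (INR (S n))) by apply pos_INR. apply Rle_abs. }
  { apply CV_disk_inside. rewrite CV_radius_derive. apply RB. lra. }
  exists l. split; [|exact Hl].
  (* The twice differentiated series of moduli at [rho]; its sum bounds the quotient of the
     first-order remainder by [|k|^2]. *)
  set (c := fun n => Rabs (PS_derive (PS_derive b) n * rho ^ n)).
  assert (Hc : ex_series c).
  { apply CV_disk_inside. rewrite !CV_radius_derive. apply RB. exact Hrho. }
  assert (HB : (0 <= Series c)%R).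
  { apply Rle_trans with (sum_n c 0); [rewrite sum_O; apply Rabs_pos|].
    apply sum_n_le_Series; [intro; apply Rabs_pos|exact Hc]. }
  assert (Key : forall k, (Cmod k < rho - Cmod z)%R ->
     (Cmod (F (z + k)%C - F z - l * k) <= Series c * (Cmod k * Cmod k))%R).
  { intros k Hk.
    assert (Hzk : (Cmod (z + k) <= rho)%R).
    { eapply Rle_trans; [apply Cmod_triangle|]. lra. }
    assert (S1 := H (z + k) ltac:(lra)). assert (S2 := H z Hz).
    (* Reindexed with [pred] so that it can be combined term by term with [S1] and [S2]; the term of
       index 0 is killed by [INR 0]. *)
    assert (S3 : Cseries (fun n => a n * RtoC (INR n) * z ^ pred n) l).
    { apply Cseries_decr. replace (l - a O * RtoC (INR 0) * z ^ pred 0) with l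
        by (simpl; ring).
      revert Hl. apply Cseries_ext. intro n. unfold Cpseries_derive.
      rewrite Nat.pred_succ. ring. }
    assert (S4 : Cseries (fun n => a n * ((z + k) ^ n - z ^ n - RtoC (INR n) * z ^ pred n * k))
                         (F (z + k) - F z - l * k)).
    { replace (F (z + k) - F z - l * k) with (F (z + k) + ((-(1)) * F z + (- k) * l)) by ring.
      eapply Cseries_ext; [|apply Cseries_plus; [exact S1|apply Cseries_plus;
        [apply (Cseries_scal (-(1))); exact S2|apply (Cseries_scal (- k)); exact S3]]].
      intro n. cbv beta. ring. }
    (* The terms of index 0 and 1 have zero remainder; dropping them aligns the index with
       [Cmod_pow_remainder]. *)
    apply Cseries_incr in S4. apply Cseries_incr in S4.
    replace (_ - _ - _) with (F (z + k) - F z - l * k) in S4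
      by (simpl; ring).
    rewrite <- (Rmult_comm (Cmod k * Cmod k)), <- Series_scal_l.
    apply (Cseries_bound _ _ (fun n => (Cmod k * Cmod k) * c n)%R) in S4; [exact S4| |].
    2:{ apply (ex_series_scal_l (K := R_AbsRing) (V := R_NormedModule)). exact Hc. }
    intro n. rewrite Cmod_mult. rewrite Nat.pred_succ.
    unfold c, PS_derive. fold (b (S (S n))).
    assert (T := Cmod_pow_remainder z k rho n ltac:(unfold rho; lra) Hzk).
    rewrite Rabs_pos_eq.
    2:{ apply Rmult_le_pos; [|apply pow_le; lra]. apply Rmult_le_pos; [apply pos_INR|].
        apply Rmult_le_pos; [apply pos_INR|apply Cmod_ge_0]. }
    eapply Rle_trans; [apply Rmult_le_compat_l; [apply Cmod_ge_0|exact T]|].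
    apply Req_le. unfold b. ring. }
  apply Cderiv_of_eps. intros eps He.
  exists (Rmin (rho - Cmod z) (eps / (Series c + 1))). split.
  { apply Rmin_pos; [unfold rho; lra|]. apply Rdiv_lt_0_compat; lra. }
  intros k Hk.
  eapply Rle_trans; [apply Key; eapply Rlt_le_trans; [exact Hk|apply Rmin_l]|].
  assert (L := Rlt_le_trans _ _ _ Hk (Rmin_r _ _)).
  rewrite <- Rmult_assoc. apply Rmult_le_compat_r; [apply Cmod_ge_0|].
  apply Rle_trans with (Series c * (eps / (Series c + 1)))%R.
  { apply Rmult_le_compat_l; lra. }
  apply Rmult_le_reg_r with (Series c + 1)%R; [lra|].
  replace (Series c * (eps / (Series c + 1)) * (Series c + 1))%R with (Series c * eps)%R
    by (field; lra).
  nra.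
Qed.

(** Induction on [n] with the series left general: both derived series represent [C_derive F], and
    their coefficients of index [n] are those of index [n + 1] up to the factor [n + 1]. *)
Lemma pseries_coef_unique (r : R) (n : nat) :
  (0 < r)%R -> forall (a b : nat -> C) (F : C -> C),
  (forall h, (Cmod h < r)%R -> Cseries (fun n => a n * h ^ n) (F h)) ->
  (forall h, (Cmod h < r)%R -> Cseries (fun n => b n * h ^ n) (F h)) ->
  a n = b n.
Proof.
  intro Hr. induction n as [|n IH]; intros a b F Ha Hb.
  - assert (E : forall c : nat -> C,
      (forall h, (Cmod h < r)%R -> Cseries (fun n => c n * h ^ n) (F h)) -> c O = F 0).
    { intros c Hc. apply Cseries_unique with (fun n => c n * 0 ^ n).
      - apply Cseries_decr. replace (c O - c O * 0 ^ 0) with (RtoC 0) by (simpl; ring).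
        apply Cseries_ext with (fun _ => 0); [|apply Cseries_zero].
        intro n. rewrite Cpow_S. ring.
      - apply Hc. rewrite Cmod_0. exact Hr. }
    rewrite (E a Ha), (E b Hb). reflexivity.
  - assert (E : Cpseries_derive a n = Cpseries_derive b n).
    { apply (IH _ _ (C_derive F)); intros h Hh.
      - destruct (pseries_derivable a r F Ha h Hh) as (l & D & Sl).
        rewrite (Cderiv_unique_derive _ _ _ D). exact Sl.
      - destruct (pseries_derivable b r F Hb h Hh) as (l & D & Sl).
        rewrite (Cderiv_unique_derive _ _ _ D). exact Sl. }
    unfold Cpseries_derive in E.
    assert (N : RtoC (INR (S n)) <> 0).
    { intro A. apply RtoC_inj in A. apply (not_0_INR (S n)); [discriminate|exact A]. }
    replace (a (S n)) with (/ RtoC (INR (S n)) * (RtoC (INR (S n)) * a (S n)))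
      by (field; exact N).
    rewrite E. field. exact N.
Qed.

(** * The exponential *)

Definition Cexp (z : C) : C :=
  ((exp (Re z) * cos (Im z))%R, (exp (Re z) * sin (Im z))%R).

Lemma Cexp_plus (z w : C) : Cexp (z + w) = Cexp z * Cexp w.
Proof.
  unfold Cexp. rewrite re_plus, im_plus, exp_plus, cos_plus, sin_plus.
  unfold Cmult; simpl. f_equal; ring.
Qed.

Lemma Cexp_0 : Cexp 0 = 1.
Proof. unfold Cexp. simpl. rewrite exp_0, cos_0, sin_0. unfold RtoC. f_equal; ring. Qed.

Lemma Cmod_Cexp (z : C) : Cmod (Cexp z) = exp (Re z).
Proof.
  assert (P := exp_pos (Re z)).
  assert (T := sin2_cos2 (Im z)). unfold Rsqr in T.
  apply Rsqr_inj; [apply Cmod_ge_0|lra|]. unfold Rsqr.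
  rewrite Cmod_sqr.
  change (exp (Re z) * cos (Im z) * (exp (Re z) * cos (Im z))
          + exp (Re z) * sin (Im z) * (exp (Re z) * sin (Im z)) = exp (Re z) * exp (Re z))%R.
  replace (exp (Re z) * exp (Re z))%R
    with (exp (Re z) * exp (Re z) * (sin (Im z) * sin (Im z) + cos (Im z) * cos (Im z)))%R
    by (rewrite T; ring).
  ring.
Qed.

Lemma Cexp_neq_0 (z : C) : Cexp z <> 0.
Proof. apply Cmod_gt_0. rewrite Cmod_Cexp. apply exp_pos. Qed.

(** Both sides come from [1 + t <= exp t]: at [t = x] directly, and at [t = -x] in the form
    [exp x (1 - x) <= 1]. *)
Lemma exp_remainder (x : R) :
  (Rabs x <= 1 / 2)%R -> (Rabs (exp x - 1 - x) <= 2 * (x * x))%R.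
Proof.
  intro H. apply Rabs_le_between in H.
  assert (A := exp_ineq1_le x). assert (B := exp_ineq1_le (- x)).
  assert (P := exp_pos x).
  assert (E : (exp x * exp (- x) = 1)%R) by (rewrite <- exp_plus, Rplus_opp_r; apply exp_0).
  rewrite Rabs_pos_eq by lra. nra.
Qed.

(** [1 - cos y = 2 sin(y/2)^2] together with [|sin t| <= |t|]. *)
Lemma cos_remainder (y : R) : (0 <= 1 - cos y <= y * y)%R.
Proof.
  split; [generalize (COS_bound y); lra|].
  assert (S : (Rabs (sin (y / 2)) <= Rabs (y / 2))%R).
  { assert (P : forall x, (0 <= x -> Rabs (sin x) <= x)%R).
    { intros x Hx. destruct (Rle_lt_dec x 1) as [L|G].
      - assert (PI1 := PI2_1). rewrite Rabs_pos_eq.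
        + destruct Hx as [Hx| <-]; [|rewrite sin_0; lra].
          left. apply sin_lt_x. exact Hx.
        + apply sin_ge_0; lra.
      - generalize (SIN_bound x). intro. apply Rabs_le_between. lra. }
    destruct (Rle_lt_dec 0 (y / 2)) as [L|G].
    - rewrite (Rabs_pos_eq (y / 2)) by exact L. apply P, L.
    - rewrite <- Rabs_Ropp, <- sin_neg, (Rabs_left (y / 2)) by exact G. apply P. lra. }
  replace y with (2 * (y / 2))%R at 1 by field. rewrite cos_2a_sin.
  apply Rsqr_le_abs_1 in S. unfold Rsqr in S. nra.
Qed.

Lemma Rabs_sqr_eq (x : R) : (x * x = Rabs x * Rabs x)%R.
Proof. exact (Rsqr_abs x). Qed.

Lemma sin_remainder (y : R) :
  (Rabs y <= 1)%R -> (Rabs (sin y - y) <= y * y)%R.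
Proof.
  intro H.
  destruct (MVT_gen (fun t => sin t - t)%R 0 y (fun t => cos t - 1)%R) as (c & Hc & E).
  - intros x _. auto_derive; [exact I|ring].
  - intros x _. apply continuity_pt_minus; [apply continuity_sin|apply continuity_pt_id].
  - rewrite sin_0 in E. replace (sin y - y)%R with ((cos c - 1) * y)%R by lra.
    rewrite Rabs_mult. destruct (cos_remainder c) as [C1 C2].
    assert (Ac : (Rabs c <= Rabs y)%R).
    { unfold Rmin, Rmax in Hc. unfold Rabs.
      destruct (Rle_dec 0 y), (Rcase_abs c), (Rcase_abs y); lra. }
    rewrite <- Rabs_Ropp, Rabs_pos_eq by lra.
    assert (Sc := Rabs_sqr_eq c).
    assert (Sy := Rabs_sqr_eq y).
    generalize (Rabs_pos c), (Rabs_pos y). intros.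
    assert (- (cos c - 1) <= Rabs y)%R by nra. nra.
Qed.

Lemma Cmod_le_Rabs (z : C) : (Cmod z <= Rabs (Re z) + Rabs (Im z))%R.
Proof.
  assert (A := Rabs_pos (Re z)). assert (B := Rabs_pos (Im z)).
  apply Rsqr_incr_0_var; [|lra]. unfold Rsqr. rewrite Cmod_sqr.
  assert (SRe := Rabs_sqr_eq (Re z)).
  assert (SIm := Rabs_sqr_eq (Im z)).
  nra.
Qed.

(** Only the quadratic order matters, for the derivative of [Cexp]; the constant is generous. *)
Lemma Cexp_remainder (h : C) :
  (Cmod h <= 1 / 2)%R -> (Cmod (Cexp h - 1 - h)%C <= 10 * (Cmod h * Cmod h))%R.
Proof.
  intro H. set (x := Re h). set (y := Im h).
  assert (Hx : (Rabs x <= Cmod h)%R) by apply re_le_Cmod.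
  assert (Hy : (Rabs y <= Cmod h)%R) by apply im_le_Cmod.
  assert (Ex := exp_remainder x ltac:(lra)).
  assert (Sy := sin_remainder y ltac:(lra)).
  assert (Cy := cos_remainder y).
  assert (N := Cmod_sqr h). fold x y in N.
  set (m := (Cmod h * Cmod h)%R) in *.
  assert (P := exp_pos x).
  apply Rabs_le_between in Ex. apply Rabs_le_between in Sy.
  apply Rabs_le_between in Hx. apply Rabs_le_between in Hy.
  assert (X2 : (-(1/2) <= x <= 1/2)%R) by lra.
  assert (P2 : (exp x <= 2)%R).
  { assert (0 <= (1 / 2 - x) * (1 / 2 + x))%R by (apply Rmult_le_pos; lra). lra. }
  eapply Rle_trans; [apply Cmod_le_Rabs|].
  replace (Re (Cexp h - 1 - h)) with (exp x * (cos y - 1) + (exp x - 1 - x))%R.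
  2:{ unfold x, y, Cexp, Re, Im; simpl. ring. }
  replace (Im (Cexp h - 1 - h)) with (exp x * (sin y - y) + (exp x - 1) * y)%R.
  2:{ unfold x, y, Cexp, Re, Im; simpl. ring. }
  assert (A : (Rabs (exp x * (cos y - 1) + (exp x - 1 - x)) <= 2 * (y * y) + 2 * (x * x))%R).
  { apply Rabs_le_between. split; nra. }
  assert (A2 : (Rabs (exp x * (sin y - y)) <= 2 * (y * y))%R).
  { rewrite Rabs_mult, (Rabs_pos_eq (exp x)) by lra.
    apply Rmult_le_compat; [lra|apply Rabs_pos|exact P2|apply Rabs_le_between; lra]. }
  assert (A3 : (Rabs ((exp x - 1) * y) <= x * x + y * y + 2 * (x * x))%R).
  { replace ((exp x - 1) * y)%R with (x * y + (exp x - 1 - x) * y)%R by ring.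
    set (d := (exp x - 1 - x)%R) in *. assert (Y2 : (-(1/2) <= y <= 1/2)%R) by lra.
    assert (0 <= (2 * (x * x) - d) * (1 / 2 + y))%R by (apply Rmult_le_pos; lra).
    assert (0 <= (2 * (x * x) + d) * (1 / 2 - y))%R by (apply Rmult_le_pos; lra).
    assert (0 <= (2 * (x * x) - d) * (1 / 2 - y))%R by (apply Rmult_le_pos; lra).
    assert (0 <= (2 * (x * x) + d) * (1 / 2 + y))%R by (apply Rmult_le_pos; lra).
    assert (0 <= (x - y) * (x - y))%R by apply Rle_0_sqr.
    assert (0 <= (x + y) * (x + y))%R by apply Rle_0_sqr.
    apply Rabs_le_between. split; lra. }
  assert (A4 := Rabs_triang (exp x * (sin y - y)) ((exp x - 1) * y)).
  nra.
Qed.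

Lemma Cderiv_Cexp (z : C) : Cderiv Cexp z (Cexp z).
Proof.
  apply Cderiv_of_eps. intros eps He.
  set (M := Cmod (Cexp z)). assert (HM : (0 <= M)%R) by apply Cmod_ge_0.
  exists (Rmin (1 / 2) (eps / (10 * M + 1))). split.
  { apply Rmin_pos; [lra|]. apply Rdiv_lt_0_compat; lra. }
  intros h Hh.
  assert (L1 := Rlt_le_trans _ _ _ Hh (Rmin_l _ _)).
  assert (L2 := Rlt_le_trans _ _ _ Hh (Rmin_r _ _)).
  rewrite Cexp_plus. replace (Cexp z * Cexp h - Cexp z - Cexp z * h)
    with (Cexp z * (Cexp h - 1 - h)) by ring.
  rewrite Cmod_mult. fold M.
  assert (K := Cexp_remainder h ltac:(lra)). assert (P := Cmod_ge_0 h).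
  assert (L3 : (Cmod h * (10 * M + 1) <= eps)%R).
  { apply Rmult_lt_compat_r with (r := (10 * M + 1)%R) in L2; [|lra].
    replace (eps / (10 * M + 1) * (10 * M + 1))%R with eps in L2 by (field; lra). lra. }
  apply Rle_trans with (M * (10 * (Cmod h * Cmod h)))%R.
  { apply Rmult_le_compat_l; assumption. }
  nra.
Qed.

(** * Integrals of complex functions over real intervals *)

(** The integrand is a function of a complex variable read on the real line, so [Ccont] and [Cderiv]
    serve for integrands and primitives as well. *)
Definition CRint (F : C -> C) (a b : R) : C :=
  (RInt (fun t => Re (F (RtoC t))) a b, RInt (fun t => Im (F (RtoC t))) a b).

Lemma Ccont_real (F : C -> C) (t : R) :
  Ccont F (RtoC t) ->
  continuous (fun s : R => Re (F (RtoC s))) t /\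
  continuous (fun s : R => Im (F (RtoC s))) t.
Proof.
  intro H.
  assert (K : forall eps : posreal, exists d : posreal, forall s : R,
    (Rabs (s - t) < d)%R -> (Cmod (F (RtoC s) - F (RtoC t))%C < eps)%R).
  { intros [eps He]. destruct (H eps He) as (d & Hd & L). exists (mkposreal d Hd).
    intros s Hs. apply L. rewrite <- RtoC_minus, Cmod_R. exact Hs. }
  split; apply filterlim_locally; intro eps; destruct (K eps) as (d & L); exists d;
    intros s Hs; specialize (L s Hs); (eapply Rle_lt_trans; [|exact L]).
  - change (Rabs (Re (F (RtoC s)) - Re (F (RtoC t))) <= Cmod (F (RtoC s) - F (RtoC t)))%R.
    exact (re_le_Cmod (F (RtoC s) - F (RtoC t))).
  - change (Rabs (Im (F (RtoC s)) - Im (F (RtoC t))) <= Cmod (F (RtoC s) - F (RtoC t)))%R.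
    exact (im_le_Cmod (F (RtoC s) - F (RtoC t))).
Qed.

Lemma ex_CRint (F : C -> C) (a b : R) :
  (forall t : R, Ccont F (RtoC t)) ->
  ex_RInt (fun t : R => Re (F (RtoC t))) a b /\
  ex_RInt (fun t : R => Im (F (RtoC t))) a b.
Proof.
  intro H. split; apply (ex_RInt_continuous (V := R_CompleteNormedModule));
    intros t _; apply (Ccont_real F t (H t)).
Qed.

Lemma CRint_ext (F G : C -> C) (a b : R) :
  (forall t : R, F (RtoC t) = G (RtoC t)) -> CRint F a b = CRint G a b.
Proof.
  intro H. unfold CRint. f_equal; apply RInt_ext; intros t _; rewrite H; reflexivity.
Qed.

Lemma CRint_plus (F G : C -> C) (a b : R) :
  (forall t : R, Ccont F (RtoC t)) -> (forall t : R, Ccont G (RtoC t)) ->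
  CRint (fun x => F x + G x) a b = CRint F a b + CRint G a b.
Proof.
  intros HF HG. destruct (ex_CRint F a b HF), (ex_CRint G a b HG).
  unfold CRint, Cplus; simpl. f_equal.
  - rewrite <- (RInt_plus (V := R_CompleteNormedModule)); assumption || reflexivity.
  - rewrite <- (RInt_plus (V := R_CompleteNormedModule)); assumption || reflexivity.
Qed.

Lemma CRint_scal (c : C) (F : C -> C) (a b : R) :
  (forall t : R, Ccont F (RtoC t)) ->
  CRint (fun x => c * F x) a b = c * CRint F a b.
Proof.
  intro HF. destruct (ex_CRint F a b HF) as [H1 H2].
  assert (S : forall (k : R) f, ex_RInt f a b -> is_RInt (fun t => k * f t)%R a b (k * RInt f a b)%R).
  { intros k f Hf. apply (is_RInt_scal (V := R_NormedModule)).
    apply (RInt_correct (V := R_CompleteNormedModule)). exact Hf. }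
  unfold CRint. unfold Cmult at 3; simpl. f_equal.
  - apply (@is_RInt_unique R_CompleteNormedModule).
    apply (is_RInt_minus (V := R_NormedModule)
      (fun t : R => (Re c * Re (F (RtoC t)))%R) (fun t : R => (Im c * Im (F (RtoC t)))%R));
      apply S; assumption.
  - apply (@is_RInt_unique R_CompleteNormedModule).
    apply (is_RInt_plus (V := R_NormedModule)
      (fun t : R => (Re c * Im (F (RtoC t)))%R) (fun t : R => (Im c * Re (F (RtoC t)))%R));
      apply S; assumption.
Qed.

(** The factor 2 comes from estimating real and imaginary part separately. It is harmless: the bound
    is used for a remainder tending to 0 and for powers of unbounded exponent. *)
Lemma CRint_bound (F : C -> C) (B : R -> R) (a b : R) :
  (a <= b)%R -> (forall t : R, Ccont F (RtoC t)) -> ex_RInt B a b ->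
  (forall t : R, (Cmod (F (RtoC t)) <= B t)%R) ->
  (Cmod (CRint F a b) <= 2 * RInt B a b)%R.
Proof.
  intros Hab HF HB H. destruct (ex_CRint F a b HF) as [H1 H2].
  eapply Rle_trans; [apply Cmod_le_Rabs|]. unfold CRint; simpl.
  assert (K : forall f, ex_RInt f a b -> (forall t, Rabs (f t) <= B t)%R ->
                        (Rabs (RInt f a b) <= RInt B a b)%R).
  { intros f Hf Hle. eapply Rle_trans; [apply abs_RInt_le; assumption|].
    apply RInt_le; auto.
    apply ex_RInt_norm. exact Hf. }
  assert (A1 := K _ H1 (fun t => Rle_trans _ _ _ (re_le_Cmod _) (H t))).
  assert (A2 := K _ H2 (fun t => Rle_trans _ _ _ (im_le_Cmod _) (H t))).
  simpl in A1, A2. lra.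
Qed.

Lemma Cderiv_real (F : C -> C) (t : R) (l : C) :
  Cderiv F (RtoC t) l ->
  is_derive (fun s : R => Re (F (RtoC s))) t (Re l) /\
  is_derive (fun s : R => Im (F (RtoC s))) t (Im l).
Proof.
  intro H.
  assert (K : forall eps : posreal, exists d : posreal, forall s : R,
    (Rabs (s - t) < d)%R ->
    (Cmod (F (RtoC s) - F (RtoC t) - l * RtoC (s - t)%R)%C <= eps * Rabs (s - t))%R).
  { intros [eps He]. destruct (Cderiv_eps F _ _ H eps He) as (d & Hd & L).
    exists (mkposreal d Hd). intros s Hs. specialize (L (RtoC (s - t)%R)).
    rewrite Cmod_R in L. specialize (L Hs). rewrite <- RtoC_plus in L.
    replace (t + (s - t))%R with s in L by ring. exact L. }
  split; (split; [apply is_linear_scal_l|]); intros x Hx;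
    (assert (E0 : t = x) by exact (@is_filter_lim_locally_unique R_AbsRing R_NormedModule t x Hx));
    subst x; clear Hx; intro eps; destruct (K eps) as (d & L); exists d; intros s Hs;
    specialize (L s Hs); (eapply Rle_trans; [|exact L]).
  - change (Rabs (Re (F (RtoC s)) - Re (F (RtoC t)) - (s - t) * Re l)
            <= Cmod (F (RtoC s) - F (RtoC t) - l * RtoC (s - t)))%R.
    replace (_ - _ - _)%R with (Re (F (RtoC s) - F (RtoC t) - l * RtoC (s - t)%R)).
    + apply re_le_Cmod.
    + unfold Cminus. rewrite !re_plus, !re_opp, re_scal_r. ring.
  - change (Rabs (Im (F (RtoC s)) - Im (F (RtoC t)) - (s - t) * Im l)
            <= Cmod (F (RtoC s) - F (RtoC t) - l * RtoC (s - t)))%R.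
    replace (_ - _ - _)%R with (Im (F (RtoC s) - F (RtoC t) - l * RtoC (s - t)%R)).
    + apply im_le_Cmod.
    + unfold Cminus. rewrite !im_plus, !im_opp, im_scal_r. ring.
Qed.

Lemma CRint_derive (F f : C -> C) (a b : R) :
  (forall t : R, Cderiv F (RtoC t) (f (RtoC t))) ->
  (forall t : R, Ccont f (RtoC t)) ->
  CRint f a b = F (RtoC b) - F (RtoC a).
Proof.
  intros HF Hf.
  apply injective_projections; simpl; apply (@is_RInt_unique R_CompleteNormedModule).
  - apply (is_RInt_derive (V := R_CompleteNormedModule) (fun t => Re (F (RtoC t)))); intros t _.
    + apply (Cderiv_real F t _ (HF t)).
    + apply (Ccont_real f t (Hf t)).
  - apply (is_RInt_derive (V := R_CompleteNormedModule) (fun t => Im (F (RtoC t)))); intros t _.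
    + apply (Cderiv_real F t _ (HF t)).
    + apply (Ccont_real f t (Hf t)).
Qed.

(** * The Cauchy kernel *)

Lemma Ccont_pow (f : C -> C) (z : C) (n : nat) :
  Ccont f z -> Ccont (fun x => f x ^ n) z.
Proof.
  intro H. induction n as [|n IH]; [apply (Ccont_const 1)|].
  simpl. apply Ccont_mult; assumption.
Qed.

Definition circle (r : R) (t : C) : C := RtoC r * Cexp (Ci * t).

Lemma Cmod_circle (r t : R) : (0 <= r)%R -> Cmod (circle r (RtoC t)) = r.
Proof.
  intro Hr. unfold circle. rewrite Cmod_mult, Cmod_R, Cmod_Cexp, Rabs_pos_eq by exact Hr.
  rewrite re_scal_r. simpl. rewrite Rmult_0_l, exp_0. ring.
Qed.

Lemma Cderiv_circle (r : R) (t : C) : Cderiv (circle r) t (Ci * circle r t).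
Proof.
  unfold circle. replace (Ci * (RtoC r * Cexp (Ci * t)))
    with (RtoC r * (Cexp (Ci * t) * (Ci * 1))) by ring.
  apply Cderiv_scal, (Cderiv_comp Cexp (fun x => Ci * x)); [apply Cderiv_Cexp|].
  apply Cderiv_scal, Cderiv_id.
Qed.

Lemma Ccont_circle (r : R) (t : C) : Ccont (circle r) t.
Proof. exact (Cderiv_cont _ _ _ (Cderiv_circle r t)). Qed.

Lemma Cexp_2PI_nat (n : nat) : Cexp (- RtoC (INR n) * Ci * RtoC (2 * PI)) = 1.
Proof.
  induction n as [|n IH].
  - replace (- RtoC (INR 0) * Ci * RtoC (2 * PI)) with (RtoC 0) by (simpl; ring).
    apply Cexp_0.
  - rewrite S_INR, RtoC_plus.
    replace (- (RtoC (INR n) + 1) * Ci * RtoC (2 * PI))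
      with (- RtoC (INR n) * Ci * RtoC (2 * PI) + - (Ci * RtoC (2 * PI))) by ring.
    rewrite Cexp_plus, IH. unfold Cexp, RtoC. simpl.
    replace (- (0 * (2 * PI) - 1 * 0))%R with 0%R by ring.
    replace (- (0 * 0 + 1 * (2 * PI)))%R with (- (2 * PI))%R by ring.
    rewrite exp_0, cos_neg, sin_neg, cos_2PI, sin_2PI.
    unfold Cmult; simpl. f_equal; ring.
Qed.

Lemma circle_periodic (r : R) : circle r (RtoC (2 * PI)) = circle r (RtoC 0).
Proof.
  unfold circle. f_equal.
  replace (Ci * RtoC 0) with (RtoC 0) by ring. rewrite Cexp_0.
  unfold Cexp, RtoC. simpl.
  replace (0 * (2 * PI) - 1 * 0)%R with 0%R by ring.
  replace (0 * 0 + 1 * (2 * PI))%R with (2 * PI)%R by ring.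
  rewrite exp_0, cos_2PI, sin_2PI. f_equal; ring.
Qed.

Lemma circle_neq_0 (r : R) (t : C) : (0 < r)%R -> circle r t <> 0.
Proof.
  intro Hr. apply Cmult_neq_0; [|apply Cexp_neq_0].
  intro E. apply RtoC_inj in E. lra.
Qed.

Lemma circle_minus_bound (r t : R) (z : C) :
  (0 <= r)%R -> (r - Cmod z <= Cmod (circle r (RtoC t) - z)%C)%R.
Proof.
  intro Hr. rewrite <- (Cmod_circle r t Hr) at 1. apply Cmod_triangle_inv.
Qed.

Lemma circle_minus_neq_0 (r t : R) (z : C) :
  (Cmod z < r)%R -> circle r (RtoC t) - z <> 0.
Proof.
  intro H. apply Cmod_gt_0.
  generalize (circle_minus_bound r t z). generalize (Cmod_ge_0 z). lra.
Qed.

(** On [zeta = circle r t] one has [d zeta = i zeta dt], so this is [d zeta / (zeta - z)] without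
    the factor [i]; accordingly [2 PI] stands for [2 PI i] below. *)
Definition cauchy_kernel (r : R) (z t : C) : C := circle r t / (circle r t - z).

Lemma Ccont_cauchy_kernel (r t : R) (z : C) :
  (Cmod z < r)%R -> Ccont (cauchy_kernel r z) (RtoC t).
Proof.
  intro H. apply Ccont_mult; [apply Ccont_circle|].
  apply (Ccont_inv (fun t => circle r t - z)).
  - apply Ccont_plus; [apply Ccont_circle|apply Ccont_const].
  - apply circle_minus_neq_0, H.
Qed.

Lemma cauchy_kernel_bound (r t : R) (z : C) :
  (Cmod z < r)%R -> (Cmod (cauchy_kernel r z (RtoC t)) <= r / (r - Cmod z))%R.
Proof.
  intro H. assert (H0 := Cmod_ge_0 z). unfold cauchy_kernel.
  rewrite Cmod_div by (apply circle_minus_neq_0, H).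
  rewrite Cmod_circle by lra. apply Rmult_le_compat_l; [lra|].
  apply Rinv_le_contravar; [lra|]. apply circle_minus_bound. lra.
Qed.

Lemma Ccont_real_Cmod (F : C -> C) (t : R) :
  Ccont F (RtoC t) -> continuous (fun s : R => Cmod (F (RtoC s))) t.
Proof.
  intro H. apply filterlim_locally. intros [eps He].
  destruct (H eps He) as (d & Hd & L). exists (mkposreal d Hd). intros s Hs.
  assert (Q : (Cmod (RtoC s - RtoC t) < d)%R) by (rewrite <- RtoC_minus, Cmod_R; exact Hs).
  specialize (L _ Q).
  change (Rabs (Cmod (F (RtoC s)) - Cmod (F (RtoC t))) < eps)%R.
  assert (A := Cmod_triangle_inv (F (RtoC s)) (F (RtoC t))).
  assert (B := Cmod_triangle_inv (F (RtoC t)) (F (RtoC s))).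
  replace (F (RtoC t) - F (RtoC s)) with (- (F (RtoC s) - F (RtoC t))) in B by ring.
  rewrite Cmod_opp in B. apply Rabs_lt_between. lra.
Qed.

(** Finite geometric expansion of the kernel in [z / zeta] with its exact remainder, the kernel
    times [(z / zeta)^(n+1)]. The integrated remainder is of order [(|z| / r)^(n+1)], which replaces
    an exchange of sum and integral. *)
Lemma cauchy_kernel_series (G : C -> C) (r : R) (z : C) :
  (forall t : R, Ccont G (RtoC t)) -> (Cmod z < r)%R ->
  Cseries (fun n => CRint (fun t => G t * (/ circle r t) ^ n) 0 (2 * PI) * z ^ n)
          (CRint (fun t => G t * cauchy_kernel r z t) 0 (2 * PI)).
Proof.
  intros HG Hz. assert (Hz0 := Cmod_ge_0 z). assert (Hr : (0 < r)%R) by lra.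
  assert (HI : forall t : R, Ccont (fun t => / circle r t) (RtoC t)).
  { intro t. apply (Ccont_inv (circle r)); [apply Ccont_circle|apply circle_neq_0, Hr]. }
  assert (HK : forall t : R, Ccont (fun t => G t * cauchy_kernel r z t) (RtoC t)).
  { intro t. apply Ccont_mult; [apply HG|apply Ccont_cauchy_kernel, Hz]. }
  assert (HP : forall n (t : R), Ccont (fun t => G t * (/ circle r t) ^ n) (RtoC t)).
  { intros n t. apply Ccont_mult; [apply HG|]. apply (Ccont_pow (fun t => / circle r t)), HI. }
  assert (HQ : forall n (t : R), Ccont (fun t => G t * cauchy_kernel r z t * (z / circle r t) ^ n) (RtoC t)).
  { intros n t. apply Ccont_mult; [apply HK|].
    apply (Ccont_pow (fun t => z / circle r t)). apply Ccont_mult; [apply Ccont_const|apply HI]. }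
  assert (Step : forall n,
     CRint (fun t => G t * cauchy_kernel r z t * (z / circle r t) ^ n) 0 (2 * PI)
     = CRint (fun t => G t * (/ circle r t) ^ n) 0 (2 * PI) * z ^ n
       + CRint (fun t => G t * cauchy_kernel r z t * (z / circle r t) ^ S n) 0 (2 * PI)).
  { intro n. rewrite (Cmult_comm _ (z ^ n)), <- CRint_scal by apply HP.
    rewrite <- CRint_plus; [|intro t; apply Ccont_mult; [apply Ccont_const|apply HP]|apply HQ].
    apply CRint_ext. intro t.
    assert (N1 := circle_neq_0 r (RtoC t) Hr).
    assert (N2 := circle_minus_neq_0 r t z Hz).
    rewrite Cpow_S. unfold cauchy_kernel.
    set (c := circle r (RtoC t)) in *.
    replace ((z / c) ^ n) with (z ^ n * (/ c) ^ n) by (symmetry; apply Cpow_mult_l).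
    generalize (z ^ n) ((/ c) ^ n). intros x y. field. split; assumption. }
  set (rest := fun n => CRint (fun t => G t * cauchy_kernel r z t * (z / circle r t) ^ S n) 0 (2 * PI)).
  assert (Sum : forall n, sum_n (G := C_AbelianMonoid)
      (fun n => CRint (fun t => G t * (/ circle r t) ^ n) 0 (2 * PI) * z ^ n) n
      - CRint (fun t => G t * cauchy_kernel r z t) 0 (2 * PI) = - rest n).
  { intro n. unfold rest. induction n as [|n IH].
    - rewrite sum_O. rewrite (CRint_ext (fun t => G t * cauchy_kernel r z t)
        (fun t => G t * cauchy_kernel r z t * (z / circle r t) ^ 0)).
      + rewrite (Step O). ring.
      + intro t. simpl. ring.
    - rewrite sum_Sn. rewrite (Step (S n)) in IH.
      match goal with |- ?s - ?i = _ => change s with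
        (sum_n (G := C_AbelianMonoid) (fun n => CRint (fun t => G t * (/ circle r t) ^ n) 0 (2 * PI) * z ^ n) n
         + CRint (fun t => G t * (/ circle r t) ^ S n) 0 (2 * PI) * z ^ S n) end.
      match type of IH with ?s - ?i = _ => replace s with (s - i + i) by ring end.
      rewrite IH. ring. }
  apply Cseries_eps. intros eps He.
  set (I := RInt (fun t => Cmod (G (RtoC t))) 0 (2 * PI)).
  assert (PP := PI_RGT_0).
  assert (HIc : ex_RInt (fun t => Cmod (G (RtoC t))) 0 (2 * PI)).
  { apply (ex_RInt_continuous (V := R_CompleteNormedModule)). intros t _.
    apply Ccont_real_Cmod, HG. }
  assert (HI0 : (0 <= I)%R).
  { apply RInt_ge_0; [lra|exact HIc|]. intros t _. apply Cmod_ge_0. }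
  set (M := (r / (r - Cmod z))%R).
  assert (HM : (0 < M)%R) by (apply Rdiv_lt_0_compat; lra).
  set (rho := (Cmod z / r)%R).
  assert (Hrho : (0 <= rho < 1)%R).
  { unfold rho. split; [apply Rdiv_le_0_compat; lra|].
    apply Rmult_lt_reg_r with r; [lra|]. unfold Rdiv. rewrite Rmult_assoc, Rinv_l; lra. }
  assert (B : forall n, (Cmod (rest n) <= 2 * (M * rho ^ S n * I))%R).
  { intro n. unfold rest, I.
    rewrite <- (is_RInt_unique (V := R_CompleteNormedModule)
      (fun t => M * rho ^ S n * Cmod (G (RtoC t)))%R 0 (2 * PI)
      (M * rho ^ S n * RInt (fun t => Cmod (G (RtoC t))) 0 (2 * PI))%R).
    2:{ apply (is_RInt_scal (V := R_NormedModule)).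
        apply (RInt_correct (V := R_CompleteNormedModule)). exact HIc. }
    apply CRint_bound; [lra|intro t; apply (HQ (S n))| |].
    - apply (ex_RInt_scal (V := R_NormedModule)). exact HIc.
    - intro t. rewrite !Cmod_mult, Cmod_pow, Cmod_div by (apply circle_neq_0, Hr).
      rewrite Cmod_circle by lra. fold rho.
      assert (A := cauchy_kernel_bound r t z Hz). fold M in A.
      assert (A2 : (0 <= rho ^ S n)%R) by (apply pow_le; lra).
      replace (M * rho ^ S n * Cmod (G (RtoC t)))%R
        with (Cmod (G (RtoC t)) * M * rho ^ S n)%R by ring.
      apply Rmult_le_compat_r; [exact A2|].
      apply Rmult_le_compat_l; [apply Cmod_ge_0|exact A]. }
  (* The summand 1 keeps the denominator positive when [M * I] is zero. *)
  destruct (pow_lt_1_zero rho) with (y := (eps / (2 * (M * I) + 1))%R) as [N HN].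
  { rewrite Rabs_pos_eq; lra. }
  { apply Rdiv_lt_0_compat; [lra|]. assert (0 <= M * I)%R by (apply Rmult_le_pos; lra). lra. }
  exists N. intros n Hn. rewrite Sum, Cmod_opp.
  eapply Rle_lt_trans; [apply B|].
  assert (H1 := HN (S n) ltac:(lia)).
  assert (A2 : (0 <= rho ^ S n)%R) by (apply pow_le; lra).
  rewrite Rabs_pos_eq in H1 by exact A2.
  set (x := (rho ^ S n)%R) in *.
  assert (A3 : (0 <= M * I)%R) by (apply Rmult_le_pos; lra).
  apply Rmult_lt_compat_r with (r := (2 * (M * I) + 1)%R) in H1; [|lra].
  replace (eps / (2 * (M * I) + 1) * (2 * (M * I) + 1))%R with eps in H1 by (field; lra).
  nra.
Qed.

Lemma CRint_const (c : C) (a b : R) : CRint (fun _ => c) a b = c * RtoC (b - a).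
Proof.
  unfold CRint. rewrite !RInt_const. unfold scal, Cmult; simpl. unfold mult; simpl.
  unfold Re, Im. f_equal; ring.
Qed.

Lemma circle_inv_pow (r : R) (n : nat) (t : C) : (0 < r)%R ->
  (/ circle r t) ^ n = (/ RtoC r) ^ n * Cexp (- RtoC (INR n) * Ci * t).
Proof.
  intro Hr. assert (Nr : RtoC r <> 0) by (intro E; apply RtoC_inj in E; lra).
  induction n as [|n IH].
  - simpl. replace (- 0 * Ci * t) with (RtoC 0) by ring. rewrite Cexp_0. ring.
  - rewrite !Cpow_S, IH, S_INR, RtoC_plus.
    replace (- (RtoC (INR n) + 1) * Ci * t)
      with (- RtoC (INR n) * Ci * t + - (Ci * t)) by ring.
    rewrite Cexp_plus. unfold circle.
    assert (E : Cexp (Ci * t) * Cexp (- (Ci * t)) = 1).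
    { rewrite <- Cexp_plus. replace (Ci * t + - (Ci * t)) with (RtoC 0) by ring. apply Cexp_0. }
    assert (Ne := Cexp_neq_0 (Ci * t)).
    replace (Cexp (- (Ci * t))) with (/ Cexp (Ci * t)).
    + field. split; assumption.
    + replace (Cexp (- (Ci * t))) with (/ Cexp (Ci * t) * (Cexp (Ci * t) * Cexp (- (Ci * t))))
        by (field; exact Ne).
      rewrite E. ring.
Qed.

(** An exponential of nonzero integer frequency has a periodic primitive. *)
Lemma CRint_circle_inv_pow (r : R) (n : nat) : (0 < r)%R ->
  CRint (fun t => (/ circle r t) ^ S n) 0 (2 * PI) = 0.
Proof.
  intro Hr.
  assert (Nn : RtoC (INR (S n)) <> 0).
  { intro E. apply RtoC_inj in E. apply (not_0_INR (S n)); [discriminate|exact E]. }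
  set (k := - RtoC (INR (S n)) * Ci).
  assert (Nk : k <> 0).
  { unfold k. intro E. apply Nn.
    replace (RtoC (INR (S n))) with (- RtoC (INR (S n)) * Ci * Ci).
    - rewrite E. ring.
    - replace (- RtoC (INR (S n)) * Ci * Ci) with (- RtoC (INR (S n)) * (Ci * Ci)) by ring.
      replace (Ci * Ci) with (RtoC (-1)) by (unfold Ci, Cmult, RtoC; simpl; f_equal; ring).
      ring. }
  rewrite (CRint_ext _ (fun t => (/ RtoC r) ^ S n * Cexp (k * t))).
  2:{ intro t. apply circle_inv_pow, Hr. }
  assert (HD : forall t, Cderiv (fun t => Cexp (k * t)) t (Cexp (k * t) * (k * 1))).
  { intro t. apply (Cderiv_comp Cexp (fun t => k * t)); [apply Cderiv_Cexp|].
    apply Cderiv_scal, Cderiv_id. }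
  rewrite CRint_scal by (intro t; apply (Cderiv_cont _ _ _ (HD _))).
  rewrite (CRint_derive (fun t => / k * Cexp (k * t))).
  - replace (k * RtoC 0) with (RtoC 0) by ring. rewrite Cexp_0.
    unfold k at 2. rewrite Cexp_2PI_nat. ring.
  - intro t. replace (Cexp (k * RtoC t)) with (/ k * (Cexp (k * RtoC t) * (k * 1)))
      by (field; exact Nk).
    apply Cderiv_scal, HD.
  - intro t. apply (Cderiv_cont _ _ _ (HD _)).
Qed.

(** In the expansion with [G = 1] only the term of index 0 survives. *)
Lemma CRint_cauchy_kernel (r : R) (z : C) : (Cmod z < r)%R ->
  CRint (cauchy_kernel r z) 0 (2 * PI) = RtoC (2 * PI).
Proof.
  intro Hz. assert (Hr : (0 < r)%R) by (generalize (Cmod_ge_0 z); lra).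
  assert (K := cauchy_kernel_series (fun _ => 1) r z (fun t => Ccont_const _ _) Hz).
  rewrite (CRint_ext (cauchy_kernel r z) (fun t => 1 * cauchy_kernel r z t))
    by (intro; ring).
  apply (Cseries_unique _ _ _ K).
  apply Cseries_decr. rewrite (CRint_ext (fun t => 1 * (/ circle r t) ^ 0) (fun _ => 1))
    by (intro; simpl; ring).
  rewrite CRint_const. simpl.
  match goal with |- Cseries _ ?x => replace x with (RtoC 0) by (rewrite Rminus_0_r; ring) end.
  apply Cseries_ext with (fun _ => 0); [|apply Cseries_zero].
  intro n. rewrite (CRint_ext _ (fun t => (/ circle r t) ^ S n)).
  - rewrite CRint_circle_inv_pow by exact Hr. ring.
  - intro t. rewrite !Cpow_S. ring.
Qed.

(** * Cauchy's formula *)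

(** Straight-line contraction of the circle ([s = 1]) to the point [z] ([s = 0]). *)
Definition homotopy (r : R) (z s t : C) : C := z + s * (circle r t - z).

(** The parameter may overshoot [0, 1] on both sides, because two-sided derivatives are taken at the
    end points too. With this margin the modulus stays below [r + (rr - r) / 2]. *)
Lemma Cmod_homotopy (r rr s t : R) (z : C) :
  (Cmod z < r < rr)%R -> (- ((rr - r) / (4 * r)) < s < 1 + (rr - r) / (4 * r))%R ->
  (Cmod (homotopy r z (RtoC s) (RtoC t)) < rr)%R.
Proof.
  intros Hz Hs. assert (H0 := Cmod_ge_0 z). unfold homotopy.
  replace (z + RtoC s * (circle r (RtoC t) - z))
    with (RtoC (1 - s) * z + RtoC s * circle r (RtoC t))
    by (rewrite RtoC_minus; ring).
  eapply Rle_lt_trans; [apply Cmod_triangle|].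
  rewrite !Cmod_mult, !Cmod_R, Cmod_circle by lra.
  set (d := ((rr - r) / (4 * r))%R) in *.
  assert (D : (d * r = (rr - r) / 4)%R) by (unfold d; field; lra).
  assert (A : (Rabs (1 - s) * Cmod z <= Rabs (1 - s) * r)%R).
  { apply Rmult_le_compat_l; [apply Rabs_pos|lra]. }
  unfold Rabs in *. destruct (Rcase_abs s), (Rcase_abs (1 - s)); nra.
Qed.

Section CauchyFormula.

Variables (g g' : C -> C) (rr r : R) (z : C).
Hypothesis Dg : forall x, (Cmod x < rr)%R -> Cderiv g x (g' x).
Hypothesis Cg' : forall x, (Cmod x < rr)%R -> Ccont g' x.
Hypothesis Hr : (Cmod z < r < rr)%R.

Let del := ((rr - r) / (4 * r))%R.

Lemma homotopy_margin_pos : (0 < del)%R.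
Proof.
  assert (H0 := Cmod_ge_0 z). apply Rdiv_lt_0_compat; lra.
Qed.

(** The inner derivative [circle r t - z] cancels the denominator of the kernel, which is what makes
    the integral over [t] computable. *)
Lemma Cderiv_homotopy_time (s t : R) : (- del < s < 1 + del)%R ->
  Cderiv (fun s => g (homotopy r z s (RtoC t)) * cauchy_kernel r z (RtoC t)) (RtoC s)
    (g' (homotopy r z (RtoC s) (RtoC t)) * circle r (RtoC t)).
Proof.
  intro Hs.
  assert (N := circle_minus_neq_0 r t z (proj1 Hr)).
  replace (g' (homotopy r z (RtoC s) (RtoC t)) * circle r (RtoC t))
    with (g' (homotopy r z (RtoC s) (RtoC t)) * (0 + (1 * (circle r (RtoC t) - z) + RtoC s * 0))
            * cauchy_kernel r z (RtoC t)
          + g (homotopy r z (RtoC s) (RtoC t)) * 0)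
    by (unfold cauchy_kernel; field; exact N).
  apply (Cderiv_mult (fun s => g (homotopy r z s (RtoC t))) (fun _ => cauchy_kernel r z (RtoC t)));
    [|apply Cderiv_const].
  apply (Cderiv_comp g (fun s => homotopy r z s (RtoC t))).
  - apply Dg, Cmod_homotopy; assumption.
  - apply Cderiv_plus; [apply Cderiv_const|].
    apply (Cderiv_mult (fun s => s) (fun _ => circle r (RtoC t) - z)); [apply Cderiv_id|apply Cderiv_const].
Qed.

Lemma Cderiv_homotopy_angle (s : R) (t : C) :
  Cderiv (fun t => homotopy r z (RtoC s) t) t (RtoC s * (Ci * circle r t)).
Proof.
  unfold homotopy. replace (RtoC s * (Ci * circle r t))
    with (0 + RtoC s * (Ci * circle r t - 0)) by ring.
  apply Cderiv_plus; [apply Cderiv_const|].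
  apply Cderiv_scal, Cderiv_minus; [apply Cderiv_circle|apply Cderiv_const].
Qed.

(** Up to the factor [1 / (i s)] the integrand is the derivative in [t] of [g (homotopy r z s t)],
    which is periodic. The division by [s] excludes [s = 0]. *)
Lemma homotopy_derivative_integral (s : R) : (0 < s < 1 + del)%R ->
  CRint (fun t => g' (homotopy r z (RtoC s) t) * circle r t) 0 (2 * PI) = 0.
Proof.
  intro Hs. assert (P := homotopy_margin_pos).
  assert (Ns : RtoC s <> 0) by (intro E; apply RtoC_inj in E; lra).
  assert (In : forall t : R, (Cmod (homotopy r z (RtoC s) (RtoC t)) < rr)%R).
  { intro t. apply Cmod_homotopy; [exact Hr|]. fold del. lra. }
  rewrite (CRint_derive (fun t => / (Ci * RtoC s) * g (homotopy r z (RtoC s) t))).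
  - unfold homotopy. rewrite circle_periodic. ring.
  - intro t.
    replace (g' (homotopy r z (RtoC s) (RtoC t)) * circle r (RtoC t))
      with (/ (Ci * RtoC s) * (g' (homotopy r z (RtoC s) (RtoC t))
              * (RtoC s * (Ci * circle r (RtoC t)))))
      by (field; split; [exact Ns|exact Ci_nz]).
    apply Cderiv_scal, (Cderiv_comp g (fun t => homotopy r z (RtoC s) t)).
    + apply Dg, In.
    + apply Cderiv_homotopy_angle.
  - intro t. apply Ccont_mult; [|apply Ccont_circle].
    apply (Ccont_comp g' (fun t => homotopy r z (RtoC s) t)).
    + exact (Cderiv_cont _ _ _ (Cderiv_homotopy_angle s _)).
    + apply Cg', In.
Qed.

(** Joint continuity in the two real parameters, as differentiation under the integral sign
    demands. *)
Lemma homotopy_derivative_cont2 (s t : R) : (- del < s < 1 + del)%R ->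
  forall eps : R, (0 < eps)%R -> exists d : R, (0 < d)%R /\ forall u v : R,
    (Rabs (u - s) < d)%R -> (Rabs (v - t) < d)%R ->
    (Cmod (g' (homotopy r z (RtoC u) (RtoC v)) * circle r (RtoC v)
           - g' (homotopy r z (RtoC s) (RtoC t)) * circle r (RtoC t))%C < eps)%R.
Proof.
  intros Hs eps He. assert (H0 := Cmod_ge_0 z).
  set (P := homotopy r z (RtoC s) (RtoC t)).
  assert (HP : (Cmod P < rr)%R) by (apply Cmod_homotopy; assumption).
  set (M := Cmod (g' P)). assert (HM : (0 <= M)%R) by apply Cmod_ge_0.
  destruct (Cg' P HP (eps / (2 * r))%R) as (d1 & D1 & K1).
  { apply Rdiv_lt_0_compat; lra. }
  assert (As := Rabs_pos s).
  destruct (Ccont_circle r (RtoC t)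
    (Rmin (d1 / (2 * (Rabs s + 1))) (eps / (2 * (M + 1))))) as (d2 & D2 & K2).
  { apply Rmin_pos; apply Rdiv_lt_0_compat; lra. }
  (* Moving [s] displaces the point by at most [d1 / (4 r) * 2 r], moving [t] by less than [d1 / 2];
     together they stay within the range [d1] granted by [g']. *)
  exists (Rmin d2 (d1 / (4 * r))). split.
  { apply Rmin_pos; [exact D2|]. apply Rdiv_lt_0_compat; lra. }
  intros u v Hu Hv.
  assert (Lu := Rlt_le_trans _ _ _ Hu (Rmin_r _ _)).
  assert (Lv := Rlt_le_trans _ _ _ Hv (Rmin_l _ _)).
  assert (Q : (Cmod (RtoC v - RtoC t) < d2)%R) by (rewrite <- RtoC_minus, Cmod_R; exact Lv).
  assert (K := K2 _ Q).
  set (cv := circle r (RtoC v)) in *. set (ct := circle r (RtoC t)) in *.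
  assert (Ka := Rlt_le_trans _ _ _ K (Rmin_l _ _)).
  assert (Kb := Rlt_le_trans _ _ _ K (Rmin_r _ _)).
  assert (Mcv : Cmod cv = r) by (apply Cmod_circle; lra).
  assert (near : (Cmod (homotopy r z (RtoC u) (RtoC v) - P) < d1)%R).
  { unfold P, homotopy. fold cv ct.
    replace (z + RtoC u * (cv - z) - (z + RtoC s * (ct - z)))
      with (RtoC (u - s) * (cv - z) + RtoC s * (cv - ct)) by (rewrite RtoC_minus; ring).
    eapply Rle_lt_trans; [apply Cmod_triangle|]. rewrite !Cmod_mult, !Cmod_R.
    assert (X := Cmod_triangle' cv z). rewrite Mcv in X.
    assert (Y1 : (Rabs (u - s) * Cmod (cv - z) <= d1 / (4 * r) * (2 * r))%R).
    { apply Rmult_le_compat; [apply Rabs_pos|apply Cmod_ge_0|lra|lra]. }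
    replace (d1 / (4 * r) * (2 * r))%R with (d1 / 2)%R in Y1 by (field; lra).
    apply Rmult_lt_compat_r with (r := (Rabs s + 1)%R) in Ka; [|lra].
    replace (d1 / (2 * (Rabs s + 1)) * (Rabs s + 1))%R with (d1 / 2)%R in Ka by (field; lra).
    assert (X2 := Cmod_ge_0 (cv - ct)). nra. }
  assert (N := K1 _ near). set (w := homotopy r z (RtoC u) (RtoC v)) in *.
  replace (g' w * cv - g' P * ct) with ((g' w - g' P) * cv + g' P * (cv - ct)) by ring.
  eapply Rle_lt_trans; [apply Cmod_triangle|]. rewrite !Cmod_mult, Mcv. fold M.
  apply Rmult_lt_compat_r with (r := r) in N; [|lra].
  replace (eps / (2 * r) * r)%R with (eps / 2)%R in N by (field; lra).
  apply Rmult_lt_compat_r with (r := (M + 1)%R) in Kb; [|lra].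
  replace (eps / (2 * (M + 1)) * (M + 1))%R with (eps / 2)%R in Kb by (field; lra).
  assert (X2 := Cmod_ge_0 (cv - ct)). nra.
Qed.

Lemma Ccont_homotopy_integrand (s t : R) : (- del < s < 1 + del)%R ->
  Ccont (fun t => g (homotopy r z (RtoC s) t) * cauchy_kernel r z t) (RtoC t).
Proof.
  intro Hs. apply Ccont_mult; [|apply Ccont_cauchy_kernel, Hr].
  apply (Ccont_comp g (fun t => homotopy r z (RtoC s) t)).
  - exact (Cderiv_cont _ _ _ (Cderiv_homotopy_angle s _)).
  - apply (Cderiv_cont g _ _ (Dg _ (Cmod_homotopy r rr s t z Hr Hs))).
Qed.

Lemma homotopy_range_open (s : R) : (- del < s < 1 + del)%R ->
  locally s (fun u : R => (- del < u < 1 + del)%R).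
Proof.
  intro Hs. apply (open_and (fun u : R => - del < u)%R (fun u : R => u < 1 + del)%R);
    [apply open_gt|apply open_lt|exact Hs].
Qed.

Let Phi (s : R) : C :=
  CRint (fun t => g (homotopy r z (RtoC s) t) * cauchy_kernel r z t) 0 (2 * PI).

(** Differentiation under the integral sign is a real theorem; [p] lets one argument treat the real
    and the imaginary part. *)
Lemma is_derive_homotopy_integral (p : C -> R) (s : R) :
  (p = Re \/ p = Im) -> (- del < s < 1 + del)%R ->
  is_derive (fun s : R => p (Phi s)) s
    (p (CRint (fun t => g' (homotopy r z (RtoC s) t) * circle r t) 0 (2 * PI))).
Proof.
  intros Hp Hs.
  assert (Pint : forall F, p (CRint F 0 (2 * PI)) = RInt (fun t => p (F (RtoC t))) 0 (2 * PI)).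
  { intro F. destruct Hp as [-> | ->]; reflexivity. }
  assert (Pd : forall F t l, Cderiv F (RtoC t) l -> is_derive (fun s : R => p (F (RtoC s))) t (p l)).
  { intros F t l H. destruct Hp as [-> | ->]; apply (Cderiv_real F t l H). }
  assert (Pm : forall a b : C, (Rabs (p a - p b) <= Cmod (a - b))%R).
  { intros a b. destruct Hp as [-> | ->].
    - exact (re_le_Cmod (a - b)).
    - exact (im_le_Cmod (a - b)). }
  set (f := fun u t : R => p (g (homotopy r z (RtoC u) (RtoC t)) * cauchy_kernel r z (RtoC t))).
  set (f' := fun u t : R => p (g' (homotopy r z (RtoC u) (RtoC t)) * circle r (RtoC t))).
  assert (Df : forall u t, (- del < u < 1 + del)%R -> is_derive (fun s : R => f s t) u (f' u t)).
  { intros u t Hu. exact (Pd _ u _ (Cderiv_homotopy_time u t Hu)). }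
  apply is_derive_ext with (fun s : R => RInt (fun t => f s t) 0 (2 * PI)).
  { intro u. symmetry. apply Pint. }
  rewrite Pint. fold (f' s).
  rewrite (RInt_ext (fun t => p (g' (homotopy r z (RtoC s) (RtoC t)) * circle r (RtoC t)))
             (fun t => Derive (fun u => f u t) s)).
  2:{ intros t _. symmetry. apply is_derive_unique. apply Df, Hs. }
  assert (Ex : locally s (fun u : R => (- del < u < 1 + del)%R)) by (apply homotopy_range_open, Hs).
  apply is_derive_RInt_param.
  - revert Ex. apply filter_imp. intros u Hu t _. exists (f' u t). apply Df, Hu.
  - intros t _. apply continuity_2d_pt_ext_loc with f'.
    + destruct Ex as [d Hd]. exists d. intros u v Hu _. symmetry.
      apply is_derive_unique. apply Df. apply Hd. exact Hu.
    + intros [eps He]. destruct (homotopy_derivative_cont2 s t Hs eps He) as (d & Hd & K).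
      exists (mkposreal d Hd). intros u v Hu Hv.
      eapply Rle_lt_trans; [apply Pm|]. exact (K u v Hu Hv).
  - revert Ex. apply filter_imp. intros u Hu.
    destruct (ex_CRint (fun t => g (homotopy r z (RtoC u) t) * cauchy_kernel r z t) 0 (2 * PI)
      (fun t => Ccont_homotopy_integrand u t Hu)) as [E1 E2].
    unfold f. destruct Hp as [-> | ->]; assumption.
Qed.

Lemma homotopy_integral_const : Phi 1 = Phi 0.
Proof.
  assert (P := homotopy_margin_pos).
  assert (K : forall p : C -> R, (p = Re \/ p = Im) -> p (Phi 1) = p (Phi 0)).
  { intros p Hp.
    (* The derivative is known to vanish only for [s > 0]; at the end points the mean value theorem
       asks for continuity alone. *)
    destruct (MVT_gen (fun s => p (Phi s)) 0 1 (fun _ => 0%R)) as (c & _ & E).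
    - intros s Hs. rewrite Rmin_left, Rmax_right in Hs by lra.
      replace 0%R with (p (RtoC 0)) by (destruct Hp as [-> | ->]; reflexivity).
      rewrite <- (homotopy_derivative_integral s) by lra.
      apply is_derive_homotopy_integral; [exact Hp|lra].
    - intros s Hs. rewrite Rmin_left, Rmax_right in Hs by lra.
      apply continuity_pt_filterlim.
      apply (ex_derive_continuous (K := R_AbsRing) (V := R_NormedModule)).
      eexists. apply is_derive_homotopy_integral; [exact Hp|lra].
    - lra. }
  apply injective_projections; [apply (K Re)|apply (K Im)]; auto.
Qed.

Theorem cauchy_formula :
  CRint (fun t => g (circle r t) * cauchy_kernel r z t) 0 (2 * PI) = RtoC (2 * PI) * g z.
Proof.
  transitivity (Phi 1).
  { apply CRint_ext. intro t. unfold homotopy. do 2 f_equal. ring. }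
  rewrite homotopy_integral_const. unfold Phi.
  rewrite (CRint_ext _ (fun t => g z * cauchy_kernel r z t)).
  - rewrite CRint_scal by (intro t; apply Ccont_cauchy_kernel, Hr).
    rewrite CRint_cauchy_kernel by apply Hr. ring.
  - intro t. unfold homotopy. do 2 f_equal. ring.
Qed.

End CauchyFormula.

(** Cauchy's formula on the circle of radius [r] yields coefficients that depend on [r] and a series
    valid for [|z| < r]. By uniqueness of coefficients near 0 they agree with those for [rr / 2], so
    one series serves the whole disc. *)
Lemma holomorphic_pseries (g g' : C -> C) (rr : R) :
  (0 < rr)%R ->
  (forall x, (Cmod x < rr)%R -> Cderiv g x (g' x)) ->
  (forall x, (Cmod x < rr)%R -> Ccont g' x) ->
  exists a : nat -> C, forall z, (Cmod z < rr)%R -> Cseries (fun n => a n * z ^ n) (g z).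
Proof.
  intros Hrr Dg Cg'. assert (PP := PI_RGT_0).
  set (a := fun r n => / RtoC (2 * PI) * CRint (fun t => g (circle r t) * (/ circle r t) ^ n) 0 (2 * PI)).
  assert (Ha : forall r z, (Cmod z < r < rr)%R -> Cseries (fun n => a r n * z ^ n) (g z)).
  { intros r z Hz. assert (H0 := Cmod_ge_0 z).
    assert (N : RtoC (2 * PI) <> 0) by (intro E; apply RtoC_inj in E; lra).
    replace (g z) with (/ RtoC (2 * PI) * (RtoC (2 * PI) * g z)) by (field; exact N).
    rewrite <- (cauchy_formula g g' rr r z Dg Cg' Hz).
    assert (K := cauchy_kernel_series (fun t => g (circle r t)) r z).
    apply (Cseries_scal (/ RtoC (2 * PI))) in K; [|intro t|apply Hz].
    - revert K. apply Cseries_ext. intro n. unfold a. ring.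
    - apply (Ccont_comp g (circle r)); [apply Ccont_circle|].
      eapply Cderiv_cont, Dg. rewrite Cmod_circle; lra. }
  exists (a (rr / 2)%R). intros z Hz. assert (H0 := Cmod_ge_0 z).
  (* Midway between [rr] and the larger of [|z|] and [rr / 2]: beyond [z], and beyond the reference
     radius so that both series live on a common disc. *)
  set (r := (Rmax (Cmod z) (rr / 2) / 2 + rr / 2)%R).
  assert (Hr : (Cmod z < r < rr)%R /\ (rr / 2 < r)%R).
  { unfold r. unfold Rmax. destruct (Rle_dec (Cmod z) (rr / 2)); lra. }
  apply Cseries_ext with (fun n => a r n * z ^ n); [|apply Ha, Hr].
  intro n. f_equal.
  apply (pseries_coef_unique (rr / 2)%R n ltac:(lra) (a r) (a (rr / 2)%R) g);
    intros h Hh; apply Ha; lra.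
Qed.

(** * Analytic functions on the disc *)

Lemma unit_disc_0 : unit_disc 0.
Proof. unfold unit_disc. rewrite Cmod_0. lra. Qed.

Lemma unit_disc_nbhd (z : C) : unit_disc z ->
  exists r, (0 < r)%R /\ forall y, (Cmod (y - z) < r)%R -> unit_disc y.
Proof.
  intro Hz. exists (1 - Cmod z)%R. unfold unit_disc in *. split; [lra|].
  intros y Hy. replace y with (z + (y - z)) by ring.
  eapply Rle_lt_trans; [apply Cmod_triangle|]. lra.
Qed.

Lemma Cderiv_ext_disc (f g : C -> C) (z l : C) :
  (forall y, unit_disc y -> f y = g y) -> unit_disc z -> Cderiv f z l -> Cderiv g z l.
Proof.
  intros E Hz. destruct (unit_disc_nbhd z Hz) as (r & Hr & K).
  apply Cderiv_ext_loc with r; auto.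
Qed.

Lemma analytic_local_series (f : C -> C) (z : C) :
  analytic_on_disc f -> unit_disc z -> exists (r : R) (a : nat -> C), (0 < r)%R /\
    forall h, (Cmod h < r)%R -> Cseries (fun n => a n * h ^ n) (f (z + h)).
Proof.
  intros Hf Hz. destruct (Hf z Hz) as (r & a & Hr & K). exists r, a. split; [exact Hr|].
  intros h Hh. apply Cpseries_series. replace h with (z + h - z) at 1 by ring.
  apply K. replace (z + h - z) with h by ring. exact Hh.
Qed.

Lemma Cderiv_shift (f : C -> C) (z h l : C) :
  Cderiv (fun k => f (z + k)) h l <-> Cderiv f (z + h) l.
Proof.
  split; intros (q & Hq & E & Cq); exists q; (split; [|split; assumption]); intro k.
  - rewrite <- Cplus_assoc. apply Hq.
  - rewrite Cplus_assoc. apply Hq.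
Qed.

Lemma analytic_Cderiv (f : C -> C) (z : C) :
  analytic_on_disc f -> unit_disc z -> Cderiv f z (C_derive f z).
Proof.
  intros Hf Hz. destruct (analytic_local_series f z Hf Hz) as (r & a & Hr & K).
  destruct (pseries_derivable a r (fun h => f (z + h)) K 0) as (l & D & _).
  { rewrite Cmod_0. exact Hr. }
  apply (proj1 (Cderiv_shift f z 0 l)) in D. rewrite Cplus_0_r in D.
  rewrite (Cderiv_unique_derive _ _ _ D). exact D.
Qed.

Lemma analytic_cont (f : C -> C) (z : C) :
  analytic_on_disc f -> unit_disc z -> Ccont f z.
Proof. intros Hf Hz. exact (Cderiv_cont _ _ _ (analytic_Cderiv f z Hf Hz)). Qed.

Lemma analytic_derive (f : C -> C) :
  analytic_on_disc f -> analytic_on_disc (C_derive f).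
Proof.
  intros Hf z Hz. destruct (analytic_local_series f z Hf Hz) as (r & a & Hr & K).
  exists r, (Cpseries_derive a). split; [exact Hr|].
  intros y Hy. apply Cpseries_series.
  destruct (pseries_derivable a r (fun h => f (z + h)) K (y - z) Hy) as (l & D & Sl).
  apply (proj1 (Cderiv_shift f z (y - z) l)) in D. replace (z + (y - z)) with y in D by ring.
  rewrite (Cderiv_unique_derive _ _ _ D). exact Sl.
Qed.

(** The way into analyticity: the closure properties and the inverse of the nephroid map reduce to
    rules for [Cderiv] and [Ccont]. Continuity of [f'] is what the contraction argument for Cauchy's
    formula consumes. *)
Lemma analytic_of_C1 (f f' : C -> C) :
  (forall z, unit_disc z -> Cderiv f z (f' z)) ->
  (forall z, unit_disc z -> Ccont f' z) -> analytic_on_disc f.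
Proof.
  intros D K z Hz. destruct (unit_disc_nbhd z Hz) as (r & Hr & N).
  assert (N' : forall x, (Cmod x < r)%R -> unit_disc (z + x)).
  { intros x Hx. apply N. replace (z + x - z) with x by ring. exact Hx. }
  destruct (holomorphic_pseries (fun h => f (z + h)) (fun h => f' (z + h)) r Hr)
    as (a & Ha).
  - intros x Hx. apply (proj2 (Cderiv_shift f z x _)), D, N', Hx.
  - intros x Hx. apply (Ccont_comp f' (fun h => z + h)).
    + apply Ccont_plus; [apply Ccont_const|apply Ccont_id].
    + apply K, N', Hx.
  - exists r, a. split; [exact Hr|]. intros y Hy. apply Cpseries_series.
    assert (E := Ha (y - z) Hy). cbv beta in E.
    replace (z + (y - z)) with y in E by ring. exact E.
Qed.

Lemma analytic_ext (f g : C -> C) :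
  (forall z, unit_disc z -> f z = g z) -> analytic_on_disc f -> analytic_on_disc g.
Proof.
  intros E Hf. apply analytic_of_C1 with (C_derive f); intros z Hz.
  - apply Cderiv_ext_disc with f; auto. apply analytic_Cderiv; assumption.
  - apply analytic_cont; [apply analytic_derive|]; assumption.
Qed.

Lemma analytic_const (c : C) : analytic_on_disc (fun _ => c).
Proof.
  apply analytic_of_C1 with (fun _ => 0); intros z Hz; [apply Cderiv_const|apply Ccont_const].
Qed.

Lemma analytic_id : analytic_on_disc (fun z => z).
Proof.
  apply analytic_of_C1 with (fun _ => 1); intros z Hz; [apply Cderiv_id|apply Ccont_const].
Qed.

Lemma analytic_plus (f g : C -> C) :
  analytic_on_disc f -> analytic_on_disc g -> analytic_on_disc (fun z => f z + g z).
Proof.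
  intros Hf Hg.
  apply analytic_of_C1 with (fun z => C_derive f z + C_derive g z); intros z Hz.
  - apply Cderiv_plus; apply analytic_Cderiv; assumption.
  - apply Ccont_plus; apply analytic_cont; auto using analytic_derive.
Qed.

Lemma analytic_mult (f g : C -> C) :
  analytic_on_disc f -> analytic_on_disc g -> analytic_on_disc (fun z => f z * g z).
Proof.
  intros Hf Hg.
  apply analytic_of_C1 with (fun z => C_derive f z * g z + f z * C_derive g z); intros z Hz.
  - apply Cderiv_mult; apply analytic_Cderiv; assumption.
  - apply Ccont_plus; apply Ccont_mult; apply analytic_cont; auto using analytic_derive.
Qed.

Lemma analytic_opp (f : C -> C) :
  analytic_on_disc f -> analytic_on_disc (fun z => - f z).
Proof.
  intro Hf. apply analytic_ext with (fun z => - (1) * f z); [intros; ring|].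
  apply analytic_mult; [apply analytic_const|exact Hf].
Qed.

Lemma analytic_minus (f g : C -> C) :
  analytic_on_disc f -> analytic_on_disc g -> analytic_on_disc (fun z => f z - g z).
Proof. intros. apply analytic_plus; [|apply analytic_opp]; assumption. Qed.

Lemma analytic_inv (f : C -> C) :
  analytic_on_disc f -> (forall z, unit_disc z -> f z <> 0) ->
  analytic_on_disc (fun z => / f z).
Proof.
  intros Hf N.
  apply analytic_of_C1 with (fun z => - C_derive f z / (f z * f z)); intros z Hz.
  - apply Cderiv_inv; [apply analytic_Cderiv|]; auto.
  - apply Ccont_mult.
    + apply Ccont_opp, analytic_cont; auto using analytic_derive.
    + apply (Ccont_inv (fun z => f z * f z)).
      * apply Ccont_mult; apply analytic_cont; assumption.
      * apply Cmult_neq_0; auto.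
Qed.

Lemma analytic_Cexp (f : C -> C) :
  analytic_on_disc f -> analytic_on_disc (fun z => Cexp (f z)).
Proof.
  intros Hf.
  apply analytic_of_C1 with (fun z => Cexp (f z) * C_derive f z); intros z Hz.
  - apply (Cderiv_comp Cexp f); [apply Cderiv_Cexp|apply analytic_Cderiv; assumption].
  - apply Ccont_mult; [|apply analytic_cont; auto using analytic_derive].
    apply (Ccont_comp Cexp f); [apply analytic_cont; assumption|].
    exact (Cderiv_cont _ _ _ (Cderiv_Cexp (f z))).
Qed.

Lemma analytic_pow (f : C -> C) (n : nat) :
  analytic_on_disc f -> analytic_on_disc (fun z => f z ^ n).
Proof.
  intro Hf. induction n as [|n IH]; [apply (analytic_const 1)|].
  simpl. apply analytic_mult; assumption.
Qed.

(** * Expansion at the origin, division by [z], primitives *)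

Lemma analytic_series (f : C -> C) : analytic_on_disc f ->
  exists a : nat -> C, forall z, unit_disc z -> Cseries (fun n => a n * z ^ n) (f z).
Proof.
  intro Hf. apply (holomorphic_pseries f (C_derive f)); [lra| |]; intros x Hx.
  - apply analytic_Cderiv; assumption.
  - apply analytic_cont; [apply analytic_derive, Hf|exact Hx].
Qed.

Lemma series_analytic (f : C -> C) (a : nat -> C) :
  (forall z, unit_disc z -> Cseries (fun n => a n * z ^ n) (f z)) -> analytic_on_disc f.
Proof.
  intro H.
  assert (D : forall z, unit_disc z ->
    Cderiv f z (C_derive f z) /\ Cseries (fun n => Cpseries_derive a n * z ^ n) (C_derive f z)).
  { intros z Hz. destruct (pseries_derivable a 1 f H z Hz) as (l & D & Sl).
    rewrite (Cderiv_unique_derive _ _ _ D). split; assumption. }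
  apply analytic_of_C1 with (C_derive f); intros z Hz; [apply D, Hz|].
  destruct (pseries_derivable (Cpseries_derive a) 1 (C_derive f) (fun h Hh => proj2 (D h Hh)) z Hz)
    as (l & D2 & _).
  exact (Cderiv_cont _ _ _ D2).
Qed.

Lemma Cseries_at_0 (a : nat -> C) (l : C) : Cseries (fun n => a n * 0 ^ n) l -> l = a O.
Proof.
  intro H. apply Cseries_unique with (1 := H).
  apply Cseries_decr. replace (a O - a O * 0 ^ 0) with (RtoC 0) by (simpl; ring).
  apply Cseries_ext with (fun _ => 0); [|apply Cseries_zero].
  intro n. rewrite Cpow_S. ring.
Qed.

(** Dividing by [z] shifts the coefficients at the origin; the new constant term is the old linear
    one, [C_derive f 0]. *)
Lemma analytic_div_id (f : C -> C) : analytic_on_disc f -> f 0 = 0 ->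
  exists g : C -> C, analytic_on_disc g /\ g 0 = C_derive f 0 /\
    forall z, unit_disc z -> f z = z * g z.
Proof.
  intros Hf H0. destruct (analytic_series f Hf) as (a & Ha).
  assert (A0 : a O = 0) by (rewrite <- H0; symmetry; apply Cseries_at_0, Ha, unit_disc_0).
  destruct (pseries_derivable a 1 f Ha 0 unit_disc_0) as (l & D & Sl).
  apply Cderiv_unique_derive in D. apply Cseries_at_0 in Sl.
  unfold Cpseries_derive in Sl. simpl in Sl. rewrite Cmult_1_l in Sl.
  exists (fun z => if Ceq_dec z 0 then a 1%nat else f z / z). split; [|split].
  - apply series_analytic with (fun n => a (S n)). intros z Hz.
    destruct (Ceq_dec z 0) as [->|N].
    + apply Cseries_decr. replace (a 1%nat - a 1%nat * 0 ^ 0) with (RtoC 0) by (simpl; ring).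
      apply Cseries_ext with (fun _ => 0); [|apply Cseries_zero].
      intro n. rewrite Cpow_S. ring.
    + assert (K := Cseries_incr _ _ (Ha z Hz)). cbv beta in K.
      replace (f z - a O * z ^ 0) with (f z) in K by (rewrite A0; ring).
      apply (Cseries_scal (/ z)) in K.
      replace (f z / z) with (/ z * f z) by (unfold Cdiv; ring).
      revert K. apply Cseries_ext. intro n. rewrite Cpow_S. field. exact N.
  - destruct (Ceq_dec 0 0) as [_|N]; congruence.
  - intros z Hz. destruct (Ceq_dec z 0) as [->|N]; [rewrite H0; ring|field; exact N].
Qed.

(** Definite description on the complex plane. It turns unique existence into a function: the sum of
    a series here, the inverse of the nephroid map later. *)
Definition Ciota (P : C -> Prop) : C := iota (T := C_CompleteNormedModule) P.

Lemma Ciota_correct (P : C -> Prop) :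
  (exists x, P x) -> (forall x y, P x -> P y -> x = y) -> P (Ciota P).
Proof.
  intros [x Hx] U. apply (iota_correct (V := C_CompleteNormedModule) P).
  exists x. split; [exact Hx|]. intros y Hy. apply U; assumption.
Qed.

(** Termwise integration. Each new term is an old one times [z / (n + 1)], of modulus at most 1, so
    absolute convergence is inherited. *)
Lemma analytic_primitive (f : C -> C) : analytic_on_disc f ->
  exists F : C -> C, analytic_on_disc F /\ F 0 = 0 /\
    forall z, unit_disc z -> Cderiv F z (f z).
Proof.
  intro Hf. destruct (analytic_series f Hf) as (a & Ha).
  set (A := fun n => match n with O => RtoC 0 | S k => / RtoC (INR (S k)) * a k end).
  assert (NZ : forall n, RtoC (INR (S n)) <> 0).
  { intros n E. apply RtoC_inj in E. apply (not_0_INR (S n)); [discriminate|exact E]. }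
  assert (Ex : forall z, unit_disc z -> exists l, Cseries (fun n => A n * z ^ n) l).
  { intros z Hz.
    destruct (Cseries_exists (fun n => A (S n) * z ^ S n)
      (fun n => Rabs (Cmod (a n) * Cmod z ^ n))) as [l Hl].
    - intro n. unfold A. rewrite !Cmod_mult, Cmod_pow, Cmod_inv, Cmod_R by apply NZ.
      rewrite (Rabs_pos_eq (INR (S n))) by apply pos_INR.
      assert (I1 : (1 <= INR (S n))%R) by (rewrite S_INR; generalize (pos_INR n); lra).
      assert (I2 : (0 < / INR (S n) <= 1)%R).
      { split; [apply Rinv_0_lt_compat; lra|].
        rewrite <- Rinv_1. apply Rinv_le_contravar; lra. }
      assert (P := Cmod_ge_0 (a n)). assert (Pz := Cmod_ge_0 z).
      assert (Pn : (0 <= Cmod z ^ n)%R) by (apply pow_le; exact Pz).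
      unfold unit_disc in Hz.
      rewrite Rabs_pos_eq by (apply Rmult_le_pos; assumption).
      replace (/ INR (S n) * Cmod (a n) * Cmod z ^ S n)%R
        with (/ INR (S n) * Cmod z * (Cmod (a n) * Cmod z ^ n))%R by (simpl; ring).
      rewrite <- (Rmult_1_l (Cmod (a n) * Cmod z ^ n)) at 2.
      apply Rmult_le_compat_r; [apply Rmult_le_pos; assumption|]. nra.
    - apply CV_disk_inside.
      apply (pseries_radius a 1 f Ha). split; [apply Cmod_ge_0|exact Hz].
    - exists l. apply Cseries_decr. replace (l - A O * z ^ 0) with l by (simpl; ring).
      exact Hl. }
  set (F := fun z => Ciota (Cseries (fun n => A n * z ^ n))).
  assert (HF : forall z, unit_disc z -> Cseries (fun n => A n * z ^ n) (F z)).
  { intros z Hz. apply Ciota_correct; [apply Ex, Hz|apply Cseries_unique]. }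
  exists F. split; [|split].
  - apply series_analytic with A. exact HF.
  - apply (Cseries_at_0 A). apply HF, unit_disc_0.
  - intros z Hz. destruct (pseries_derivable A 1 F HF z Hz) as (l & D & Sl).
    replace (f z) with l; [exact D|].
    apply (Cseries_unique _ _ _ Sl). generalize (Ha z Hz). apply Cseries_ext.
    intro n. unfold Cpseries_derive, A. rewrite <- (Cmult_1_l (a n)) at 1.
    rewrite <- (Cinv_r _ (NZ n)). ring.
Qed.

(** * Estimates along radii, maximum modulus, Schwarz lemma *)

Lemma Cmod_direction (u : C) : exists e : C, Cmod e = 1%R /\ Re (e * u) = Cmod u.
Proof.
  destruct (Ceq_dec u 0) as [->|N].
  - exists 1. rewrite Cmod_1, Cmult_0_r, Cmod_0. split; reflexivity.
  - assert (P := proj1 (Cmod_gt_0 u) N). exists (Cconj u * RtoC (/ Cmod u)). split.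
    + rewrite Cmod_mult, Cmod_conj, Cmod_R, Rabs_pos_eq.
      * field. lra.
      * left. apply Rinv_0_lt_compat, P.
    + replace (Cconj u * RtoC (/ Cmod u) * u) with (RtoC (/ Cmod u) * (u * Cconj u)) by ring.
      rewrite <- Cmod2_conj, <- RtoC_mult, re_RtoC. field. lra.
Qed.

(* The real mean value theorem on the radius [0, z], for the real part of [f]
   rotated so that [f z - f 0] is positive. *)
Lemma radial_bound (f f' : C -> C) (M m : R -> R) :
  (forall z, unit_disc z -> Cderiv f z (f' z)) ->
  (forall t, (0 <= t < 1)%R -> is_derive M t (m t)) ->
  (forall z, unit_disc z -> z <> 0 -> (Cmod (f' z) <= m (Cmod z))%R) ->
  forall z, unit_disc z -> (Cmod (f z - f 0)%C <= M (Cmod z) - M 0)%R.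
Proof.
  intros D DM B z Hz. unfold unit_disc in Hz.
  destruct (Ceq_dec z 0) as [->|Nz].
  { replace (f 0 - f 0) with (RtoC 0) by ring. rewrite Cmod_0. lra. }
  assert (Pz := proj1 (Cmod_gt_0 z) Nz).
  destruct (Cmod_direction (f z - f 0)) as (e & He & Eu). rewrite <- Eu.
  assert (Mt : forall t : R, (0 <= t -> Cmod (RtoC t * z) = t * Cmod z)%R).
  { intros t Ht. rewrite Cmod_mult, Cmod_R, Rabs_pos_eq by exact Ht. reflexivity. }
  set (phi := fun t : R => (Re (e * f (RtoC t * z)%C)%C - M (t * Cmod z))%R).
  set (phi' := fun t : R =>
    (Re (e * (f' (RtoC t * z) * (1 * z + RtoC t * 0)))%C - m (t * Cmod z) * Cmod z)%R).
  destruct (MVT_cor2 phi phi' 0 1) as (c & E & Hc); [lra| |].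
  - intros t Ht. apply is_derive_Reals. unfold phi, phi'.
    apply (is_derive_minus (K := R_AbsRing) (V := R_NormedModule)
             (fun t : R => Re (e * f (RtoC t * z))) (fun t : R => M (t * Cmod z)%R)).
    + apply (Cderiv_real (fun t => e * f (t * z))).
      apply Cderiv_scal, (Cderiv_comp f (fun t => t * z)).
      * apply D. unfold unit_disc. rewrite Mt by lra. nra.
      * apply (Cderiv_mult (fun t => t) (fun _ => z)); [apply Cderiv_id|apply Cderiv_const].
    + rewrite Rmult_comm.
      apply (is_derive_comp M (fun t : R => t * Cmod z)%R).
      * apply DM. nra.
      * auto_derive; [exact I|ring].
  - assert (L : (phi' c <= 0)%R).
    { unfold phi'. assert (Nc : RtoC c * z <> 0).
      { apply Cmult_neq_0; [|exact Nz]. intro X. apply RtoC_inj in X. lra. }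
      assert (Hcz : unit_disc (RtoC c * z)) by (unfold unit_disc; rewrite Mt by lra; nra).
      assert (K := B _ Hcz Nc). rewrite Mt in K by lra.
      eapply Rle_trans with (Cmod (f' (RtoC c * z)%C) * Cmod z - m (c * Cmod z) * Cmod z)%R;
        [|nra].
      apply Rplus_le_compat_r. eapply Rle_trans; [apply Rle_abs|].
      eapply Rle_trans; [apply re_le_Cmod|].
      replace (1 * z + RtoC c * 0) with z by ring.
      rewrite !Cmod_mult, He. lra. }
    unfold phi in E. rewrite Rmult_0_l, Rmult_1_l, Cmult_0_l, Cmult_1_l in E.
    replace (e * (f z - f 0)) with (e * f z - e * f 0) by ring.
    unfold Cminus. rewrite re_plus, re_opp. lra.
Qed.

Lemma derive_0_const (f : C -> C) :
  (forall z, unit_disc z -> Cderiv f z 0) -> forall z, unit_disc z -> f z = f 0.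
Proof.
  intros D z Hz.
  assert (K := radial_bound f (fun _ => 0) (fun _ => 0%R) (fun _ => 0%R) D
    (fun t _ => is_derive_const (K := R_AbsRing) (V := R_NormedModule) 0%R t)
    (fun _ _ _ => Req_le _ _ Cmod_0) z Hz).
  simpl in K. apply Ceq_minus, Cmod_eq_0. generalize (Cmod_ge_0 (f z - f 0)). lra.
Qed.

Lemma pow_unbounded (x B : R) : (forall n, (x ^ n <= B)%R) -> (x <= 1)%R.
Proof.
  intro H. destruct (Rle_lt_dec x 1) as [L|G]; [exact L|exfalso].
  destruct (Pow_x_infinity x) with (b := (B + 1)%R) as [N HN].
  { rewrite Rabs_pos_eq; lra. }
  specialize (HN N (le_n N)). specialize (H N).
  rewrite Rabs_pos_eq in HN by (apply pow_le; lra). lra.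
Qed.

(* Cauchy's formula for all powers of [v] gives [|v|^n <= C * (max |v|)^n]. *)
Lemma analytic_max_modulus (v : C -> C) (B r : R) :
  analytic_on_disc v -> (0 < r < 1)%R -> (0 < B)%R ->
  (forall t : R, (Cmod (v (circle r (RtoC t))) <= B)%R) ->
  forall z, (Cmod z < r)%R -> (Cmod (v z) <= B)%R.
Proof.
  intros Hv Hr HB H z Hz. assert (PP := PI_RGT_0). assert (H0 := Cmod_ge_0 z).
  assert (K : (Cmod (v z) / B <= 1)%R).
  { apply pow_unbounded with (2 * (r / (r - Cmod z)))%R. intro n.
    assert (An := analytic_pow v n Hv).
    assert (F := cauchy_formula (fun z => v z ^ n) (C_derive (fun z => v z ^ n)) 1 r z
      (fun x Hx => analytic_Cderiv _ x An Hx)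
      (fun x Hx => analytic_cont _ x (analytic_derive _ An) Hx) (conj Hz (proj2 Hr))).
    set (b := (B ^ n * (r / (r - Cmod z)))%R).
    assert (Bd := CRint_bound (fun t => v (circle r t) ^ n * cauchy_kernel r z t)
      (fun _ => b) 0 (2 * PI)).
    rewrite F, Cmod_mult, Cmod_R, Rabs_pos_eq, RInt_const, Cmod_pow in Bd by lra.
    change (scal (2 * PI - 0) b)%R with ((2 * PI - 0) * b)%R in Bd.
    assert (Bd' : (2 * PI * Cmod (v z) ^ n <= 2 * ((2 * PI - 0) * b))%R).
    { apply Bd; [lra| |apply ex_RInt_const|].
      - intro t. apply Ccont_mult; [|apply Ccont_cauchy_kernel, Hz].
        apply (Ccont_comp (fun z => v z ^ n) (circle r)); [apply Ccont_circle|].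
        apply analytic_cont; [exact An|]. unfold unit_disc. rewrite Cmod_circle; lra.
      - intro t. rewrite Cmod_mult, Cmod_pow. unfold b.
        apply Rmult_le_compat; [apply pow_le, Cmod_ge_0|apply Cmod_ge_0| |].
        + apply pow_incr. split; [apply Cmod_ge_0|apply H].
        + apply cauchy_kernel_bound, Hz. }
    assert (Bd2 : (Cmod (v z) ^ n <= 2 * b)%R).
    { apply Rmult_le_reg_l with (2 * PI)%R; [lra|]. lra. }
    unfold Rdiv at 1. rewrite Rpow_mult_distr, pow_inv.
    assert (Pn : (0 < B ^ n)%R) by (apply pow_lt; exact HB).
    apply Rmult_le_reg_r with (B ^ n)%R; [exact Pn|].
    rewrite Rmult_assoc, Rinv_l, Rmult_1_r by lra. unfold b in Bd2. lra. }
  apply Rmult_le_reg_r with (/ B)%R; [apply Rinv_0_lt_compat, HB|].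
  rewrite Rinv_r by lra. exact K.
Qed.

(** The quotient [v = w / z] is at most [1 / r] on the circle of radius [r], hence inside it, and
    [r] may approach 1. *)
Lemma schwarz_lemma (w : C -> C) :
  analytic_on_disc w -> w 0 = 0 ->
  (forall z, unit_disc z -> (Cmod (w z) < 1)%R) ->
  forall z, unit_disc z -> (Cmod (w z) <= Cmod z)%R.
Proof.
  intros Hw W0 B z Hz. unfold unit_disc in Hz. assert (H0 := Cmod_ge_0 z).
  destruct (analytic_div_id w Hw W0) as (v & Hv & _ & Ev).
  assert (K : forall r, (Cmod z < r < 1)%R -> (r * Cmod (v z) <= 1)%R).
  { intros r Hr.
    assert (L : (Cmod (v z) <= / r)%R).
    { apply (analytic_max_modulus v (/ r) r Hv); [lra|apply Rinv_0_lt_compat; lra| |apply Hr].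
      intro t. assert (Hc : unit_disc (circle r (RtoC t))).
      { unfold unit_disc. rewrite Cmod_circle; lra. }
      assert (E := B _ Hc). rewrite (Ev _ Hc), Cmod_mult, Cmod_circle in E by lra.
      apply Rmult_le_reg_l with r; [lra|]. rewrite Rinv_r by lra. lra. }
    apply Rmult_le_compat_l with (r := r) in L; [|lra]. rewrite Rinv_r in L by lra. exact L. }
  rewrite (Ev z Hz), Cmod_mult. rewrite <- (Rmult_1_r (Cmod z)) at 2.
  apply Rmult_le_compat_l; [exact H0|].
  destruct (Rle_lt_dec (Cmod (v z)) 1) as [L|G]; [exact L|exfalso].
  set (y := Cmod (v z)) in *.
  assert (Iy : (0 < / y < 1)%R).
  { split; [apply Rinv_0_lt_compat; lra|]. rewrite <- Rinv_1. apply Rinv_lt_contravar; lra. }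
  (* In place of the limit, one radius beyond both [|z|] and [1 / |v z|], which contradicts
     [r |v z| <= 1]. *)
  set (r := (Rmax (Cmod z) (/ y) / 2 + 1 / 2)%R).
  assert (Hr : (Cmod z < r < 1)%R /\ (/ y < r)%R).
  { unfold r, Rmax. destruct (Rle_dec (Cmod z) (/ y)); lra. }
  assert (Kr := K r (proj1 Hr)).
  assert (X : (/ y * y < r * y)%R) by (apply Rmult_lt_compat_r; lra).
  rewrite Rinv_l in X by lra. lra.
Qed.

(** * The principal square root *)

Lemma Csqrt_sqr (z : C) : Csqrt z * Csqrt z = z.
Proof.
  assert (Hx := re_le_Cmod z). apply Rabs_le_between in Hx.
  assert (N := Cmod_sqr z). unfold Csqrt.
  set (p := sqrt ((Cmod z + Re z) / 2)). set (q := sqrt ((Cmod z - Re z) / 2)).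
  assert (P2 : (p * p = (Cmod z + Re z) / 2)%R) by (apply sqrt_sqrt; lra).
  assert (Q2 : (q * q = (Cmod z - Re z) / 2)%R) by (apply sqrt_sqrt; lra).
  assert (PQ : (2 * (p * q) = Rabs (Im z))%R).
  { unfold p, q. rewrite <- sqrt_mult by lra.
    replace ((Cmod z + Re z) / 2 * ((Cmod z - Re z) / 2))%R with (Rsqr (Im z / 2))
      by (unfold Rsqr; lra).
    rewrite sqrt_Rsqr_abs. unfold Rdiv. rewrite Rabs_mult, (Rabs_pos_eq (/ 2)) by lra. lra. }
  apply injective_projections; unfold Cmult; simpl fst; simpl snd.
  - change (fst z) with (Re z). destruct (Rlt_dec (Im z) 0); lra.
  - change (snd z) with (Im z). destruct (Rlt_dec (Im z) 0) as [L|G].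
    + rewrite Rabs_left in PQ by exact L. lra.
    + rewrite Rabs_pos_eq in PQ by lra. lra.
Qed.

Lemma Re_Csqrt_pos (z : C) : (0 < Re z)%R -> (0 < Re (Csqrt z))%R.
Proof.
  intro H. apply sqrt_lt_R0. generalize (Cmod_ge_0 z). lra.
Qed.

Lemma Csqrt_RtoC (x : R) : (0 <= x)%R -> Csqrt (RtoC x) = RtoC (sqrt x).
Proof.
  intro H. unfold Csqrt. rewrite Cmod_R, Rabs_pos_eq, re_RtoC, im_RtoC by exact H.
  destruct (Rlt_dec 0 0) as [L|_]; [lra|]. unfold RtoC. f_equal.
  - f_equal. field.
  - replace ((x - x) / 2)%R with 0%R by field. apply sqrt_0.
Qed.

Lemma Re_pos_neq_0 (z : C) : (0 < Re z)%R -> z <> 0.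
Proof. intros H E. rewrite E in H. simpl in H. lra. Qed.

(** * The function [phi_cr] *)

Definition cr_root (z : C) : C := Csqrt (1 + z ^ 2).

Lemma cr_root_sqr (z : C) : cr_root z * cr_root z = 1 + z * z.
Proof. unfold cr_root. rewrite Csqrt_sqr. ring. Qed.

Lemma Re_cr_root_pos (z : C) : unit_disc z -> (0 < Re (cr_root z))%R.
Proof.
  intro H. unfold unit_disc in H. apply Re_Csqrt_pos.
  assert (N := re_le_Cmod (z ^ 2)). rewrite Cmod_pow in N.
  apply Rabs_le_between in N. rewrite re_plus, re_RtoC.
  assert (P := Cmod_ge_0 z). simpl in *. nra.
Qed.

(** From [(s - s0) (s + s0) = (2 z + h) h] for the roots at [z + h] and [z]. Both have positive real
    part, so [s + s0] stays away from 0 and the branch cut never enters. *)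
Lemma Cderiv_cr_root (z : C) : unit_disc z -> Cderiv cr_root z (z / cr_root z).
Proof.
  intro Hz. destruct (unit_disc_nbhd z Hz) as (r & Hr & N).
  assert (P := Re_cr_root_pos z Hz).
  assert (N' : forall h, (Cmod h < r)%R -> unit_disc (z + h)).
  { intros h Hh. apply N. replace (z + h - z) with h by ring. exact Hh. }
  assert (NZ : forall h, (Cmod h < r)%R ->
    (Re (cr_root z) <= Cmod (cr_root (z + h) + cr_root z)%C)%R).
  { intros h Hh. assert (Q := Re_cr_root_pos _ (N' h Hh)).
    eapply Rle_trans; [|eapply Rle_trans; [apply Rle_abs|apply re_le_Cmod]].
    rewrite re_plus. lra. }
  assert (NZ' : forall h, (Cmod h < r)%R -> cr_root (z + h) + cr_root z <> 0).
  { intros h Hh. apply Cmod_gt_0. generalize (NZ h Hh). lra. }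
  set (q := fun h => (2 * z + h) * / (cr_root (z + h) + cr_root z)).
  assert (E : forall h, (Cmod h < r)%R -> cr_root (z + h) = cr_root z + q h * h).
  { intros h Hh. unfold q. set (s := cr_root (z + h)) in *. set (s0 := cr_root z) in *.
    assert (K : (2 * z + h) * h = (s - s0) * (s + s0)).
    { replace ((s - s0) * (s + s0)) with (s * s - s0 * s0) by ring.
      unfold s, s0. rewrite !cr_root_sqr. ring. }
    replace ((2 * z + h) * / (s + s0) * h) with ((2 * z + h) * h * / (s + s0)) by ring.
    rewrite K. field. exact (NZ' h Hh). }
  assert (C0 : (Cmod 0 < r)%R) by (rewrite Cmod_0; exact Hr).
  (* Continuity comes from [E] itself: [q h] is bounded by [(|2 z| + 1) / Re (cr_root z)] for small
     [h]. *)
  assert (Cs : Ccont (fun h => cr_root (z + h)) 0).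
  { intros eps He. set (M := Cmod (2 * z)). assert (HM : (0 <= M)%R) by apply Cmod_ge_0.
    set (k := Re (cr_root z)) in *.
    exists (Rmin (Rmin r 1) (eps * k / (M + 1))). split.
    { apply Rmin_pos; [apply Rmin_pos; lra|]. apply Rdiv_lt_0_compat; nra. }
    intros h Hh. replace (h - 0) with h in Hh by ring.
    assert (L1 := Rlt_le_trans _ _ _ (Rlt_le_trans _ _ _ Hh (Rmin_l _ _)) (Rmin_l _ _)).
    assert (L2 := Rlt_le_trans _ _ _ (Rlt_le_trans _ _ _ Hh (Rmin_l _ _)) (Rmin_r _ _)).
    assert (L3 := Rlt_le_trans _ _ _ Hh (Rmin_r _ _)).
    rewrite (E h L1), (E 0 C0).
    replace (cr_root z + q h * h - (cr_root z + q 0 * 0)) with (q h * h) by ring.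
    unfold q. rewrite !Cmod_mult, Cmod_inv by (apply NZ'; exact L1).
    assert (T := NZ h L1). set (y := Cmod (cr_root (z + h) + cr_root z)) in *.
    assert (A : (Cmod (2 * z + h) <= M + 1)%R).
    { eapply Rle_trans; [apply Cmod_triangle|]. fold M. lra. }
    assert (H0 := Cmod_ge_0 h).
    apply Rmult_lt_compat_r with (r := (M + 1)%R) in L3; [|lra].
    replace (eps * k / (M + 1) * (M + 1))%R with (eps * k)%R in L3 by (field; lra).
    apply Rmult_lt_reg_r with y; [lra|].
    replace (Cmod (2 * z + h) * / y * Cmod h * y)%R with (Cmod (2 * z + h) * Cmod h)%R
      by (field; lra).
    nra. }
  replace (z / cr_root z) with (q 0).
  - apply Cderiv_loc with r; [exact Hr|exact E|].
    unfold q. apply Ccont_mult.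
    + apply Ccont_plus; [apply Ccont_const|apply Ccont_id].
    + apply (Ccont_inv (fun h => cr_root (z + h) + cr_root z)).
      * apply Ccont_plus; [exact Cs|apply Ccont_const].
      * apply NZ', C0.
  - unfold q. rewrite !Cplus_0_r. assert (NR := Re_pos_neq_0 _ P).
    assert (NN : cr_root z + cr_root z <> 0).
    { replace (cr_root z + cr_root z) with (2 * cr_root z) by ring.
      apply Cmult_neq_0; [|exact NR]. intro Y. apply RtoC_inj in Y. lra. }
    field. split; assumption.
Qed.

Lemma analytic_cr_root : analytic_on_disc cr_root.
Proof.
  apply analytic_of_C1 with (fun z => z / cr_root z); [exact Cderiv_cr_root|].
  intros z Hz. apply Ccont_mult; [apply Ccont_id|].
  apply (Ccont_inv cr_root).
  - exact (Cderiv_cont _ _ _ (Cderiv_cr_root z Hz)).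
  - apply Re_pos_neq_0, Re_cr_root_pos, Hz.
Qed.

Lemma analytic_phi_cr : analytic_on_disc phi_cr.
Proof. apply analytic_plus; [apply analytic_id|apply analytic_cr_root]. Qed.

(* With [v = phi_cr z] one has [2 z v = v ^ 2 - 1]; among the points of a circle
   [|v - 1| = d <= sqrt 2], [|v ^ 2 - 1| / |v|] is least at [v = 1 + d]. *)
Lemma phi_cr_bound (z : C) : unit_disc z ->
  (Cmod (phi_cr z - 1)%C <= Cmod z + sqrt (1 + Cmod z * Cmod z) - 1)%R.
Proof.
  intro Hz. assert (Sp := Re_cr_root_pos z Hz). assert (S2 := cr_root_sqr z).
  unfold unit_disc in Hz.
  change (phi_cr z) with (z + cr_root z). set (s := cr_root z) in *.
  set (v := z + s).
  assert (Vs : v * (s - z) = 1).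
  { unfold v. replace ((z + s) * (s - z)) with (s * s - z * z) by ring. rewrite S2. ring. }
  assert (Nv : v <> 0).
  { intro X. rewrite X, Cmult_0_l in Vs. symmetry in Vs. exact (C1_nz Vs). }
  assert (E1 : v * v - 1 = 2 * z * v).
  { unfold v. replace ((z + s) * (z + s) - 1) with (z * z + 2 * z * s + s * s - 1) by ring.
    rewrite S2. ring. }
  assert (Pv : (0 < Cmod v)%R) by (apply Cmod_gt_0, Nv).
  set (n := (Cmod v * Cmod v)%R). assert (Hn : (0 < n)%R) by (unfold n; nra).
  (* [2 s = v + 1 / v], multiplied by [|v|^2]: the real part of [v] has the sign of the real part of
     [s]. *)
  assert (Rev : (0 < Re v)%R).
  { assert (Y : 2 * s * (v * Cconj v) = (v * v + 1) * Cconj v).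
    { replace (v * v + 1) with (2 * v * s).
      - ring.
      - replace (v * v + 1) with (v * v - 1 + 2 * (v * (s - z))) by (rewrite Vs; ring).
        rewrite E1. ring. }
    rewrite <- Cmod2_conj in Y.
    assert (Y2 := f_equal Re Y). rewrite re_scal_r in Y2.
    replace ((v * v + 1) * Cconj v) with (v * (v * Cconj v) + Cconj v) in Y2 by ring.
    rewrite <- Cmod2_conj, re_plus, re_scal_r, re_conj, re_scal_l in Y2.
    replace (Cmod v ^ 2)%R with n in Y2 by (unfold n; ring).
    assert (0 < 2 * Re s * n)%R by nra. nra. }
  set (d := Cmod (v - 1)). set (t := Cmod z) in *.
  assert (Hd : (0 <= d)%R) by apply Cmod_ge_0. assert (Ht : (0 <= t)%R) by apply Cmod_ge_0.
  set (X := (Re v - 1)%R).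
  assert (D2 : (d * d = X * X + Im v * Im v)%R).
  { unfold d. rewrite Cmod_sqr. unfold X, Cminus. rewrite re_plus, im_plus, re_opp, im_opp.
    rewrite re_RtoC, im_RtoC. ring. }
  assert (N2 : (n = 1 + 2 * X + d * d)%R).
  { unfold n. rewrite Cmod_sqr, D2. unfold X. ring. }
  assert (P2 : (Cmod (v + 1) * Cmod (v + 1) = 4 + 4 * X + d * d)%R).
  { rewrite Cmod_sqr, D2, re_plus, im_plus, re_RtoC, im_RtoC. unfold X. ring. }
  assert (M : (d * d * (4 + 4 * X + d * d) = 4 * (t * t) * n)%R).
  { rewrite <- P2.
    assert (K : (d * Cmod (v + 1) = 2 * t * Cmod v)%R).
    { unfold d. rewrite <- Cmod_mult. replace ((v - 1) * (v + 1)) with (v * v - 1) by ring.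
      rewrite E1, !Cmod_mult, Cmod_R, Rabs_pos_eq by lra. reflexivity. }
    replace (d * d * (Cmod (v + 1) * Cmod (v + 1)))%R
      with ((d * Cmod (v + 1)) * (d * Cmod (v + 1)))%R by ring.
    rewrite K. unfold n. ring. }
  (* The lune [|v^2 - 1| < 2 |v|], [Re v > 0] lies in [|v - 1| < sqrt 2]: if [d^2 >= 2] then
     [n - 1 >= 2 Re v], so [(n + 1)^2 - 4 (Re v)^2 >= (n + 1)^2 - (n - 1)^2 = 4 n]. *)
  assert (Dlt : (d * d < 2)%R).
  { assert (T2 : (t * t < 1)%R) by nra.
    assert (4 * (t * t) * n < 4 * n)%R by nra.
    assert (HX : (0 < X + 1)%R) by (unfold X; lra).
    assert (Q : (d * d * (4 + 4 * X + d * d) = (n + 1) * (n + 1) - 4 * ((X + 1) * (X + 1)))%R).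
    { rewrite N2. ring. }
    destruct (Rle_lt_dec 2 (d * d)) as [L|G]; [|exact G].
    assert (n - 1 >= 2 * (X + 1))%R by lra. nra. }
  assert (Xd : (X <= d)%R).
  { assert (X * X <= d * d)%R by (rewrite D2; nra). nra. }
  (* Comparison of [v] with [1 + d]. In [B] both factors on the right are nonpositive, by [Dlt] and
     [Xd]. *)
  assert (Main : (d * (2 + d) <= 2 * t * (1 + d))%R).
  { assert (A : (0 <= (2 * (d * d) - 4) * (X - d))%R) by nra.
    assert (B : ((4 + 4 * X + d * d) * ((1 + d) * (1 + d)) - (2 + d) * (2 + d) * n
               = (2 * (d * d) - 4) * (X - d))%R) by (rewrite N2; ring).
    assert (C1 : ((d * (2 + d)) * (d * (2 + d)) * n <= (2 * t * (1 + d)) * (2 * t * (1 + d)) * n)%R).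
    { replace ((2 * t * (1 + d)) * (2 * t * (1 + d)) * n)%R
        with (4 * (t * t) * n * ((1 + d) * (1 + d)))%R by ring.
      rewrite <- M.
      assert (0 <= d * d * ((4 + 4 * X + d * d) * ((1 + d) * (1 + d)) - (2 + d) * (2 + d) * n))%R.
      { apply Rmult_le_pos; [nra|]. rewrite B. exact A. }
      lra. }
    apply Rmult_le_reg_r in C1; [|exact Hn].
    apply Rsqr_incr_0_var; [exact C1|]. nra. }
  (* [Main] with the square completed; the root of it is the claim. *)
  assert (Fin : (Rsqr (d + 1 - t) <= 1 + t * t)%R) by (unfold Rsqr; nra).
  apply sqrt_le_1_alt in Fin. rewrite sqrt_Rsqr_abs in Fin.
  assert (Q := Rle_abs (d + 1 - t)). lra.
Qed.

(** * The disc of radius 2/3 and the nephroid map *)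

Lemma phi_Ne_minus_1 (x : C) : phi_Ne x - 1 = x - x * x * x / 3.
Proof. unfold phi_Ne. simpl. unfold Cdiv. ring. Qed.

Lemma RtoC_3_neq_0 : RtoC 3 <> 0.
Proof. intro E. apply RtoC_inj in E. lra. Qed.

(** Divided difference of [x - x ^ 3 / 3]. It gives injectivity, and both continuity and derivative
    of the inverse. *)
Definition nephroid_slope (x y : C) : C := 1 - (x * x + x * y + y * y) / 3.

Lemma nephroid_difference (x y : C) :
  (x - x * x * x / 3) - (y - y * y * y / 3) = (x - y) * nephroid_slope x y.
Proof. unfold nephroid_slope. field. Qed.

(** The lower bound depends on [y] alone; this uniformity in [x] is what makes the inverse
    continuous at [y]. *)
Lemma nephroid_slope_bound (x y : C) : unit_disc x -> unit_disc y ->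
  (0 < (1 - Cmod y) / 3 <= Cmod (nephroid_slope x y))%R.
Proof.
  unfold unit_disc. intros Hx Hy. assert (Px := Cmod_ge_0 x). assert (Py := Cmod_ge_0 y).
  split; [lra|]. unfold nephroid_slope.
  eapply Rle_trans; [|apply Cmod_triangle_inv].
  rewrite Cmod_1, Cmod_div, Cmod_R, Rabs_pos_eq by (exact RtoC_3_neq_0 || lra).
  assert (A : (Cmod (x * x + x * y + y * y) <= 2 + Cmod y)%R).
  { eapply Rle_trans; [apply Cmod_triangle|].
    assert (B := Cmod_triangle (x * x) (x * y)). rewrite !Cmod_mult in *. nra. }
  lra.
Qed.

Lemma nephroid_inj (x y : C) : unit_disc x -> unit_disc y ->
  x - x * x * x / 3 = y - y * y * y / 3 -> x = y.
Proof.
  intros Hx Hy E. assert (D := nephroid_difference x y).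
  assert (B := nephroid_slope_bound x y Hx Hy).
  apply Ceq_minus. destruct (Ceq_dec (x - y) 0) as [Z|N]; [exact Z|exfalso].
  apply (Cmult_neq_0 _ (nephroid_slope x y)) in N.
  - apply N. rewrite <- D, E. ring.
  - apply Cmod_gt_0. lra.
Qed.

(* Fixed point of the contraction [x => u + x ^ 3 / 3] on the disc of radius
   [1/3 + |u| < 1]. *)
Lemma nephroid_surj (u : C) : (Cmod u < 2 / 3)%R ->
  exists x, unit_disc x /\ x - x * x * x / 3 = u.
Proof.
  intro Hu. assert (U0 := Cmod_ge_0 u). set (c := Cmod u) in *.
  set (rho := (1 / 3 + c)%R).
  assert (Hrho : (0 < rho < 1)%R) by (unfold rho; lra).
  (* [rho - c = 1/3] and [rho < 1]; hence the iteration maps the disc of radius [rho] into itself,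
     with Lipschitz constant [rho^2 < 1]. *)
  assert (Hstep : (c + rho * rho * rho / 3 <= rho)%R).
  { unfold rho. assert (0 <= c * c)%R by nra.
    assert ((1 / 3 + c) * (1 / 3 + c) * (1 / 3 + c) <= 1)%R; [|lra].
    assert ((1 / 3 + c) * (1 / 3 + c) <= 1)%R by nra. nra. }
  set (T := fun x => u + x * x * x / 3).
  set (xs := fix xs n := match n with O => RtoC 0 | S k => T (xs k) end).
  assert (Tb : forall x, (Cmod x <= rho)%R -> (Cmod (T x) <= rho)%R).
  { intros x Hx. unfold T. eapply Rle_trans; [apply Cmod_triangle|]. fold c.
    rewrite Cmod_div, Cmod_R, Rabs_pos_eq, !Cmod_mult by (exact RtoC_3_neq_0 || lra).
    assert (P := Cmod_ge_0 x).
    assert (Cmod x * Cmod x * Cmod x <= rho * rho * rho)%R.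
    { repeat apply Rmult_le_compat; nra. }
    lra. }
  assert (Bx : forall n, (Cmod (xs n) <= rho)%R).
  { induction n as [|n IH]; [simpl; rewrite Cmod_0; lra|apply Tb, IH]. }
  assert (Lip : forall x y, (Cmod x <= rho)%R -> (Cmod y <= rho)%R ->
    (Cmod (T x - T y)%C <= rho * rho * Cmod (x - y)%C)%R).
  { intros x y Hx Hy.
    replace (T x - T y) with ((x - y) * ((x * x + x * y + y * y) / 3))
      by (unfold T; field).
    rewrite Cmod_mult, Cmod_div, Cmod_R, Rabs_pos_eq by (exact RtoC_3_neq_0 || lra).
    rewrite Rmult_comm. apply Rmult_le_compat_r; [apply Cmod_ge_0|].
    assert (B := Cmod_triangle (x * x) (x * y)).
    assert (B2 := Cmod_triangle (x * x + x * y) (y * y)).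
    rewrite !Cmod_mult in *.
    assert (Px := Cmod_ge_0 x). assert (Py := Cmod_ge_0 y).
    assert (Cmod x * Cmod x <= rho * rho)%R by (apply Rmult_le_compat; lra).
    assert (Cmod x * Cmod y <= rho * rho)%R by (apply Rmult_le_compat; lra).
    assert (Cmod y * Cmod y <= rho * rho)%R by (apply Rmult_le_compat; lra).
    lra. }
  set (q := (rho * rho)%R) in *. assert (Hq : (0 <= q < 1)%R) by (unfold q; nra).
  (* The iterates are partial sums of their increments, so completeness enters through comparison
     with a geometric series. *)
  set (s := fun n => xs (S n) - xs n).
  assert (Bs : forall n, (Cmod (s n) <= rho * q ^ n)%R).
  { induction n as [|n IH].
    - unfold s. change (xs O) with (RtoC 0). replace (xs 1%nat - 0) with (xs 1%nat) by ring.
      simpl. rewrite Rmult_1_r. apply (Bx 1%nat).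
    - unfold s. change (xs (S (S n))) with (T (xs (S n))). change (xs (S n)) with (T (xs n)) at 2.
      eapply Rle_trans; [apply Lip; apply Bx|]. fold (s n). simpl. nra. }
  destruct (Cseries_exists s (fun n => rho * q ^ n)%R Bs) as [l Hl].
  { apply (ex_series_scal_l (K := R_AbsRing) (V := R_NormedModule)).
    apply ex_series_geom. rewrite Rabs_pos_eq; lra. }
  assert (Sx : forall n, sum_n (G := C_AbelianMonoid) s n = xs (S n)).
  { induction n as [|n IH].
    - rewrite sum_O. change (xs 1%nat - 0 = xs 1%nat). ring.
    - rewrite sum_Sn, IH. change (xs (S n) + s (S n) = xs (S (S n))). unfold s. ring. }
  assert (Lim : forall eps, (0 < eps)%R -> exists N, forall n, (N <= n)%nat ->
     (Cmod (xs (S n) - l)%C < eps)%R).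
  { intros eps He. destruct (proj1 (Cseries_eps s l) Hl eps He) as [N HN].
    exists N. intros n Hn. rewrite <- Sx. apply HN, Hn. }
  assert (Bl : (Cmod l <= rho)%R).
  { apply le_epsilon. intros eps He. destruct (Lim eps He) as [N HN].
    specialize (HN N (le_n N)). assert (B := Bx (S N)).
    replace l with (xs (S N) - (xs (S N) - l)) by ring.
    eapply Rle_trans; [apply Cmod_triangle'|]. lra. }
  assert (Fix : l = T l).
  { apply Ceq_minus, Cmod_eq_0, Rle_antisym; [|apply Cmod_ge_0].
    apply le_epsilon. intros eps He. destruct (Lim (eps / 2)%R) as [N HN]; [lra|].
    assert (A := HN N (le_n N)). assert (B := HN (S N) (le_S _ _ (le_n N))).
    assert (K := Lip (xs (S N)) l (Bx _) Bl).
    change (T (xs (S N))) with (xs (S (S N))) in K.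
    replace (l - T l) with ((xs (S (S N)) - T l) - (xs (S (S N)) - l)) by ring.
    eapply Rle_trans; [apply Cmod_triangle'|].
    assert (P := Cmod_ge_0 (xs (S N) - l)). nra. }
  exists l. split; [unfold unit_disc; lra|].
  rewrite Fix at 1. unfold T. ring.
Qed.

(** Here [w] is the inverse of [phi_Ne] applied to [p]. The identity [Diff] does the work of an
    inverse function theorem: a slope bounded below makes [w] continuous, and dividing by the then
    continuous slope makes it differentiable. *)
Lemma subordinate_phi_Ne (p : C -> C) :
  analytic_on_disc p -> p 0 = 1 ->
  (forall z, unit_disc z -> (Cmod (p z - 1)%C < 2 / 3)%R) -> subordinate p phi_Ne.
Proof.
  intros Hp P0 B.
  set (w := fun z => Ciota (fun x => unit_disc x /\ x - x * x * x / 3 = p z - 1)).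
  assert (Hw : forall z, unit_disc z ->
    unit_disc (w z) /\ w z - w z * w z * w z / 3 = p z - 1).
  { intros z Hz. apply (Ciota_correct (fun x => unit_disc x /\ x - x * x * x / 3 = p z - 1)).
    - apply nephroid_surj, B, Hz.
    - intros x y [Hx Ex] [Hy Ey]. apply nephroid_inj; congruence. }
  assert (Diff : forall y z, unit_disc y -> unit_disc z ->
    p y - p z = (w y - w z) * nephroid_slope (w y) (w z)).
  { intros y z Hy Hz. rewrite <- nephroid_difference.
    rewrite (proj2 (Hw y Hy)), (proj2 (Hw z Hz)). ring. }
  assert (SB : forall y z, unit_disc y -> unit_disc z ->
    (0 < (1 - Cmod (w z)) / 3 <= Cmod (nephroid_slope (w y) (w z)))%R).
  { intros y z Hy Hz. apply nephroid_slope_bound; apply Hw; assumption. }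
  assert (SN : forall y z, unit_disc y -> unit_disc z -> nephroid_slope (w y) (w z) <> 0).
  { intros y z Hy Hz. apply Cmod_gt_0. generalize (SB y z Hy Hz). lra. }
  assert (Cw : forall z, unit_disc z -> Ccont w z).
  { intros z Hz eps He. destruct (unit_disc_nbhd z Hz) as (r & Hr & N).
    set (k := ((1 - Cmod (w z)) / 3)%R).
    assert (Hk : (0 < k)%R) by apply (SB z z Hz Hz).
    destruct (analytic_cont p z Hp Hz (eps * k)%R) as (d & Hd & K); [nra|].
    exists (Rmin r d). split; [apply Rmin_pos; assumption|].
    intros y Hy. assert (Uy := N y (Rlt_le_trans _ _ _ Hy (Rmin_l _ _))).
    assert (Ky := K y (Rlt_le_trans _ _ _ Hy (Rmin_r _ _))).
    rewrite (Diff y z Uy Hz), Cmod_mult in Ky.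
    assert (S1 := SB y z Uy Hz). fold k in S1.
    assert (P := Cmod_ge_0 (w y - w z)).
    apply Rmult_lt_reg_r with k; [exact Hk|]. nra. }
  assert (Dw : forall z, unit_disc z ->
     Cderiv w z (C_derive p z / nephroid_slope (w z) (w z))).
  { intros z Hz. destruct (unit_disc_nbhd z Hz) as (r & Hr & N).
    destruct (analytic_Cderiv p z Hp Hz) as (q & Eq & E0 & Cq).
    set (f := fun h => q h / nephroid_slope (w (z + h)) (w z)).
    assert (Cz : Ccont (fun h => w (z + h)) 0).
    { apply (Ccont_comp w (fun h => z + h)).
      - apply Ccont_plus; [apply Ccont_const|apply Ccont_id].
      - rewrite Cplus_0_r. apply Cw, Hz. }
    replace (C_derive p z / nephroid_slope (w z) (w z)) with (f 0)
      by (unfold f; rewrite Cplus_0_r, E0; reflexivity).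
    apply Cderiv_loc with r; [exact Hr| |].
    - intros h Hh. assert (Uh : unit_disc (z + h)).
      { apply N. replace (z + h - z) with h by ring. exact Hh. }
      assert (D := Diff _ _ Uh Hz). rewrite Eq in D.
      unfold f. replace (q h / nephroid_slope (w (z + h)) (w z) * h)
        with ((p z + q h * h - p z) / nephroid_slope (w (z + h)) (w z))
        by (field; exact (SN _ _ Uh Hz)).
      rewrite D. field. exact (SN _ _ Uh Hz).
    - apply Ccont_mult; [exact Cq|].
      apply (Ccont_inv (fun h => nephroid_slope (w (z + h)) (w z))).
      + apply Ccont_plus; [apply Ccont_const|]. apply Ccont_opp.
        apply Ccont_mult; [|apply Ccont_const].
        apply Ccont_plus; [apply Ccont_plus|apply Ccont_const];
          apply Ccont_mult; auto using Ccont_const.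
      + rewrite Cplus_0_r. exact (SN z z Hz Hz). }
  split; [exact Hp|split].
  { apply analytic_minus; [apply analytic_plus; [apply analytic_const|apply analytic_id]|].
    apply analytic_mult; [|apply analytic_const]. apply (analytic_pow (fun z => z)), analytic_id. }
  exists w. split; [|split; [|split]].
  - apply analytic_of_C1 with (1 := Dw). intros z Hz.
    apply Ccont_mult; [apply analytic_cont; auto using analytic_derive|].
    apply (Ccont_inv (fun z => nephroid_slope (w z) (w z))); [|exact (SN z z Hz Hz)].
    apply Ccont_plus; [apply Ccont_const|]. apply Ccont_opp.
    apply Ccont_mult; [|apply Ccont_const].
    apply Ccont_plus; [apply Ccont_plus|]; apply Ccont_mult; auto.
  - apply nephroid_inj; [apply Hw, unit_disc_0|apply unit_disc_0|].
    rewrite (proj2 (Hw 0 unit_disc_0)), P0. unfold Cdiv. ring.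
  - intros z Hz. apply Hw, Hz.
  - intros z Hz. replace (p z) with (1 + (p z - 1)) by ring.
    rewrite <- (proj2 (Hw z Hz)), <- phi_Ne_minus_1. ring.
Qed.

(** For [x = a + i b] the imaginary part [b (1 - a^2 + b^2 / 3)] vanishes in the disc only when
    [b = 0], and then [5/3 - y = (1 - a)^2 (a + 2) / 3]. *)
Lemma phi_Ne_real_bound (x : C) (y : R) :
  unit_disc x -> phi_Ne x = RtoC y -> (y < 5 / 3)%R.
Proof.
  intros Hx E.
  assert (E2 : x - x * x * x / 3 = RtoC (y - 1)).
  { rewrite <- phi_Ne_minus_1, E, RtoC_minus. reflexivity. }
  assert (Hm := Cmod_sqr x). assert (P := Cmod_ge_0 x). unfold unit_disc in Hx.
  set (m := Cmod x) in *. destruct x as [a b]. simpl in Hm.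
  assert (E3 : (a - (a * a * a - 3 * (a * (b * b))) / 3 = y - 1)%R).
  { apply (f_equal Re) in E2. rewrite re_RtoC in E2. rewrite <- E2.
    unfold Cdiv. rewrite <- RtoC_inv by lra. unfold Re, Cminus, Cplus, Copp, Cmult, RtoC. simpl. field. }
  assert (E4 : (b * (1 - a * a + b * b / 3) = 0)%R).
  { apply (f_equal Im) in E2. rewrite im_RtoC in E2. rewrite <- E2.
    unfold Cdiv. rewrite <- RtoC_inv by lra. unfold Im, Cminus, Cplus, Copp, Cmult, RtoC. simpl. field. }
  assert (A2 : (a * a < 1)%R) by nra.
  assert (Bz : b = 0%R).
  { apply Rmult_integral in E4. destruct E4 as [E4|E4]; [exact E4|nra]. }
  subst b. assert (Ha : (-1 < a < 1)%R) by nra.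
  assert (0 < (1 - a) * (1 - a) * (a + 2))%R by (repeat apply Rmult_lt_0_compat; lra).
  lra.
Qed.

(** * The growth function of [phi_cr] *)

(** Closed form of the integral of [(phi_cr(u) - 1) / u] over [0, t]; the 2 inside the logarithm
    normalises it to vanish at 0. *)
Definition cr_majorant (t : R) : R :=
  (t + sqrt (1 + t * t) - 1 - ln ((1 + sqrt (1 + t * t)) / 2))%R.

(** [(phi_cr(t) - 1) / t] with the root rationalised, which removes the singularity at 0. *)
Definition cr_majorant' (t : R) : R := (1 + t / (1 + sqrt (1 + t * t)))%R.

Lemma is_derive_cr_majorant (t : R) : is_derive cr_majorant t (cr_majorant' t).
Proof.
  assert (P : (0 < 1 + t * t)%R) by nra.
  assert (S := sqrt_lt_R0 _ P). assert (SS := sqrt_sqrt _ (Rlt_le _ _ P)).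
  unfold cr_majorant, cr_majorant'. auto_derive.
  - repeat split; lra.
  - set (s := sqrt (1 + t * t)) in *. field_simplify_eq; [|lra]. nra.
Qed.

Lemma cr_majorant_0 : cr_majorant 0 = 0%R.
Proof.
  unfold cr_majorant. rewrite Rmult_0_l, Rplus_0_r, sqrt_1.
  replace ((1 + 1) / 2)%R with 1%R by field. rewrite ln_1. ring.
Qed.

Lemma cr_majorant_1 : cr_majorant 1 = (sqrt 2 - ln (1 + sqrt 2) + ln 2)%R.
Proof.
  unfold cr_majorant. rewrite Rmult_1_l. replace (1 + 1)%R with 2%R by ring.
  assert (S : (0 < sqrt 2)%R) by (apply sqrt_lt_R0; lra).
  rewrite ln_div by lra. ring.
Qed.

Lemma cr_majorant_lt (s t : R) : (0 <= s < t)%R -> (cr_majorant s < cr_majorant t)%R.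
Proof.
  intro H.
  destruct (MVT_cor2 cr_majorant cr_majorant' s t) as (c & E & Hc); [lra| |].
  - intros c _. apply is_derive_Reals, is_derive_cr_majorant.
  - assert (P : (1 <= cr_majorant' c)%R).
    { unfold cr_majorant'. assert (S := sqrt_pos (1 + c * c)).
      assert (0 <= c / (1 + sqrt (1 + c * c)))%R by (apply Rdiv_le_0_compat; lra). lra. }
    nra.
Qed.

Lemma cr_majorant_1_pos : (0 < cr_majorant 1)%R.
Proof. rewrite <- cr_majorant_0. apply cr_majorant_lt. lra. Qed.

(** Carries a strict inequality from the boundary point 1 to a point inside the disc, where the
    counterexamples to smaller [beta] are evaluated. *)
Lemma cr_majorant_approx (c : R) : (c < cr_majorant 1)%R ->
  exists x, (0 < x < 1)%R /\ (c < cr_majorant x)%R.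
Proof.
  intro H.
  assert (K : continuous cr_majorant 1%R).
  { apply (ex_derive_continuous (K := R_AbsRing) (V := R_NormedModule)).
    eexists. apply is_derive_cr_majorant. }
  assert (Pc : (0 < cr_majorant 1 - c)%R) by lra.
  destruct (proj1 (filterlim_locally cr_majorant (cr_majorant 1)) K
             (mkposreal _ Pc)) as [d Hd].
  assert (Pd := cond_pos d).
  set (x := (1 - Rmin (d / 2) (1 / 2))%R).
  assert (M : (0 < Rmin (d / 2) (1 / 2) <= 1 / 2)%R /\ (Rmin (d / 2) (1 / 2) <= d / 2)%R).
  { split; [split; [apply Rmin_pos; lra|apply Rmin_r]|apply Rmin_l]. }
  exists x. split; [unfold x; lra|].
  assert (B : Rabs (x - 1) < d).
  { unfold x. rewrite Rabs_left; lra. }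
  assert (E := Hd x B). change (Rabs (cr_majorant x - cr_majorant 1) < cr_majorant 1 - c)%R in E.
  apply Rabs_lt_between in E. lra.
Qed.

(* Since [|w z| <= |z|], the derivative of [h] is at most that of the majorant
   on each radius. *)
Lemma cr_growth (h w : C -> C) (beta : R) :
  (0 < beta)%R -> analytic_on_disc h -> h 0 = 0 ->
  (forall z, unit_disc z -> (Cmod (w z) <= Cmod z)%R) ->
  (forall z, unit_disc z -> RtoC beta * (z * C_derive h z) = phi_cr (w z) - 1) ->
  forall z, unit_disc z -> (Cmod (h z) < cr_majorant 1 / beta)%R.
Proof.
  intros Hb Hh H0 Hw E z Hz.
  assert (K : (Cmod (h z - h 0)%C <= cr_majorant (Cmod z) / beta - cr_majorant 0 / beta)%R).
  { apply (radial_bound h (C_derive h) (fun t => cr_majorant t / beta)%R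
             (fun t => cr_majorant' t / beta)%R).
    - intros x Hx. apply analytic_Cderiv; assumption.
    - intros t _. unfold Rdiv. rewrite (Rmult_comm (cr_majorant' t)).
      apply is_derive_ext with (fun t => / beta * cr_majorant t)%R; [intro u; apply Rmult_comm|].
      apply is_derive_scal, is_derive_cr_majorant.
    - intros x Hx Nx.
      assert (B := phi_cr_bound (w x)). rewrite <- (E x Hx), !Cmod_mult, Cmod_R in B.
      rewrite Rabs_pos_eq in B by lra.
      assert (Wx := Hw x Hx). unfold unit_disc in *.
      assert (Px := proj1 (Cmod_gt_0 x) Nx). assert (Pw := Cmod_ge_0 (w x)).
      specialize (B ltac:(lra)).
      set (t := Cmod x) in *.
      assert (S1 : (sqrt (1 + Cmod (w x) * Cmod (w x)) <= sqrt (1 + t * t))%R).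
      { apply sqrt_le_1_alt. nra. }
      assert (P : (0 < 1 + t * t)%R) by nra.
      assert (S := sqrt_lt_R0 _ P). assert (SS := sqrt_sqrt _ (Rlt_le _ _ P)).
      assert (Em : (t * cr_majorant' t = t + sqrt (1 + t * t) - 1)%R).
      { unfold cr_majorant'. set (s := sqrt (1 + t * t)) in *.
        apply Rmult_eq_reg_r with (1 + s)%R; [|lra]. field_simplify; [|lra]. nra. }
      apply Rmult_le_reg_l with (beta * t)%R; [nra|].
      replace (beta * t * (cr_majorant' t / beta))%R with (t * cr_majorant' t)%R
        by (field; lra).
      rewrite Em. lra.
    - exact Hz. }
  replace (h z - h 0) with (h z) in K by (rewrite H0; ring).
  rewrite cr_majorant_0 in K.
  assert (L : (cr_majorant (Cmod z) < cr_majorant 1)%R).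
  { apply cr_majorant_lt. split; [apply Cmod_ge_0|exact Hz]. }
  assert (Ib := Rinv_0_lt_compat beta Hb). unfold Rdiv in *. nra.
Qed.

(** * The logarithmic derivative *)

(** Writing [f = z g] with [g] free of zeros turns [zdlog f] into [f' / g], which also has the right
    value at 0. *)
Lemma analytic_zdlog (f : C -> C) :
  class_A f -> zdlog_defined f -> analytic_on_disc (zdlog f).
Proof.
  intros (Hf & F0 & F1) N.
  destruct (analytic_div_id f Hf F0) as (g & Hg & G0 & Eg).
  assert (Ng : forall z, unit_disc z -> g z <> 0).
  { intros z Hz E. destruct (Ceq_dec z 0) as [->|Nz].
    - apply C1_nz. rewrite <- F1, <- G0. exact E.
    - apply (N z Hz Nz). rewrite (Eg z Hz), E. ring. }
  apply analytic_ext with (fun z => C_derive f z * / g z).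
  - intros z Hz. unfold zdlog. destruct (Ceq_dec z 0) as [->|Nz].
    + rewrite G0, F1. apply Cinv_r, C1_nz.
    + rewrite (Eg z Hz). field. split; [exact (Ng z Hz)|exact Nz].
  - apply analytic_mult; [apply analytic_derive, Hf|]. apply analytic_inv; assumption.
Qed.

Lemma zdlog_0 (f : C -> C) : zdlog f 0 = 1.
Proof. unfold zdlog. destruct (Ceq_dec 0 0); congruence. Qed.

Lemma zdlog_neq_0 (f : C -> C) (z : C) :
  calG_defined f -> unit_disc z -> zdlog f z <> 0.
Proof.
  intros [N N'] Hz. unfold zdlog. destruct (Ceq_dec z 0) as [_|Nz]; [exact C1_nz|].
  apply Cmult_neq_0; [apply Cmult_neq_0; auto|].
  intro E. apply C1_nz. rewrite <- (Cinv_r (f z)) by auto. rewrite E. ring.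
Qed.

Lemma calG_zdlog (f : C -> C) (z : C) :
  class_A f -> calG_defined f -> unit_disc z ->
  calG f z * zdlog f z = z * C_derive (zdlog f) z.
Proof.
  intros (Hf & F0 & F1) [N N'] Hz. unfold calG.
  destruct (Ceq_dec z 0) as [->|Nz].
  { rewrite zdlog_0. unfold Cdiv. ring. }
  assert (D : Cderiv (zdlog f) z
    (((1 * C_derive f z + z * C_derive (C_derive f) z) * f z - z * C_derive f z * C_derive f z)
       / (f z * f z))).
  (* The ball of radius [|z|] around [z] omits the origin, so the filled-in value does not
     interfere. *)
  { apply Cderiv_ext_loc with (fun y => y * C_derive f y / f y) (Cmod z).
    - apply Cmod_gt_0, Nz.
    - intros y Hy. unfold zdlog. destruct (Ceq_dec y 0) as [->|_]; [|reflexivity].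
      replace (0 - z) with (- z) in Hy by ring. rewrite Cmod_opp in Hy. lra.
    - apply (Cderiv_div (fun y => y * C_derive f y) f).
      + apply (Cderiv_mult (fun y => y)); [apply Cderiv_id|].
        apply analytic_Cderiv; [apply analytic_derive, Hf|exact Hz].
      + apply analytic_Cderiv; assumption.
      + exact (N z Hz Nz). }
  rewrite (Cderiv_unique_derive _ _ _ D). unfold zdlog.
  destruct (Ceq_dec z 0) as [E|_]; [contradiction|].
  field. split; [exact (N z Hz Nz)|exact (N' z Hz)].
Qed.

Lemma starlike_Ne_of_disc (f : C -> C) :
  class_A f -> zdlog_defined f ->
  (forall z, unit_disc z -> (Cmod (zdlog f z - 1)%C < 2 / 3)%R) -> starlike_Ne f.
Proof.
  intros Hf N B. split; [exact Hf|split; [exact N|]].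
  apply subordinate_phi_Ne; [apply analytic_zdlog; assumption|apply zdlog_0|exact B].
Qed.

(* [f = z exp (int (q - 1) / z)] has logarithmic derivative [q]. *)
Lemma exists_zdlog (q : C -> C) :
  analytic_on_disc q -> q 0 = 1 -> (forall z, unit_disc z -> q z <> 0) ->
  exists f, class_A f /\ calG_defined f /\ (forall z, unit_disc z -> zdlog f z = q z).
Proof.
  intros Hq Q0 Nq.
  destruct (analytic_div_id (fun z => q z - 1)) as (g & Hg & _ & Eg).
  { apply analytic_minus; [exact Hq|apply analytic_const]. }
  { rewrite Q0. ring. }
  destruct (analytic_primitive g Hg) as (G & HG & G0 & DG).
  set (f := fun z => z * Cexp (G z)).
  assert (Df : forall z, unit_disc z -> C_derive f z = Cexp (G z) * q z).
  { intros z Hz. apply Cderiv_unique_derive.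
    replace (q z) with (1 + z * g z) by (rewrite <- (Eg z Hz); ring).
    replace (Cexp (G z) * (1 + z * g z)) with (1 * Cexp (G z) + z * (Cexp (G z) * g z)) by ring.
    apply (Cderiv_mult (fun z => z) (fun z => Cexp (G z))); [apply Cderiv_id|].
    apply (Cderiv_comp Cexp G); [apply Cderiv_Cexp|apply DG, Hz]. }
  assert (Nf : zdlog_defined f).
  { intros z Hz Nz. apply Cmult_neq_0; [exact Nz|apply Cexp_neq_0]. }
  exists f. split; [split; [|split]|split; [split|]].
  - apply analytic_mult; [apply analytic_id|apply analytic_Cexp, HG].
  - unfold f. ring.
  - rewrite (Df 0 unit_disc_0), G0, Cexp_0, Q0. ring.
  - exact Nf.
  - intros z Hz. rewrite (Df z Hz). apply Cmult_neq_0; [apply Cexp_neq_0|apply Nq, Hz].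
  - intros z Hz. unfold zdlog. destruct (Ceq_dec z 0) as [->|Nz]; [symmetry; exact Q0|].
    rewrite (Df z Hz). unfold f. field. split; [apply Cexp_neq_0|exact Nz].
Qed.

Lemma C_derive_ext (f g : C -> C) (z : C) :
  analytic_on_disc g -> (forall y, unit_disc y -> f y = g y) -> unit_disc z ->
  C_derive f z = C_derive g z.
Proof.
  intros Hg E Hz. apply Cderiv_unique_derive.
  apply Cderiv_ext_disc with g; [intros; symmetry; auto|exact Hz|].
  apply analytic_Cderiv; assumption.
Qed.

(** Common frame of the three counterexamples: [q] is the prescribed [z f' / f], the hypothesis on
    [lhs] holds with the identity as Schwarz function, and [y] is a real value of [q] that [phi_Ne]
    cannot take. *)
Lemma not_sufficient_from (lhs : R -> (C -> C) -> C -> C) (beta1 beta x y : R) (q : C -> C) :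
  (beta1 <= beta)%R ->
  analytic_on_disc q -> q 0 = 1 -> (forall z, unit_disc z -> q z <> 0) ->
  (forall f, (forall z, unit_disc z -> zdlog f z = q z) ->
     (forall z, unit_disc z -> calG f z * q z = z * C_derive q z) ->
     forall z, unit_disc z -> lhs beta f z = phi_cr z) ->
  (0 < x < 1)%R -> q (RtoC x) = RtoC y -> (5 / 3 < y)%R ->
  ~ sufficient_from lhs beta1.
Proof.
  intros Hb Hq Q0 Nq HL Hx Ey Hy Suf.
  destruct (exists_zdlog q Hq Q0 Nq) as (f & Af & Gf & Zf).
  assert (L : forall z, unit_disc z -> lhs beta f z = phi_cr z).
  { apply HL; [exact Zf|]. intros z Hz.
    rewrite <- (Zf z Hz), (calG_zdlog f z Af Gf Hz).
    rewrite (C_derive_ext (zdlog f) q z Hq Zf Hz). reflexivity. }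
  assert (Ux : unit_disc (RtoC x)).
  { unfold unit_disc. rewrite Cmod_R, Rabs_pos_eq; lra. }
  destruct (Suf f beta Af Hb Gf) as (_ & _ & _ & _ & w & _ & _ & Bw & Ew).
  - split; [|split; [exact analytic_phi_cr|]].
    + apply analytic_ext with phi_cr; [intros z Hz; symmetry; auto|exact analytic_phi_cr].
    + exists (fun z => z). split; [exact analytic_id|split; [reflexivity|split]].
      * intros z Hz. exact Hz.
      * exact L.
  - assert (K := phi_Ne_real_bound (w (RtoC x)) y (Bw _ Ux)).
    rewrite <- (Ew _ Ux), (Zf _ Ux) in K. specialize (K Ey). lra.
Qed.

(** * The extremal function *)

(** [H] is the primitive of [(phi_cr - 1) / z], rationalised as in [cr_majorant']. Equality with the
    majorant on [0, 1) shows that [cr_growth] is optimal. *)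
Lemma cr_extremal : exists H : C -> C,
  analytic_on_disc H /\ H 0 = 0 /\
  (forall z, unit_disc z -> z * C_derive H z = phi_cr z - 1) /\
  (forall z, unit_disc z -> (Cmod (H z) < cr_majorant 1)%R) /\
  (forall x : R, (0 <= x < 1)%R -> H (RtoC x) = RtoC (cr_majorant x)).
Proof.
  assert (N : forall z, unit_disc z -> 1 + cr_root z <> 0).
  { intros z Hz. apply Re_pos_neq_0. rewrite re_plus, re_RtoC.
    generalize (Re_cr_root_pos z Hz). lra. }
  set (g := fun z => 1 + z * / (1 + cr_root z)).
  assert (Hg : analytic_on_disc g).
  { apply analytic_plus; [apply analytic_const|].
    apply analytic_mult; [apply analytic_id|]. apply analytic_inv; [|exact N].
    apply analytic_plus; [apply analytic_const|apply analytic_cr_root]. }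
  destruct (analytic_primitive g Hg) as (H & HH & H0 & DH).
  assert (Eg : forall z, unit_disc z -> z * C_derive H z = phi_cr z - 1).
  { intros z Hz. rewrite (Cderiv_unique_derive _ _ _ (DH z Hz)).
    unfold g. replace (phi_cr z) with (z + cr_root z) by reflexivity.
    assert (S := cr_root_sqr z). specialize (N z Hz). set (s := cr_root z) in *.
    replace (z * (1 + z * / (1 + s))) with (z + (1 + z * z - 1) * / (1 + s)) by ring.
    rewrite <- S. field. exact N. }
  exists H. split; [exact HH|split; [exact H0|split; [exact Eg|split]]].
  - intros z Hz. replace (cr_majorant 1) with (cr_majorant 1 / 1)%R by field.
    apply (cr_growth H (fun z => z)); auto; [lra|intros; lra|].
    intros y Hy. rewrite <- (Eg y Hy). ring.
  - intros x Hx. destruct (Rle_lt_or_eq_dec 0 x (proj1 Hx)) as [Px|<-].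
    2:{ rewrite cr_majorant_0. exact H0. }
    assert (U : forall t, (0 <= t <= x)%R -> unit_disc (RtoC t)).
    { intros t Ht. unfold unit_disc. rewrite Cmod_R, Rabs_pos_eq; lra. }
    assert (Gt : forall t, g (RtoC t) = RtoC (cr_majorant' t)).
    { intro t. unfold g, cr_root, cr_majorant'.
      replace (1 + RtoC t ^ 2) with (RtoC (1 + t * t))
        by (rewrite RtoC_plus, RtoC_mult; simpl; ring).
      assert (P : (0 <= 1 + t * t)%R) by nra.
      rewrite Csqrt_RtoC by exact P. assert (S := sqrt_pos (1 + t * t)).
      rewrite <- RtoC_plus, <- RtoC_inv, <- RtoC_mult, <- RtoC_plus by lra. reflexivity. }
    assert (K : forall p : C -> R, (p = Re \/ p = Im) ->
      p (H (RtoC x)) = p (RtoC (cr_majorant x))).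
    { intros p Hp.
      destruct (MVT_cor2 (fun t => p (H (RtoC t)) - p (RtoC (cr_majorant t)))%R
        (fun t => 0%R) 0 x Px) as (c & E & _).
      - intros t Ht. apply is_derive_Reals.
        replace 0%R with (p (RtoC (cr_majorant' t)) - p (RtoC (cr_majorant' t)))%R by ring.
        apply (is_derive_minus (K := R_AbsRing) (V := R_NormedModule)
          (fun t => p (H (RtoC t))) (fun t => p (RtoC (cr_majorant t)))).
        + rewrite <- Gt.
          destruct (Cderiv_real H t _ (DH _ (U t Ht))) as [D1 D2].
          destruct Hp as [-> | ->]; assumption.
        + destruct Hp as [-> | ->].
          * apply is_derive_ext with cr_majorant; [reflexivity|].
            exact (is_derive_cr_majorant t).
          * apply (is_derive_const (K := R_AbsRing) (V := R_NormedModule) 0%R).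
      - rewrite cr_majorant_0, H0 in E. lra. }
    apply injective_projections; [apply (K Re)|apply (K Im)]; auto.
Qed.

(** * Thresholds for [beta] *)

(** Here [c] is the largest admissible [|h|]. The factor 9/10 keeps [beta] positive even for
    negative [beta1], and [10/9 c] is still below 1 for [c = 2/3] and below 1/2 for [c = 2/5], so
    that the functions built from [H] have no zeros or poles. *)
Lemma sharpness_parameter (beta0 beta1 c : R) :
  (0 < beta0)%R -> (beta1 < beta0)%R -> (beta0 * c = cr_majorant 1)%R -> (0 < c)%R ->
  exists beta x, (0 < beta)%R /\ (beta1 <= beta)%R /\ (0 < x < 1)%R /\
    (c < cr_majorant x / beta)%R /\ (cr_majorant 1 / beta <= 10 / 9 * c)%R.
Proof.
  intros H0 H1 E Hc. set (beta := Rmax beta1 (9 / 10 * beta0)).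
  assert (B : (beta1 <= beta)%R /\ (9 / 10 * beta0 <= beta)%R /\ (beta < beta0)%R).
  { split; [apply Rmax_l|split; [apply Rmax_r|]]. apply Rmax_lub_lt; lra. }
  destruct (cr_majorant_approx (beta * c)) as (x & Hx & Lx); [nra|].
  assert (Pb : (0 < beta)%R) by lra.
  exists beta, x. split; [exact Pb|split; [apply B|split; [exact Hx|split]]].
  - apply Rmult_lt_reg_r with beta; [exact Pb|].
    replace (cr_majorant x / beta * beta)%R with (cr_majorant x) by (field; lra). lra.
  - apply Rmult_le_reg_r with beta; [exact Pb|].
    replace (cr_majorant 1 / beta * beta)%R with (cr_majorant 1) by (field; lra).
    rewrite <- E. nra.
Qed.

Lemma majorant_quotient_le (beta0 beta c : R) :
  (0 < beta0)%R -> (beta0 * c = cr_majorant 1)%R -> (0 < c)%R -> (beta0 <= beta)%R ->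
  (cr_majorant 1 / beta <= c)%R.
Proof.
  intros H0 E Hc Hb. apply Rmult_le_reg_r with beta; [lra|].
  replace (cr_majorant 1 / beta * beta)%R with (cr_majorant 1) by (field; lra).
  rewrite <- E. nra.
Qed.

(** [radial_bound] works inside the open unit disc, so [h] is reached as the value of [2 h z] at
    [z = 1/2]. *)
Lemma Cmod_Cexp_minus_1 (h : C) : (Cmod (Cexp h - 1)%C <= exp (Cmod h) - 1)%R.
Proof.
  set (r := Cmod h). assert (Hr : (0 <= r)%R) by apply Cmod_ge_0.
  set (k := RtoC 2 * h).
  assert (Half : unit_disc (RtoC (1 / 2))).
  { unfold unit_disc. rewrite Cmod_R, Rabs_pos_eq; lra. }
  assert (K := radial_bound (fun z => Cexp (k * z)) (fun z => Cexp (k * z) * (k * 1))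
    (fun t => exp (2 * r * t)) (fun t => 2 * r * exp (2 * r * t))%R).
  assert (Mk : Cmod k = (2 * r)%R).
  { unfold k. rewrite Cmod_mult, Cmod_R, Rabs_pos_eq by lra. reflexivity. }
  specialize (fun A B D => K A B D _ Half). cbv beta in K.
  rewrite Cmod_R, Rabs_pos_eq in K by lra.
  replace (k * RtoC (1 / 2)) with h in K.
  2:{ unfold k. replace (RtoC 2 * h * RtoC (1 / 2)) with (h * (RtoC 2 * RtoC (1 / 2))) by ring.
      rewrite <- RtoC_mult. replace (2 * (1 / 2))%R with 1%R by field. ring. }
  replace (k * 0) with (RtoC 0) in K by ring. rewrite Cexp_0 in K.
  replace (2 * r * (1 / 2))%R with r in K by field. rewrite Rmult_0_r, exp_0 in K.
  apply K.
  - intros z _. apply (Cderiv_comp Cexp (fun z => k * z)); [apply Cderiv_Cexp|].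
    apply Cderiv_scal, Cderiv_id.
  - intros t _. auto_derive; [exact I|ring].
  - intros z _ _. rewrite !Cmod_mult, Cmod_Cexp, Cmod_1, Mk, Rmult_1_r, Rmult_comm.
    apply Rmult_le_compat_l; [lra|].
    assert (X := re_le_Cmod (k * z)). rewrite Cmod_mult, Mk in X.
    assert (Y := Rle_abs (Re (k * z))).
    destruct (Rle_lt_or_eq_dec (Re (k * z)) (2 * r * Cmod z)) as [L|E]; [lra| |].
    - left. apply exp_increasing, L.
    - rewrite E. lra.
Qed.

(** * The three conditions *)

Lemma sharp_case_product :
  sharp_sufficient_from
    (fun beta f z => 1 + RtoC beta * calG f z * zdlog f z)
    (3 * (sqrt 2 - ln (1 + sqrt 2) + ln 2) / 2)%R.
Proof.
  rewrite <- cr_majorant_1. set (b0 := (3 * cr_majorant 1 / 2)%R).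
  assert (P := cr_majorant_1_pos).
  assert (Hb0 : (0 < b0)%R) by (unfold b0; lra).
  assert (E0 : (b0 * (2 / 3) = cr_majorant 1)%R) by (unfold b0; field).
  split.
  - intros f beta Af Hb Gf (_ & _ & w & Hw & W0 & Bw & Ew).
    apply starlike_Ne_of_disc; [exact Af|apply Gf|]. intros z Hz.
    assert (Hp := analytic_zdlog f Af (proj1 Gf)).
    eapply Rlt_le_trans; [|apply (majorant_quotient_le b0 beta (2 / 3)); lra].
    apply (cr_growth (fun z => zdlog f z - 1) w); [lra| | | | |exact Hz].
    + apply analytic_minus; [exact Hp|apply analytic_const].
    + rewrite zdlog_0. ring.
    + apply schwarz_lemma; assumption.
    + intros y Hy. rewrite <- (Ew y Hy).
      replace (C_derive (fun z => zdlog f z - 1) y) with (C_derive (zdlog f) y).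
      * rewrite <- (calG_zdlog f y Af Gf Hy). ring.
      * symmetry. apply Cderiv_unique_derive.
        replace (C_derive (zdlog f) y) with (C_derive (zdlog f) y - 0) by ring.
        apply Cderiv_minus; [apply analytic_Cderiv; assumption|apply Cderiv_const].
  - intros beta1 H1.
    destruct (sharpness_parameter b0 beta1 (2 / 3) Hb0 H1 E0 ltac:(lra))
      as (beta & x & Pb & Hb & Hx & Lx & Ub).
    destruct cr_extremal as (H & HH & H0 & EH & BH & RH).
    assert (NB : RtoC beta <> 0) by (intro X; apply RtoC_inj in X; lra).
    (* [q = 1 + H / beta] solves [beta z q' = phi_cr - 1]; at [x] it exceeds [1 + 2/3]. *)
    apply (not_sufficient_from _ beta1 beta x (1 + cr_majorant x / beta)
             (fun z => 1 + / RtoC beta * H z)); [exact Hb| | | | |exact Hx| |lra].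
    + apply analytic_plus; [apply analytic_const|].
      apply analytic_mult; [apply analytic_const|exact HH].
    + rewrite H0. ring.
    (* A zero of [q] would give [|H / beta| = 1], while the bound is [10/9 * 2/3 = 20/27]. *)
    + intros z Hz E.
      assert (X : (Cmod (/ RtoC beta * H z) < 1)%R).
      { rewrite Cmod_mult, Cmod_inv, Cmod_R, Rabs_pos_eq by (exact NB || lra).
        specialize (BH z Hz). assert (Ib := Rinv_0_lt_compat beta Pb).
        unfold Rdiv in Ub. nra. }
      replace (/ RtoC beta * H z) with (1 + / RtoC beta * H z - 1) in X by ring.
      rewrite E in X. replace (0 - 1) with (- (1)) in X by ring.
      rewrite Cmod_opp, Cmod_1 in X. lra.
    + intros f Zf Gf z Hz.
      replace (RtoC beta * calG f z * zdlog f z) with (RtoC beta * (calG f z * zdlog f z)) by ring.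
      rewrite (Zf z Hz), (Gf z Hz).
      rewrite (Cderiv_unique_derive (fun z => 1 + / RtoC beta * H z) z (0 + / RtoC beta * C_derive H z)).
      * replace (1 + RtoC beta * (z * (0 + / RtoC beta * C_derive H z)))
          with (1 + z * C_derive H z) by (field; exact NB).
        rewrite (EH z Hz). ring.
      * apply Cderiv_plus; [apply Cderiv_const|]. apply Cderiv_scal, analytic_Cderiv; assumption.
    + rewrite RH by lra. rewrite RtoC_plus, RtoC_div by lra. unfold Cdiv. ring.
Qed.

Lemma sharp_case_plain :
  sharp_sufficient_from
    (fun beta f z => 1 + RtoC beta * calG f z)
    ((sqrt 2 + ln 2 - ln (1 + sqrt 2)) / ln (5 / 3))%R.
Proof.
  replace (sqrt 2 + ln 2 - ln (1 + sqrt 2))%R with (cr_majorant 1)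
    by (rewrite cr_majorant_1; ring).
  assert (Pl : (0 < ln (5 / 3))%R) by (rewrite <- ln_1; apply ln_increasing; lra).
  set (b0 := (cr_majorant 1 / ln (5 / 3))%R).
  assert (P := cr_majorant_1_pos).
  assert (Hb0 : (0 < b0)%R) by (apply Rdiv_lt_0_compat; assumption).
  assert (E0 : (b0 * ln (5 / 3) = cr_majorant 1)%R) by (unfold b0; field; lra).
  split.
  - intros f beta Af Hb Gf (_ & _ & w & Hw & W0 & Bw & Ew).
    apply starlike_Ne_of_disc; [exact Af|apply Gf|]. intros z Hz.
    set (p := zdlog f).
    assert (Hp : analytic_on_disc p) by exact (analytic_zdlog f Af (proj1 Gf)).
    assert (Np : forall z, unit_disc z -> p z <> 0) by (intros y Hy; apply zdlog_neq_0; assumption).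
    (* A branch of [log p], obtained as a primitive of [p' / p]. That it is one is verified in [Ex]:
       the derivative of [p exp(-h)] vanishes. *)
    destruct (analytic_primitive (fun z => C_derive p z * / p z)) as (h & Hh & H0 & Dh).
    { apply analytic_mult; [apply analytic_derive, Hp|apply analytic_inv; assumption]. }
    assert (Bh : (Cmod (h z) < ln (5 / 3))%R).
    { eapply Rlt_le_trans; [|apply (majorant_quotient_le b0 beta (ln (5 / 3))); lra].
      apply (cr_growth h w); [lra|exact Hh|exact H0| | |exact Hz].
      - apply schwarz_lemma; assumption.
      - intros y Hy. rewrite <- (Ew y Hy), (Cderiv_unique_derive _ _ _ (Dh y Hy)).
        replace (RtoC beta * (y * (C_derive p y * / p y)))
          with (RtoC beta * (y * C_derive p y) * / p y) by ring.
        unfold p. rewrite <- (calG_zdlog f y Af Gf Hy). field. apply (Np y Hy). }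
    assert (Ex : p z = Cexp (h z)).
    { assert (K := derive_0_const (fun z => p z * Cexp (- h z))).
      assert (K2 : p z * Cexp (- h z) = 1).
      { rewrite K; [|intros y Hy|exact Hz].
        - unfold p. rewrite zdlog_0, H0. replace (- 0) with (RtoC 0) by ring.
          rewrite Cexp_0. ring.
        - replace (RtoC 0) with (C_derive p y * Cexp (- h y)
             + p y * (Cexp (- h y) * - (C_derive p y * / p y)))
            by (field; exact (Np y Hy)).
          apply (Cderiv_mult p (fun z => Cexp (- h z))); [apply analytic_Cderiv; assumption|].
          apply (Cderiv_comp Cexp (fun z => - h z)); [apply Cderiv_Cexp|].
          apply Cderiv_opp, Dh, Hy. }
      replace (Cexp (h z)) with (p z * Cexp (- h z) * Cexp (h z)) by (rewrite K2; ring).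
      rewrite <- Cmult_assoc, <- Cexp_plus.
      replace (- h z + h z) with (RtoC 0) by ring. rewrite Cexp_0. ring. }
    change (zdlog f z) with (p z). rewrite Ex.
    (* [exp |h| - 1 < 5/3 - 1], which is where [log (5/3)] comes from. *)
    eapply Rle_lt_trans; [apply Cmod_Cexp_minus_1|].
    apply exp_increasing in Bh. rewrite exp_ln in Bh by lra. lra.
  - intros beta1 H1.
    destruct (sharpness_parameter b0 beta1 (ln (5 / 3)) Hb0 H1 E0 Pl)
      as (beta & x & Pb & Hb & Hx & Lx & Ub).
    destruct cr_extremal as (H & HH & H0 & EH & BH & RH).
    assert (NB : RtoC beta <> 0) by (intro X; apply RtoC_inj in X; lra).
    (* [q = exp (H / beta)] solves [beta z q' / q = phi_cr - 1]; at [x] the exponent exceeds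
       [log (5/3)]. *)
    apply (not_sufficient_from _ beta1 beta x (exp (cr_majorant x / beta))
             (fun z => Cexp (/ RtoC beta * H z))); [exact Hb| | | | |exact Hx| |].
    + apply analytic_Cexp, analytic_mult; [apply analytic_const|exact HH].
    + rewrite H0, Cmult_0_r. apply Cexp_0.
    + intros z Hz. apply Cexp_neq_0.
    + intros f Zf Gf z Hz. specialize (Gf z Hz).
      rewrite (Cderiv_unique_derive (fun z => Cexp (/ RtoC beta * H z)) z
        (Cexp (/ RtoC beta * H z) * (/ RtoC beta * C_derive H z))) in Gf.
      * assert (NE := Cexp_neq_0 (/ RtoC beta * H z)).
        set (e := Cexp (/ RtoC beta * H z)) in *.
        replace (calG f z) with (calG f z * e * / e) by (field; exact NE).
        rewrite Gf. replace (1 + RtoC beta * (z * (e * (/ RtoC beta * C_derive H z)) * / e))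
          with (1 + z * C_derive H z) by (field; split; assumption).
        rewrite (EH z Hz). ring.
      * apply (Cderiv_comp Cexp (fun z => / RtoC beta * H z)); [apply Cderiv_Cexp|].
        apply Cderiv_scal, analytic_Cderiv; assumption.
    + rewrite RH by lra. rewrite <- RtoC_inv, <- RtoC_mult by lra.
      unfold Cexp. rewrite re_RtoC, im_RtoC, cos_0, sin_0. unfold RtoC. f_equal; [|ring].
      rewrite Rmult_1_r. f_equal. field. lra.
    + apply exp_increasing in Lx. rewrite exp_ln in Lx by lra. exact Lx.
Qed.

Lemma sharp_case_quotient :
  sharp_sufficient_from
    (fun beta f z => 1 + RtoC beta * calG f z * / zdlog f z)
    (5 * (sqrt 2 - ln (1 + sqrt 2) + ln 2) / 2)%R.
Proof.
  rewrite <- cr_majorant_1. set (b0 := (5 * cr_majorant 1 / 2)%R).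
  assert (P := cr_majorant_1_pos).
  assert (Hb0 : (0 < b0)%R) by (unfold b0; lra).
  assert (E0 : (b0 * (2 / 5) = cr_majorant 1)%R) by (unfold b0; field).
  split.
  - intros f beta Af Hb Gf (_ & _ & w & Hw & W0 & Bw & Ew).
    apply starlike_Ne_of_disc; [exact Af|apply Gf|]. intros z Hz.
    set (p := zdlog f).
    assert (Hp : analytic_on_disc p) by exact (analytic_zdlog f Af (proj1 Gf)).
    assert (Np : forall z, unit_disc z -> p z <> 0) by (intros y Hy; apply zdlog_neq_0; assumption).
    assert (Bh : (Cmod (1 - / p z)%C < 2 / 5)%R).
    { eapply Rlt_le_trans; [|apply (majorant_quotient_le b0 beta (2 / 5)); lra].
      apply (cr_growth (fun z => 1 - / p z) w); [lra| | | | |exact Hz].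
      - apply analytic_minus; [apply analytic_const|apply analytic_inv; assumption].
      - unfold p. rewrite zdlog_0. field.
      - apply schwarz_lemma; assumption.
      - intros y Hy. rewrite <- (Ew y Hy).
        rewrite (Cderiv_unique_derive (fun z => 1 - / p z) y (0 - - C_derive p y / (p y * p y))).
        + replace (RtoC beta * (y * (0 - - C_derive p y / (p y * p y))))
            with (RtoC beta * (y * C_derive p y) * / (p y * p y)) by (field; exact (Np y Hy)).
          unfold p. rewrite <- (calG_zdlog f y Af Gf Hy). field. apply (Np y Hy).
        + apply Cderiv_minus; [apply Cderiv_const|]. apply Cderiv_inv; [|exact (Np y Hy)].
          apply analytic_Cderiv; assumption. }
    change (zdlog f z) with (p z). specialize (Np z Hz).
    (* From [p - 1 = u p] follows [|p - 1| <= |u| (|p - 1| + 1)], and [|u| < 2/5] gives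
       [|p - 1| < (2/5) / (3/5) = 2/3]. *)
    set (u := 1 - / p z) in *.
    assert (Ep : p z - 1 = u * p z) by (unfold u; field; exact Np).
    assert (T := Cmod_triangle (p z - 1) 1). rewrite Cmod_1 in T.
    replace (p z - 1 + 1) with (p z) in T by ring.
    assert (M : Cmod (p z - 1) = (Cmod u * Cmod (p z))%R) by (rewrite Ep; apply Cmod_mult).
    assert (Pp := proj1 (Cmod_gt_0 _) Np). assert (Pu := Cmod_ge_0 u).
    set (d := Cmod (p z - 1)) in *. nra.
  - intros beta1 H1.
    destruct (sharpness_parameter b0 beta1 (2 / 5) Hb0 H1 E0 ltac:(lra))
      as (beta & x & Pb & Hb & Hx & Lx & Ub).
    destruct cr_extremal as (H & HH & H0 & EH & BH & RH).
    assert (NB : RtoC beta <> 0) by (intro X; apply RtoC_inj in X; lra).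
    (* [10/9 * 2/5 = 4/9 < 1/2], so the denominator of [q] has no zeros. *)
    assert (Hmod : forall z, unit_disc z -> (Cmod (/ RtoC beta * H z) < 1 / 2)%R).
    { intros z Hz. rewrite Cmod_mult, Cmod_inv, Cmod_R, Rabs_pos_eq by (exact NB || lra).
      specialize (BH z Hz). assert (Ib := Rinv_0_lt_compat beta Pb).
      unfold Rdiv in Ub. nra. }
    assert (ND : forall z, unit_disc z -> 1 - / RtoC beta * H z <> 0).
    { intros z Hz E. specialize (Hmod z Hz).
      apply (proj2 (Ceq_minus _ _)) in E. rewrite <- E, Cmod_1 in Hmod. lra. }
    assert (Lx1 : (cr_majorant x / beta < 1)%R).
    { assert (L := cr_majorant_lt x 1 ltac:(lra)).
      assert (Ib := Rinv_0_lt_compat beta Pb). unfold Rdiv in *. nra. }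
    (* [q = 1 / (1 - H / beta)] solves [beta z q' / q^2 = phi_cr - 1]; at [x] it exceeds
       [1 / (1 - 2/5) = 5/3]. *)
    apply (not_sufficient_from _ beta1 beta x (/ (1 - cr_majorant x / beta))
             (fun z => / (1 - / RtoC beta * H z))); [exact Hb| | | | |exact Hx| |].
    + apply analytic_inv; [|exact ND]. apply analytic_minus; [apply analytic_const|].
      apply analytic_mult; [apply analytic_const|exact HH].
    + rewrite H0. field. exact NB.
    + intros z Hz E. apply C1_nz. rewrite <- (Cinv_r _ (ND z Hz)), E. ring.
    + intros f Zf Gf z Hz. specialize (Gf z Hz). rewrite (Zf z Hz).
      specialize (ND z Hz).
      rewrite (Cderiv_unique_derive (fun z => / (1 - / RtoC beta * H z)) z
        (- (0 - / RtoC beta * C_derive H z)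
           / ((1 - / RtoC beta * H z) * (1 - / RtoC beta * H z)))) in Gf.
      * set (u := 1 - / RtoC beta * H z) in *.
        replace (calG f z) with (calG f z * / u * u) by (field; exact ND).
        rewrite Gf.
        replace (1 + RtoC beta * (z * (- (0 - / RtoC beta * C_derive H z) / (u * u)) * u) * / / u)
          with (1 + z * C_derive H z).
        -- rewrite (EH z Hz). ring.
        -- field. split; assumption.
      * apply (Cderiv_inv (fun z => 1 - / RtoC beta * H z)); [|exact ND].
        apply Cderiv_minus; [apply Cderiv_const|]. apply Cderiv_scal, analytic_Cderiv; assumption.
    + rewrite RH by lra.
      rewrite <- RtoC_inv, <- RtoC_mult, <- RtoC_minus, <- RtoC_inv by lra.
      unfold Rdiv. rewrite (Rmult_comm (/ beta)). reflexivity.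
    + apply Rmult_lt_reg_r with (1 - cr_majorant x / beta)%R; [lra|].
      rewrite Rinv_l; lra.
Qed.

Theorem corollary3p1 :
  sharp_sufficient_from
    (fun beta f z => 1 + RtoC beta * calG f z * zdlog f z)%C
    (3 * (sqrt 2 - ln (1 + sqrt 2) + ln 2) / 2)%R
  /\
  sharp_sufficient_from
    (fun beta f z => 1 + RtoC beta * calG f z)%C
    ((sqrt 2 + ln 2 - ln (1 + sqrt 2)) / ln (5 / 3))%R
  /\
  sharp_sufficient_from
    (fun beta f z => 1 + RtoC beta * calG f z * / zdlog f z)%C
    (5 * (sqrt 2 - ln (1 + sqrt 2) + ln 2) / 2)%R.
Proof.
  exact (conj sharp_case_product (conj sharp_case_plain sharp_case_quotient)).
Qed.
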